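(* Let $G$ be a tame finite étale group scheme over $\mathbb{F}_q$, $C\subset G(-1)\setminus\{1\}$ a conjugacy-invariant subscheme which generates $G$, and $\mathcal{C}=C/G\subset\mathcal{C}_G^*$. Let $\varphi\in BG(\mathbb{F}_q)$, $\gamma\in G_\varphi(-1)(\mathbb{F}_q)$ and $\underline{n}\in\mathrm{Hom}_{\mathbb{F}_q}(\mathcal{C},\mathbb{N})$. The scheme $U(G_{\varphi}, \mathcal{C})_{\underline{n}, \gamma}$ has an $\mathbb{F}_q$-point if and only if for all $\beta \in \mathrm{Br}_{\bar{\mathcal{C}}} BG_{\mathbb{F}_q}$ we have $$\partial_\gamma(\beta)(\varphi) + \sum_{c \in \pi_0(\mathcal{C})} n_c\, \mathrm{cor}_{\mathbb{F}_q(c)/\mathbb{F}_q}(\partial_c(\beta)) = 0 \in \mathrm{H}^1(\mathbb{F}_q, \mathbb{Q}/\mathbb{Z}).$$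
   Context: Let $p$ be the characteristic of $\mathbb{F}_q$; étale schemes over $\mathbb{F}_q$ are identified with their Galois sets of $\bar{\mathbb{F}}_q$-points. Tame: $|G(\bar{\mathbb{F}}_q)|$ is coprime to $p$. Let $\hat{\mathbb{Z}}'(1):=\varprojlim_{p\nmid n}\mu_n(\bar{\mathbb{F}}_q)$, $\hat{\mathbb{Z}}':=\varprojlim_{p\nmid n}\mathbb{Z}/n$, and let $\hat{\mathbb{Z}}'^\times(1)$ be the set of topological generators of $\hat{\mathbb{Z}}'(1)$. For a prime-to-$p$ (profinite or torsion) étale group $E$ over $\mathbb{F}_q$, $E(-1)$ is the set of continuous homomorphisms $\gamma:\hat{\mathbb{Z}}'(1)\to E$ with Galois action $\gamma\mapsto\sigma\circ\gamma\circ\sigma^{-1}$; $\gamma^{-1}$ denotes $\zeta\mapsto\gamma(\zeta)^{-1}$. $\mathcal{C}_G:=G(-1)/G$, $\mathcal{C}_G^*:=\mathcal{C}_G\setminus\{1\}$; $\mathbb{F}_q(c)$ is the field of definition of $c\in\pi_0(\mathcal{C}_G^* )$ ($\pi_0$ = Frobenius orbits). $C$ generates $G$ if the images of its elements generate $G(\bar{\mathbb{F}}_q)$. $\varphi$ is a $G$-torsor over $\mathbb{F}_q$ and $G_\varphi=\mathrm{Aut}(\varphi)$ the corresponding inner twist; $C$ twists to a subset of $G_\varphi(-1)$ with the same scheme of conjugacy classes $\mathcal{C}$. $\mathrm{cor}$ is corestriction, $\mathrm{cor}_{\mathbb{F}_{q^k}/\mathbb{F}_q}(\chi)(\mathrm{Frob}_q)=\chi(\mathrm{Frob}_q^k)$.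 The scheme $U$. $\hat U(G,C)(1)$ is the prime-to-$p$ profinite group generated by symbols $[\gamma]^\zeta$, $\gamma\in C(\bar{\mathbb{F}}_q)$, $\zeta\in\hat{\mathbb{Z}}'^\times(1)$, with relations $[\gamma]^{\lambda\zeta}=([\gamma]^\zeta)^\lambda$ ($\lambda\in\hat{\mathbb{Z}}'^\times$) and $[\xi]^\eta[\gamma]^\zeta[\xi]^{-\eta}=[\xi(\eta)\gamma\xi(\eta)^{-1}]^\zeta$, with Galois action $\sigma([\gamma]^\zeta)=[\sigma(\gamma)]^{\sigma(\zeta)}$; it is a central extension of $G$ via $[\gamma]^\zeta\mapsto\gamma(\zeta)$. The homomorphism $\hat U(G,C)(1)\to\mathrm{Hom}(\mathcal{C},\hat{\mathbb{Z}}'(1))$, $[\gamma]^\zeta\mapsto\zeta\cdot\mathbf{1}_{\text{class of }\gamma}$, induces after applying $(-1)$ a map $\mathfrak{R}:\hat U(G,C)\to\mathrm{Hom}(\mathcal{C},\hat{\mathbb{Z}}')$, where $\hat U(G,C):=\hat U(G,C)(1)(-1)$; $U(G,C)$ is the preimage of $\mathrm{Hom}(\mathcal{C},\mathbb{Z})$. $U(G_\varphi,\mathcal{C})_{\underline{n},\gamma}\subset U(G_\varphi,C)$ is the subscheme of elements mapping to $\underline{n}$ under $\mathfrak{R}$ and to $\gamma^{-1}$ under the natural map to $G_\varphi(-1)$. Brauer group and residues. Let $\mathbb{Q}/\mathbb{Z}(1):=\varinjlim_{p\nmid n}\mu_n(\bar{\mathbb{F}}_q)$. $\mathrm{Br}\,BG_{\mathbb{F}_q}=\mathrm{H}^2(BG_{\mathbb{F}_q},\mathbb{G}_m)$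 is identified with the group (Baer sum) of isomorphism classes of central extensions $1\to\mathbb{Q}/\mathbb{Z}(1)\to E\to G\to1$ of group schemes over $\mathbb{F}_q$. Fibres of $E(-1)\to G(-1)$ are torsors under $\mathbb{Q}/\mathbb{Z}(1)(-1)\subset\mathbb{Q}/\mathbb{Z}$, written additively. For $c\in\pi_0(\mathcal{C}_G^* )$ the residue of $\beta=[E]$ at $c$ is algebraic if there is a subset $M_c\subset E(-1)(\bar{\mathbb{F}}_q)$, stable under conjugation by $E$, mapping bijectively onto the set of $\gamma\in G(-1)(\bar{\mathbb{F}}_q)$ whose class lies in $c$; then $\partial_c(\beta)\in\mathrm{H}^1(\mathbb{F}_q(c),\mathbb{Q}/\mathbb{Z})$ is characterized by $\sigma(M_{\bar c})=M_{\bar c}+\partial_c(\beta)(\sigma)$ for $\sigma\in\mathrm{Gal}(\bar{\mathbb{F}}_q/\mathbb{F}_q(c))$, with $M_{\bar c}\subset M_c$ the part above a geometric point $\bar c$ of $c$. $\mathrm{Br}_{\bar{\mathcal{C}}}BG_{\mathbb{F}_q}$ is the subgroup of $\beta$ whose residue at every $c\in\pi_0(\mathcal{C})$ is algebraic. For $\gamma\in G_\varphi(-1)(\mathbb{F}_q)$ the element $\partial_\gamma(\beta)(\varphi)\in\mathrm{H}^1(\mathbb{F}_q,\mathbb{Q}/\mathbb{Z})$ (the value of the residue of $\beta$ at the point $(\varphi,\gamma)$ of $[G(-1)/G]$) is $\sigma\mapsto\sigma(\tilde\gamma)-\tilde\gamma$, where $E_\varphi\to G_\varphi$ is the twist of $E\to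 G$ by $\varphi$ ($G$ acts on $E$ by conjugation) and $\tilde\gamma\in E_\varphi(-1)(\bar{\mathbb{F}}_q)$ is any lift of $\gamma$. *)

(* Defs.v *)
From HB Require Import structures.
From mathcomp Require Import all_boot all_order all_fingroup all_algebra.
From mathcomp Require Import cyclic finmap all_classical.

Set Implicit Arguments.
Unset Strict Implicit.
Unset Printing Implicit Defensive.

Import GRing.Theory.

Local Open Scope classical_set_scope.
Local Open Scope ring_scope.
Local Open Scope group_scope.

(* Throughout, [iota : F -> K] is the inclusion of a finite field of
   characteristic [p] in an algebraic closure.  Etale F-schemes are represented
   by their K-points with the continuous action of Gal(K/F), schemes of finite
   type over F being finite. *)

Section AbsoluteGaloisGroup.
Variables (F : finFieldType) (K : closedFieldType) (iota : {rmorphism F -> K}).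

Definition is_galois (s : K -> K) : Prop :=
  [/\ bijective s, zmod_morphism s, monoid_morphism s
    & forall a : F, s (iota a) = iota a].

Record absGal := AbsGal { gal_fun :> K -> K; _ : `[< is_galois gal_fun >] }.

HB.instance Definition _ := [isSub for gal_fun].
HB.instance Definition _ := [Choice of absGal by <:].

Lemma absGalP (s : absGal) : is_galois s.
Proof. by case: s => s /= /asboolP. Qed.

Fact gal_one_subproof : `[< is_galois id >].
Proof. by apply/asboolP; split=> //; exists id. Qed.

Fact gal_mul_subproof (s t : absGal) : `[< is_galois (s \o t) >].
Proof.
apply/asboolP; have [sb sD [s1 sM] sF] := absGalP s.
have [tb tD [t1 tM] tF] := absGalP t.
split; first exact: bij_comp.
- by move=> x y /=; rewrite tD sD.
- by split=> [|x y] /=; rewrite ?t1 ?s1 // tM sM.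
by move=> a /=; rewrite tF sF.
Qed.

Definition gal_inv_fun (s : absGal) (y : K) : K := xget 0%R [set x | s x = y].

Lemma gal_inv_funK (s : absGal) : cancel (gal_inv_fun s) s.
Proof.
move=> y; have [[t _ tK] _ _ _] := absGalP s.
by apply: (@xgetPex _ 0%R [set x | s x = y]); exists (t y); apply: tK.
Qed.

Lemma gal_inj (s : absGal) : injective s.
Proof. by have [sb _ _ _] := absGalP s; apply: bij_inj. Qed.

Fact gal_inv_subproof (s : absGal) : `[< is_galois (gal_inv_fun s) >].
Proof.
apply/asboolP; have [sb sD [s1 sM] sF] := absGalP s; have sK := @gal_inv_funK s.
split.
- by exists s => // x; apply: (@gal_inj s); rewrite sK.
- by move=> x y; apply: (@gal_inj s); rewrite sD !sK.
- by split=> [|x y]; apply: (@gal_inj s); rewrite ?s1 ?sM !sK.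
by move=> a; apply: (@gal_inj s); rewrite sF sK.
Qed.

Definition gal_one := AbsGal gal_one_subproof.
Definition gal_mul s t := AbsGal (gal_mul_subproof s t).
Definition gal_inv s := AbsGal (gal_inv_subproof s).

Fact gal_mulA : associative gal_mul. Proof. by move=> s t u; apply: val_inj. Qed.
Fact gal_mul1 : left_id gal_one gal_mul. Proof. by move=> s; apply: val_inj. Qed.
Fact gal_1mul : right_id gal_one gal_mul. Proof. by move=> s; apply: val_inj. Qed.
Fact gal_mulV : left_inverse gal_one gal_inv gal_mul.
Proof.
move=> s; apply: val_inj; apply: funext => x /=.
by apply: (@gal_inj s); rewrite gal_inv_funK.
Qed.
Fact gal_Vmul : right_inverse gal_one gal_inv gal_mul.
Proof. by move=> s; apply: val_inj; apply: funext => x /=; rewrite gal_inv_funK. Qed.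

HB.instance Definition _ :=
  isGroup.Build absGal gal_mulA gal_mul1 gal_1mul gal_mulV gal_Vmul.

Lemma galM (s t : absGal) x : (s * t) x = s (t x). Proof. by []. Qed.
Lemma gal1 x : (1 : absGal) x = x. Proof. by []. Qed.
Lemma galK (s : absGal) x : s^-1 (s x) = x.
Proof. by rewrite -galM mulVg. Qed.
Lemma galKV (s : absGal) x : s (s^-1 x) = x.
Proof. by rewrite -galM mulgV. Qed.

(* Continuity for the discrete topology on X: the stabilizer of each point
   contains the pointwise stabilizer of a finite subset of K, i.e. is open in
   the Krull topology. *)
Definition is_gal_action (X : Type) (act : absGal -> X -> X) : Prop :=
  [/\ forall x, act 1 x = x,
      forall s t x, act (s * t) x = act s (act t x)
    & forall x, exists S : seq K,
        forall s : absGal, (forall y, y \in S -> s y = y) -> act s x = x].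

Record etale_action (E : groupType) := EtaleAction {
  eact :> absGal -> E -> E;
  eact_gal : is_gal_action eact;
  eactM : forall s, {morph eact s : x y / x * y}
}.

End AbsoluteGaloisGroup.


Definition rat_int : zmodClosed rat :=
  GRing.ZmodClosed.clone rat (@Num.int_num_subdef rat) _.

Definition QZ : zmodType := Quotient.quot rat_int.

Definition toQZ (x : rat) : QZ := (\pi_(Quotient.quot rat_int) x)%qT.

Definition prime_to (p n : nat) : bool := (0 < n)%N && coprime p n.

Lemma prime_to1 p : prime_to p 1.
Proof. by rewrite /prime_to coprimen1. Qed.

Lemma prime_toM p m n : prime_to p (m * n) = prime_to p m && prime_to p n.
Proof. by rewrite /prime_to muln_gt0 coprimeMr andbACA. Qed.

Section RootsOfUnity.
Variables (p : nat) (K : closedFieldType).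

(* Q/Z(1), the union of the groups mu_n(K) for n prime to p. *)
Record muinf := Muinf {
  mu_val :> K;
  _ : `[< exists2 n, prime_to p n & (mu_val ^+ n = 1)%R >] }.

HB.instance Definition _ := [isSub for mu_val].
HB.instance Definition _ := [Choice of muinf by <:].

Lemma muinfP (x : muinf) : exists2 n, prime_to p n & (mu_val x ^+ n = 1)%R.
Proof. by case: x => x /= /asboolP. Qed.

Lemma muinf_neq0 (x : muinf) : mu_val x != 0%R.
Proof.
have [n /andP[n0 _] xn] := muinfP x; apply/eqP => x0.
by move: xn; rewrite x0 expr0n eqn0Ngt n0 => /esym/eqP; rewrite oner_eq0.
Qed.

Fact mu_one_subproof : `[< exists2 n, prime_to p n & ((1 : K) ^+ n = 1)%R >].
Proof. by apply/asboolP; exists 1%N; rewrite ?prime_to1 ?expr1n. Qed.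

Fact mu_mul_subproof (x y : muinf) :
  `[< exists2 n, prime_to p n & ((mu_val x * mu_val y) ^+ n = 1)%R >].
Proof.
apply/asboolP; have [n pn xn] := muinfP x; have [m pm ym] := muinfP y.
exists (n * m)%N; first by rewrite prime_toM pn pm.
by rewrite exprMn exprM xn expr1n mul1r mulnC exprM ym expr1n.
Qed.

Fact mu_inv_subproof (x : muinf) :
  `[< exists2 n, prime_to p n & ((mu_val x)^-1 ^+ n = 1)%R >].
Proof.
apply/asboolP; have [n pn xn] := muinfP x; exists n => //.
by rewrite exprVn xn invr1.
Qed.

Definition mu_one := Muinf mu_one_subproof.
Definition mu_mul x y := Muinf (mu_mul_subproof x y).
Definition mu_inv x := Muinf (mu_inv_subproof x).

Fact mu_mulA : associative mu_mul.
Proof. by move=> x y z; apply: val_inj; rewrite /= mulrA. Qed.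
Fact mu_1mul : left_id mu_one mu_mul.
Proof. by move=> x; apply: val_inj; rewrite /= mul1r. Qed.
Fact mu_mul1 : right_id mu_one mu_mul.
Proof. by move=> x; apply: val_inj; rewrite /= mulr1. Qed.
Fact mu_Vmul : left_inverse mu_one mu_inv mu_mul.
Proof. by move=> x; apply: val_inj; rewrite /= mulVf ?muinf_neq0. Qed.
Fact mu_mulV : right_inverse mu_one mu_inv mu_mul.
Proof. by move=> x; apply: val_inj; rewrite /= mulfV ?muinf_neq0. Qed.

HB.instance Definition _ :=
  isGroup.Build muinf mu_mulA mu_1mul mu_mul1 mu_Vmul mu_mulV.

(* The transition maps of Zhat'(1) = lim mu_n are mu_(m d) -> mu_m, x |-> x^d.
   The components whose index is not prime to p are set to 1. *)
Definition is_Zhat1 (z : nat -> K) : Prop :=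
  [/\ forall n, ~~ prime_to p n -> z n = 1%R,
      forall n, prime_to p n -> (z n ^+ n = 1)%R
    & forall m d, prime_to p (m * d) -> (z (m * d)%N ^+ d = z m)%R].

Record Zhat1 := MkZhat1 { zcomp :> nat -> K; _ : `[< is_Zhat1 zcomp >] }.

HB.instance Definition _ := [isSub for zcomp].
HB.instance Definition _ := [Choice of Zhat1 by <:].

Lemma Zhat1P (z : Zhat1) : is_Zhat1 z.
Proof. by case: z => z /= /asboolP. Qed.

Fact zroot_subproof (z : Zhat1) (n : nat) :
  `[< exists2 m, prime_to p m & (z n ^+ m = 1)%R >].
Proof.
apply/asboolP; have [z1 zX _] := Zhat1P z.
have [pn|pn] := boolP (prime_to p n); first by exists n => //; apply: zX.
by exists 1%N; rewrite ?prime_to1 // expr1 z1.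
Qed.

Definition zroot (z : Zhat1) (n : nat) : muinf := Muinf (zroot_subproof z n).

Lemma Zhat1_neq0 (z : Zhat1) n : z n != 0%R.
Proof. exact: muinf_neq0 (zroot z n). Qed.

Fact z_one_subproof : `[< is_Zhat1 (fun=> 1%R) >].
Proof. by apply/asboolP; split=> // *; rewrite expr1n. Qed.

Fact z_mul_subproof (z w : Zhat1) : `[< is_Zhat1 (fun n => (z n * w n)%R) >].
Proof.
apply/asboolP; have [z1 zX zT] := Zhat1P z; have [w1 wX wT] := Zhat1P w.
split=> [n pn|n pn|m d pmd].
- by rewrite z1 // w1 // mulr1.
- by rewrite exprMn zX // wX // mulr1.
- by rewrite exprMn zT // wT.
Qed.

Fact z_inv_subproof (z : Zhat1) : `[< is_Zhat1 (fun n => (z n)^-1%R) >].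
Proof.
apply/asboolP; have [z1 zX zT] := Zhat1P z.
split=> [n pn|n pn|m d pmd].
- by rewrite z1 // invr1.
- by rewrite exprVn zX // invr1.
- by rewrite exprVn zT.
Qed.

Definition z_one := MkZhat1 z_one_subproof.
Definition z_mul z w := MkZhat1 (z_mul_subproof z w).
Definition z_inv z := MkZhat1 (z_inv_subproof z).

Fact z_mulA : associative z_mul.
Proof. by move=> x y z; apply/val_inj/funext => n /=; rewrite mulrA. Qed.
Fact z_1mul : left_id z_one z_mul.
Proof. by move=> x; apply/val_inj/funext => n /=; rewrite mul1r. Qed.
Fact z_mul1 : right_id z_one z_mul.
Proof. by move=> x; apply/val_inj/funext => n /=; rewrite mulr1. Qed.
Fact z_Vmul : left_inverse z_one z_inv z_mul.
Proof. by move=> x; apply/val_inj/funext => n /=; rewrite mulVf ?Zhat1_neq0. Qed.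
Fact z_mulV : right_inverse z_one z_inv z_mul.
Proof. by move=> x; apply/val_inj/funext => n /=; rewrite mulfV ?Zhat1_neq0. Qed.

HB.instance Definition _ :=
  isGroup.Build Zhat1 z_mulA z_1mul z_mul1 z_Vmul z_mulV.

Definition topgen (z : Zhat1) : Prop :=
  forall (w : Zhat1) n, prime_to p n -> exists k, w n = (z n ^+ k)%R.

(* The units of Zhat' = lim Z/n: [zu n] is the representative in [0, n) of the
   component modulo n; the values at n not prime to p are irrelevant. *)
Record Zhat_unit := ZhatUnit {
  zu :> nat -> nat;
  zu_lt : forall n, prime_to p n -> (zu n < n)%N;
  zu_coprime : forall n, prime_to p n -> coprime (zu n) n;
  zu_mod : forall m d, prime_to p (m * d) -> zu (m * d)%N = zu m %[mod m]
}.

Fact zpow_subproof (l : Zhat_unit) (z : Zhat1) :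
  `[< is_Zhat1 (fun n => (z n ^+ l n)%R) >].
Proof.
apply/asboolP; have [z1 zX zT] := Zhat1P z.
split=> [n pn|n pn|m d pmd].
- by rewrite z1 // expr1n.
- by rewrite -exprM (mulnC (l n)) exprM zX // expr1n.
- rewrite -exprM (mulnC (l _)) exprM zT //.
  have zm : (z m ^+ m = 1)%R by move: pmd; rewrite prime_toM => /andP[/zX].
  by rewrite -(expr_mod (l _) zm) (zu_mod l pmd) (expr_mod _ zm).
Qed.

Definition zpow (l : Zhat_unit) (z : Zhat1) : Zhat1 := MkZhat1 (zpow_subproof l z).

Lemma zpow_topgen (l : Zhat_unit) (z : Zhat1) : topgen z -> topgen (zpow l z).
Proof.
move=> zg w n pn; have [k ->] := zg w n pn.
have [_ zX _] := Zhat1P z; have ln := zu_coprime l pn.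
have n0 : (0 < n)%N by case/andP: pn.
have [l0|l0] := posnP (l n).
  exists 0%N; move: ln; rewrite l0 /coprime gcd0n => /eqP n1.
  by rewrite expr0; move: (zX n pn); rewrite n1 expr1 => ->; rewrite expr1n.
case: (egcdnP n l0) => j i lj _; exists (j * k)%N => /=.
rewrite -exprM mulnA [(l n * j)%N]mulnC lj (eqP ln) mulnDl mul1n exprD.
by rewrite -mulnA [(n * k)%N]mulnC mulnA [(_ * n)%N]mulnC exprM zX // expr1n mul1r.
Qed.

Definition zcontinuous (X : Type) (f : Zhat1 -> X) : Prop :=
  exists2 n, prime_to p n & forall z w : Zhat1, z n = w n -> f z = f w.

(* The points of E(-1), for a discrete group E. *)
Record cochar (E : groupType) := Cochar {
  cochar_val :> Zhat1 -> E;
  cocharM : {morph cochar_val : z w / z * w};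
  cochar_cont : zcontinuous cochar_val
}.

Lemma cochar_eq (E : groupType) (g h : cochar E) : g =1 h -> g = h.
Proof.
case: g h => [g gM gc] [h hM hc] /= /funext gh.
by case: _ / gh in hM hc *; congr Cochar; apply: Prop_irrelevance.
Qed.

Fact cochar_map_cont (E E' : groupType) (f : E -> E') (g : cochar E) :
  zcontinuous (fun z => f (g z)).
Proof. by have [n pn gn] := cochar_cont g; exists n => // z w /gn ->. Qed.

Definition cochar_map (E E' : groupType) (f : E -> E')
    (fM : {morph f : x y / x * y}) (g : cochar E) : cochar E' :=
  @Cochar E' (fun z => f (g z))
    (fun z w => etrans (congr1 f (cocharM g z w)) (fM _ _)) (cochar_map_cont f g).

Fact conj_morph (E : groupType) (x : E) :
  {morph (fun y => x * y * x^-1) : y z / y * z}.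
Proof. by move=> y z; rewrite !mulgA mulgVK. Qed.

Definition cochar_conj (E : groupType) (x : E) : cochar E -> cochar E :=
  cochar_map (@conj_morph E x).

Definition conj_class (E : groupType) (g : cochar E) : set (cochar E) :=
  [set h | exists x, h = cochar_conj x g].

(* g' = g + t, for the action on E(-1) of Q/Z(1)(-1), a subgroup of Q/Z, through
   [incl : Q/Z(1) -> E]; the class of a/n is identified with the homomorphism
   z |-> z_n^a, so that g' = g + t forces t to have order prime to p. *)
Definition shift_by (E : groupType) (incl : muinf -> E) (t : QZ)
    (g g' : cochar E) : Prop :=
  exists a n : nat, [/\ prime_to p n,
    t = toQZ (a%:R / n%:R)%R
    & forall z, g' z = incl (zroot z n ^+ a) * g z].

End RootsOfUnity.

Arguments zpow {p K} l z.
Arguments zroot {p K} z n.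
Arguments topgen {p K} z.

Section CocharacterSchemes.
Variables (F : finFieldType) (K : closedFieldType) (iota : {rmorphism F -> K}).
Variable p : nat.
Notation Gal := (absGal iota).
Notation Zhat1 := (Zhat1 p K).
Notation cochar := (cochar p K).

Fact gal_zhat_subproof (s : Gal) (z : Zhat1) :
  `[< is_Zhat1 p (fun n => s (z n)) >].
Proof.
apply/asboolP; have [z1 zX zT] := Zhat1P z; have [_ _ [s1 sM] _] := absGalP s.
have sX x n : s (x ^+ n)%R = (s x ^+ n)%R.
  by elim: n => [|n IHn]; rewrite ?expr0 // !exprS sM IHn.
split=> [n pn|n pn|m d pmd].
- by rewrite z1.
- by rewrite -sX zX.
- by rewrite -sX zT.
Qed.

Definition gal_zhat (s : Gal) (z : Zhat1) : Zhat1 := MkZhat1 (gal_zhat_subproof s z).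

Lemma gal_zhatM s : {morph gal_zhat s : z w / z * w}.
Proof.
move=> z w; apply/val_inj/funext => n /=.
by have [_ _ [_ sM] _] := absGalP s; rewrite sM.
Qed.

Lemma gal_zhatK s : cancel (gal_zhat s) (gal_zhat s^-1).
Proof. by move=> z; apply/val_inj/funext => n; apply: galK. Qed.

Section Cochar.
Variables (E : groupType) (aE : etale_action iota E).

Fact gal_cochar_morph (s : Gal) (g : cochar E) :
  {morph (fun z => aE s (g (gal_zhat s^-1 z))) : z w / z * w}.
Proof. by move=> z w; rewrite gal_zhatM cocharM eactM. Qed.

Fact gal_cochar_cont (s : Gal) (g : cochar E) :
  zcontinuous (fun z => aE s (g (gal_zhat s^-1 z))).
Proof.
have [n pn gn] := cochar_cont g; exists n => // z w zw.
by rewrite (gn _ (gal_zhat s^-1 w)) //= zw.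
Qed.

Definition gal_cochar (s : Gal) (g : cochar E) : cochar E :=
  Cochar (gal_cochar_morph s g) (gal_cochar_cont s g).

Definition gal_fixed (g : cochar E) : Prop := forall s, gal_cochar s g = g.

Record conj_subscheme := ConjSubscheme {
  cs_set :> set (cochar E);
  cs_conj : forall x g, cs_set g -> cs_set (cochar_conj x g);
  cs_gal : forall s g, cs_set g -> cs_set (gal_cochar s g)
}.

Variable C : conj_subscheme.

Definition geom_classes : set (set (cochar E)) := [set conj_class g | g in C].

Definition gal_class (s : Gal) (cb : set (cochar E)) : set (cochar E) :=
  gal_cochar s @` cb.

(* A point of C/E is identified with the orbit of geometric points above it. *)
Definition pi0 : set (set (set (cochar E))) :=
  [set [set gal_class s cb | s in [set: Gal]] | cb in geom_classes].

End Cochar.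

(* A geometric point of c, and the degree over F of the field of definition
   F(c), whose absolute Galois group is the stabilizer of [geom_pt c]. *)
Definition geom_pt (E : groupType) (c : set (set (cochar E))) : set (cochar E) :=
  xget set0 c.

Definition field_degree (E : groupType) (c : set (set (cochar E))) : nat :=
  #|` fset_set c |%fset.

(* Corestriction H^1(F', Q/Z) -> H^1(F, Q/Z) for [F' : F] = k. It is the dual of
   the transfer Gal(K/F) -> Gal(K/F'), which is s |-> s^k as Gal(K/F) is
   abelian. H^1(F, Q/Z) is the group of continuous homomorphisms, inside the
   group of all maps Gal(K/F) -> Q/Z. *)
Definition cor (k : nat) (chi : Gal -> QZ) : Gal -> QZ := fun s => chi (s ^+ k).

Section Uhat.
Variables (X : groupType) (aX : etale_action iota X) (C : conj_subscheme aX).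

(* A finite group of order prime to p with elements satisfying the defining
   relations of the symbols [g]^z; the values of [r_sym] outside of C and of the
   topological generators are irrelevant. As the order of [r_grp] is prime to p,
   powers with exponent l in Zhat' are computed modulo this order. *)
Record realization := Realization {
  r_grp :> finGroupType;
  r_sym : cochar X -> Zhat1 -> r_grp;
  r_prime : prime_to p #|r_grp|;
  r_pow : forall g, cs_set C g -> forall z, topgen z -> forall l : Zhat_unit p,
    r_sym g (zpow l z) = r_sym g z ^+ l #|r_grp|;
  r_conj : forall x g, cs_set C x -> cs_set C g -> forall y z, topgen y -> topgen z ->
    r_sym x y * r_sym g z * (r_sym x y)^-1 = r_sym (cochar_conj (x y) g) z
}.

Definition extends_sym (r : realization) (Y : groupType)
    (f : cochar X -> Zhat1 -> Y) (th : r -> Y) : Prop :=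
  {morph th : x y / x * y} /\
  forall g, cs_set C g -> forall z, topgen z -> th (r_sym r g z) = f g z.

(* The limit of all realizations, i.e. the prime-to-p profinite group presented
   by the symbols and the relations; its group law is componentwise and its
   topology is the coarsest one making all the projections to the discrete
   groups [r_grp r] continuous. *)
Record Uhat1 := MkUhat1 {
  ucomp :> forall r : realization, r;
  ucomp_nat : forall (r r' : realization) (th : r -> r'),
    extends_sym (r_sym r') th -> th (ucomp r) = ucomp r'
}.

(* The value at u of the continuous homomorphism from Uhat(X, C)(1) to a discrete
   group Y which maps [g]^z to [f g z]. *)
Definition Ueval (Y : groupType) (f : cochar X -> Zhat1 -> Y) (u : Uhat1) : Y :=
  xget 1 [set y | exists (r : realization) (th : r -> Y), extends_sym f th /\ y = th (u r)].

Section UevalWellDefined.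
Variables (Y : groupType) (f : cochar X -> Zhat1 -> Y).
Variables (r r' : realization) (th : r -> Y) (th' : r' -> Y).
Hypotheses (thE : extends_sym f th) (thE' : extends_sym f th').

Let D : {set r * r'} := [set x | th x.1 == th' x.2].

Fact equalizer_group_set : group_set D.
Proof.
have th1 (H : groupType) (t : H -> Y) : {morph t : x y / x * y} -> t 1 = 1.
  by move=> tM; apply: (@mulgI _ (t 1)); rewrite -tM !mulg1.
apply/group_setP; split=> [|x y]; rewrite !inE /=.
  by rewrite (th1 _ _ thE.1) (th1 _ _ thE'.1).
by move=> /eqP xD /eqP yD; rewrite thE.1 thE'.1 xD yD.
Qed.

Canonical equalizer_group := Group equalizer_group_set.

Let sym g z : [subg equalizer_group] := subg _ (r_sym r g z, r_sym r' g z).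

Let symE g z : cs_set C g -> topgen z -> sgval (sym g z) = (r_sym r g z, r_sym r' g z).
Proof. by move=> Cg zg; rewrite subgK // inE /= thE.2 // thE'.2. Qed.

Let equalizer_card : #|{: [subg equalizer_group]}| = #|D|.
Proof. by rewrite card_sub; apply: eq_card => x; rewrite !inE. Qed.

Fact equalizer_prime : prime_to p #|{: [subg equalizer_group]}|.
Proof.
have : prime_to p (#|r| * #|r'|) by rewrite prime_toM !r_prime.
rewrite -card_prod -cardsT; have := cardSg (finset.subsetT equalizer_group).
by rewrite equalizer_card => /dvdnP[k ->]; rewrite prime_toM => /andP[].
Qed.

Fact equalizer_pow g : cs_set C g -> forall z, topgen z -> forall l : Zhat_unit p,
  sym g (zpow l z) = sym g z ^+ l #|{: [subg equalizer_group]}|.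
Proof.
move=> Cg z zg l.
have expE (H : finGroupType) (a : H) n : prime_to p n -> a ^+ n = 1 ->
    a ^+ l n = a ^+ l #[a].
  move=> pn /eqP; rewrite -order_dvdn => /dvdnP[d nE]; apply/eqP.
  by rewrite eq_expg_mod_order nE mulnC zu_mod // mulnC -nE.
have sE n : (sgval (sym g z)) ^+ n = (r_sym r g z ^+ n, r_sym r' g z ^+ n).
  by rewrite symE //; elim: n => [|n IHn] //; rewrite !expgS IHn.
have := sE #|D|; rewrite (@expg_cardG _ equalizer_group) ?subgP // => -[e1 e2].
have pD := equalizer_prime; rewrite equalizer_card in pD *.
apply: val_inj; rewrite [LHS]symE //; last exact: zpow_topgen.
rewrite [RHS](morphX (sgval_morphism _)) ?inE //= sE !r_pow //.
have rE (q : realization) (a : q) : a ^+ l #|q| = a ^+ l #[a].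
  apply: expE; first exact: r_prime.
  by rewrite -cardsT expg_cardG ?inE.
by rewrite !rE (expE _ _ _ pD (esym e1)) (expE _ _ _ pD (esym e2)).
Qed.

Fact equalizer_conj x g : cs_set C x -> cs_set C g ->
  forall y z, topgen y -> topgen z ->
  sym x y * sym g z * (sym x y)^-1 = sym (cochar_conj (x y) g) z.
Proof.
move=> Cx Cg y z yg zg; apply: val_inj; rewrite [RHS]symE //; last exact: cs_conj.
rewrite [LHS]morphM ?inE // morphM ?inE // morphV ?inE //= !symE //.
by rewrite -!r_conj.
Qed.

Lemma Ueval_unique (u : Uhat1) : th (u r) = th' (u r').
Proof.
pose re := Realization equalizer_prime equalizer_pow equalizer_conj.
have e1 : extends_sym (r_sym r) (fun x : re => (sgval x).1).
  by split=> [x y|g Cg z zg] /=; rewrite ?symE.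
have e2 : extends_sym (r_sym r') (fun x : re => (sgval x).2).
  by split=> [x y|g Cg z zg] /=; rewrite ?symE.
rewrite -(ucomp_nat u e1) -(ucomp_nat u e2).
by have := subgP (u re); rewrite inE => /eqP.
Qed.

End UevalWellDefined.

Lemma UevalE (Y : groupType) (f : cochar X -> Zhat1 -> Y) (u : Uhat1)
    (r : realization) (th : r -> Y) :
  extends_sym f th -> Ueval f u = th (u r).
Proof.
move=> thE; rewrite /Ueval; set A := (X in xget _ X).
have [r' [th' [th'E ->]]] : A (xget 1 A) by apply: xgetPex; exists (th (u r)), r, th.
exact: (Ueval_unique th'E thE u).
Qed.

Fact gal_topgen (s : Gal) (z : Zhat1) : topgen z -> topgen (gal_zhat s z).
Proof.
move=> zg w n pn; have [k wk] := zg (gal_zhat s^-1 w) n pn; exists k.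
have [_ _ [s1 sM] _] := absGalP s.
have sX x m : s (x ^+ m)%R = (s x ^+ m)%R.
  by elim: m => [|m IHm]; rewrite ?expr0 // !exprS sM IHm.
by rewrite /= -sX -wk /= galKV.
Qed.

Fact gal_zpow (s : Gal) (l : Zhat_unit p) (z : Zhat1) :
  gal_zhat s (zpow l z) = zpow l (gal_zhat s z).
Proof.
apply/val_inj/funext => n /=; have [_ _ [s1 sM] _] := absGalP s.
by elim: (l n) => [|m IHm]; rewrite ?expr0 // !exprS sM IHm.
Qed.

Lemma eact1 s : aX s 1 = 1.
Proof. by apply: (@mulgI _ (aX s 1)); rewrite -eactM !mulg1. Qed.

Lemma eactV s x : aX s x^-1 = (aX s x)^-1.
Proof. by apply: (@mulgI _ (aX s x)); rewrite -eactM !mulgV eact1. Qed.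

Lemma gal_cochar_conj s y x g :
  gal_cochar aX s (cochar_conj ((x : cochar X) y) g) =
    cochar_conj (gal_cochar aX s x (gal_zhat s y)) (gal_cochar aX s g).
Proof. by apply: cochar_eq => z /=; rewrite gal_zhatK !eactM eactV. Qed.

Fact rgal_pow (s : Gal) (r : realization) g : cs_set C g -> forall z, topgen z ->
  forall l : Zhat_unit p,
  r_sym r (gal_cochar aX s g) (gal_zhat s (zpow l z)) =
    r_sym r (gal_cochar aX s g) (gal_zhat s z) ^+ l #|r|.
Proof.
by move=> Cg z zg l; rewrite gal_zpow r_pow //; [apply: cs_gal|apply: gal_topgen].
Qed.

Fact rgal_conj (s : Gal) (r : realization) x g : cs_set C x -> cs_set C g ->
  forall y z, topgen y -> topgen z ->
  r_sym r (gal_cochar aX s x) (gal_zhat s y) *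
    r_sym r (gal_cochar aX s g) (gal_zhat s z) *
    (r_sym r (gal_cochar aX s x) (gal_zhat s y))^-1 =
  r_sym r (gal_cochar aX s (cochar_conj (x y) g)) (gal_zhat s z).
Proof.
move=> Cx Cg y z yg zg; rewrite gal_cochar_conj r_conj //;
  by [apply: cs_gal|apply: gal_topgen].
Qed.

Definition rgal (s : Gal) (r : realization) : realization :=
  @Realization r (fun g z => r_sym r (gal_cochar aX s g) (gal_zhat s z))
    (r_prime r) (@rgal_pow s r) (@rgal_conj s r).

Fact gal_U_nat (s : Gal) (u : Uhat1) (r r' : realization) (th : r -> r') :
  extends_sym (r_sym r') th -> th (u (rgal s r)) = u (rgal s r').
Proof.
case=> thM thE; apply: (@ucomp_nat u (rgal s r) (rgal s r') th); split=> // g Cg z zg.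
by apply: thE; [apply: cs_gal|apply: gal_topgen].
Qed.

(* The component of [g]^z at r is [r_sym r g z], so this is the continuous
   automorphism mapping [g]^z to [s g]^(s z). *)
Definition gal_U (s : Gal) (u : Uhat1) : Uhat1 := MkUhat1 (@gal_U_nat s u).

(* The geometric points of Uhat(X, C) = Uhat(X, C)(1)(-1). *)
Record Uhat := MkUhat {
  Uhat_val :> Zhat1 -> Uhat1;
  UhatM : forall z w r, Uhat_val (z * w) r = Uhat_val z r * Uhat_val w r;
  Uhat_cont : forall r, zcontinuous (fun z => Uhat_val z r)
}.

Definition U_rational (h : Uhat) : Prop :=
  forall s z, gal_U s (h (gal_zhat s^-1 z)) = h z.

(* The component, at the conjugacy class cb and in mu_n(K), of the homomorphism
   R : Uhat(X, C)(1) -> Hom(C/X, Zhat'(1)), [g]^z |-> z.1_(class of g). *)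
Definition Rcomp (cb : set (cochar X)) (n : nat) (u : Uhat1) : muinf p K :=
  Ueval (fun g z => if `[< cb g >] then zroot z n else 1) u.

(* R(h) takes at cb the value m, an element of N inside
   Zhat' = Zhat'(1)(-1) = End(Zhat'(1)): R(h(z)) is z^m at cb, for all z. *)
Definition R_value (h : Uhat) (cb : set (cochar X)) (m : nat) : Prop :=
  forall z n, prime_to p n -> Rcomp cb n (h z) = zroot z n ^+ m.

(* The natural map Uhat(X, C) -> X(-1), [g]^z |-> g(z). *)
Definition U_to_cochar (h : Uhat) (z : Zhat1) : X := Ueval (fun g z => g z) (h z).

End Uhat.

Section Twist.
Variables (G : finGroupType) (aG : etale_action iota G).

Record torsor := Torsor {
  t_pt :> finType;
  t_act : t_pt -> G -> t_pt;
  t_gal : Gal -> t_pt -> t_pt;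
  t_act1 : forall x, t_act x 1 = x;
  t_actM : forall x g h, t_act x (g * h) = t_act (t_act x g) h;
  t_ne : exists x : t_pt, True;
  t_simply_transitive : forall x y, exists! g, t_act x g = y;
  t_galP : is_gal_action t_gal;
  t_gal_act : forall s x g, t_gal s (t_act x g) = t_act (t_gal s x) (aG s g)
}.

Record central_ext := CentralExt {
  ce_grp :> groupType;
  ce_act : etale_action iota ce_grp;
  ce_incl : muinf p K -> ce_grp;
  ce_proj : ce_grp -> G;
  ce_inclM : {morph ce_incl : x y / x * y};
  ce_incl_inj : injective ce_incl;
  ce_projM : {morph ce_proj : x y / x * y};
  ce_proj_surj : forall g, exists e, ce_proj e = g;
  ce_exact : forall e, ce_proj e = 1 <-> exists x, e = ce_incl x;
  ce_central : forall x e, ce_incl x * e = e * ce_incl x;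
  ce_incl_gal : forall (s : Gal) x y, mu_val y = s (mu_val x) ->
    ce_act s (ce_incl x) = ce_incl y;
  ce_proj_gal : forall s e, ce_proj (ce_act s e) = aG s (ce_proj e)
}.

Section TwistedGroup.
Variables (P : torsor) (E : groupType) (aE : etale_action iota E) (pr : E -> G).
Hypothesis pr_gal : forall s e, pr (aE s e) = aG s (pr e).


Definition twist_pred : {pred {ffun P -> E}} :=
  fun f => `[< forall x e, f (t_act x (pr e)) = e^-1 * f x * e >].

(* The twist of E by P, for the action of G on E by conjugation: an element
   (x, e) of the contracted product (P x E)/G is the function f on P with
   f(x) = e and f(x.g) = g^-1 f(x) g. *)
Record twist := Twist { tw_fun :> {ffun P -> E}; _ : twist_pred tw_fun }.

HB.instance Definition _ := [isSub for tw_fun].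
HB.instance Definition _ := [Choice of twist by <:].

Fact twist_group_closed : group_closed twist_pred.
Proof.
split=> [|f h /asboolP fP /asboolP hP]; apply/asboolP=> x e.
  by rewrite !ffunE mulg1 mulVg.
by rewrite !ffunE fP hP !invMg invgK !mulgA mulgK.
Qed.

HB.instance Definition _ :=
  SubChoice_isSubGroup.Build {ffun P -> E} twist_pred twist twist_group_closed.

Lemma twistP (f : twist) x e : f (t_act x (pr e)) = e^-1 * f x * e.
Proof. by case: f => f /= /asboolP. Qed.

Lemma twistM (f h : twist) x : (f * h) x = f x * h x.
Proof. by rewrite ffunE. Qed.

Fact gal_twist_subproof (s : Gal) (f : twist) :
  twist_pred [ffun x => aE s (f (t_gal s^-1 x))].
Proof.
have [aE1 aEM _] := eact_gal aE.
apply/asboolP=> x e; rewrite !ffunE t_gal_act -pr_gal twistP !eactM eactV.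
by rewrite -!aEM mulgV aE1.
Qed.

Definition gal_twist (s : Gal) (f : twist) : twist := Twist (gal_twist_subproof s f).

Fact gal_twist_action : is_gal_action gal_twist.
Proof.
have [aE1 aEM aEc] := eact_gal aE; have [aP1 aPM aPc] := t_galP P.
split=> [f|s t f|f].
- by apply: val_inj; apply/ffunP => x; rewrite ffunE aE1 invg1 aP1.
- by apply: val_inj; apply/ffunP => x; rewrite !ffunE aEM invMg aPM.
have [SP SPP] := choice aPc; have [SE SEP] := choice aEc.
exists (flatten [seq SP x ++ SE (f x) | x <- enum P]) => s sS.
have sx (x : P) y : y \in SP x ++ SE (f x) -> s y = y.
  by move=> yS; apply/sS/flattenP; exists (SP x ++ SE (f x)) => //;
     apply/mapP; exists x; rewrite ?mem_enum.
apply: val_inj; apply/ffunP => x; rewrite ffunE.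
have -> : t_gal s^-1 x = x.
  have sxx : t_gal s x = x by apply: SPP => y yS; apply: (sx x); rewrite mem_cat yS.
  by rewrite -{1}sxx -aPM mulVg aP1.
by apply: SEP => y yS; apply: (sx x); rewrite mem_cat yS orbT.
Qed.

Fact gal_twistM s : {morph gal_twist s : f h / f * h}.
Proof. by move=> f h; apply: val_inj; apply/ffunP => x; rewrite !ffunE eactM. Qed.

Definition twist_action : etale_action iota twist :=
  EtaleAction gal_twist_action gal_twistM.

End TwistedGroup.

(* The inner twist G_P = Aut(P): f corresponds to x |-> x.f(x), see [twistGE]. *)
Definition twistG (P : torsor) : groupType := twist P (id : G -> G).

Definition twistG_action (P : torsor) : etale_action iota (twistG P) :=
  @twist_action P G aG id (fun s e => erefl).

Lemma twistGE (P : torsor) (a : P -> P) :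
  (forall x g, a (t_act x g) = t_act (a x) g) <->
  exists f : twistG P, a = fun x => t_act x (f x).
Proof.
split=> [aG'|[f ->] x g]; last first.
  by rewrite [f _](twistP f x g) -!t_actM !mulgA mulgV mul1g.
have tr x : exists g, t_act x g = a x.
  by have [g [gx _]] := t_simply_transitive x (a x); exists g.
have [f fP] := choice tr.
suff fT : twist_pred (id : G -> G) [ffun x => f x].
  by exists (Twist fT); apply/funext => x; rewrite ffunE fP.
apply/asboolP => x g; rewrite !ffunE.
have [h [_ hU]] := t_simply_transitive (t_act x g) (a (t_act x g)).
rewrite -(hU _ (fP _)); apply: hU.
by rewrite -t_actM !mulgA mulgV mul1g t_actM fP aG'.
Qed.

Lemma twistG_comp (P : torsor) (f h : twistG P) x :
  t_act x ((f * h) x) = t_act (t_act x (h x)) (f (t_act x (h x))).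
Proof.
by rewrite [f (t_act _ _)](twistP f) -t_actM !mulgA mulgV mul1g twistM.
Qed.

(* G_P -> G, the isomorphism given by the choice of a point x of P. *)
Section Evaluation.
Variables (P : torsor) (x : P).

Definition twistG_ev (f : twistG P) : G := f x.

Fact twistG_evM : {morph twistG_ev : f h / f * h}.
Proof. by move=> f h; apply: twistM. Qed.

Definition cochar_ev : cochar (twistG P) -> cochar G := cochar_map twistG_evM.

End Evaluation.

(* The subset of G_P(-1) corresponding to a conjugation-invariant subset of
   G(-1), which also identifies the conjugacy classes in the two groups. *)
Definition twist_set (P : torsor) (A : set (cochar G)) : set (cochar (twistG P)) :=
  [set g | forall x : P, A (cochar_ev x g)].

Section TwistSubscheme.
Variables (P : torsor) (C : conj_subscheme aG).

Fact twist_set_conj f g :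
  twist_set C g -> twist_set C (cochar_conj (f : twistG P) g).
Proof.
move=> Cg x; have -> : cochar_ev x (cochar_conj f g) = cochar_conj (f x) (cochar_ev x g).
  apply: cochar_eq => z /=; rewrite /twistG_ev !twistM; congr (_ * _ * _).
  by apply: (@mulgI _ (f x)); rewrite -twistM !mulgV ffunE.
exact: cs_conj.
Qed.

Fact twist_set_gal s g :
  twist_set C g -> twist_set C (gal_cochar (twistG_action P) s g).
Proof.
move=> Cg x.
have -> : cochar_ev x (gal_cochar (twistG_action P) s g) =
          gal_cochar aG s (cochar_ev (t_gal s^-1 x) g).
  by apply: cochar_eq => z /=; rewrite /twistG_ev ffunE.
exact: cs_gal.
Qed.

Definition twist_subscheme : conj_subscheme (twistG_action P) :=
  ConjSubscheme twist_set_conj twist_set_gal.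

End TwistSubscheme.

(* A class in Br(BG) is represented by a central extension B of G. *)
Section Residues.
Variable B : central_ext.

Definition cochar_proj : cochar B -> cochar G := cochar_map (@ce_projM B).

(* M is a conjugation-invariant section over the preimage of c in G(-1). *)
Definition residue_section (c : set (set (cochar G))) (M : set (cochar B)) : Prop :=
  (forall e g, M g -> M (cochar_conj e g)) /\
  set_bij M [set g | c (conj_class g)] cochar_proj.

Definition algebraic_residue (c : set (set (cochar G))) : Prop :=
  exists M, residue_section c M.

(* The residue at c, as a map on Gal(K/F(c)), the stabilizer of [geom_pt c];
   the values elsewhere are irrelevant. *)
Definition residue (c : set (set (cochar G))) (s : Gal) : QZ :=
  xget 0%R [set t | exists2 M, residue_section c M &
    let Mc := M `&` [set g | geom_pt c (cochar_proj g)] in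
    gal_cochar (ce_act B) s @` Mc =
      [set g' | exists2 g, Mc g & shift_by (@ce_incl B) t g g']].

Variable P : torsor.

Definition twistB : groupType := twist P (@ce_proj B).

Definition twistB_action : etale_action iota twistB :=
  twist_action P (@ce_proj_gal B).

Fact twistB_incl_subproof (y : muinf p K) :
  twist_pred (@ce_proj B) [ffun x : P => ce_incl B y].
Proof. by apply/asboolP => x e; rewrite !ffunE -mulgA ce_central mulKg. Qed.

Definition twistB_incl (y : muinf p K) : twistB := Twist (twistB_incl_subproof y).

(* The value at (P, g) of the residue of B. *)
Definition residue_at (g : cochar (twistG P)) (s : Gal) : QZ :=
  xget 0%R [set t | exists2 g' : cochar twistB,
    (forall z (x : P), ce_proj (g' z x) = g z x) &
    shift_by twistB_incl t g' (gal_cochar twistB_action s g')].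

End Residues.

Definition generates (C : set (cochar G)) : Prop :=
  <<[set x : G | `[< exists2 g, C g & exists z, g z = x >]]%SET>> = [set: G]%SET.

(* h is an F-point of U(G_P, C)_(n, g). As n has values in N, the second condition
   implies that h is in U(G_P, C), the preimage of Hom(C/G, Z) under R. *)
Definition U_point (P : torsor) (C : conj_subscheme aG)
    (n : set (cochar G) -> nat) (g : cochar (twistG P))
    (h : Uhat (twist_subscheme P C)) : Prop :=
  [/\ U_rational h,
      forall cb, geom_classes C cb -> R_value h (twist_set cb) (n cb)
    & forall z, U_to_cochar h z = (g z)^-1].

End Twist.
End CocharacterSchemes.

(* Main.v *)
Require Import Defs.
From HB Require Import structures.
From mathcomp Require Import all_boot all_order all_fingroup all_algebra.
From mathcomp Require Import cyclic pgroup separable cyclotomic finfield.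
From mathcomp Require Import finmap all_classical.
From mathcomp Require algC classfun character.

(** Choose a compatible system [z0] of primitive roots of unity. Evaluation at
    [z0] identifies [E(-1)] with [E] for every torsion group [E] of order prime to
    [p], with a modified Galois action [star], in which the Frobenius [Fr] satisfies
    [star Fr e ^+ q = Fr e] with [q = #|F|]. Thus [C] becomes a conjugation-invariant
    set [S] in [G]. A point [x0] of [phi], with [Fr^-1 x0 = x0.h], identifies
    [G_phi] with [G] and [gamma] with an element [a0]; the Frobenius of [G_phi] is
    that of [G] composed with the conjugation by [h]. As [Fr] generates the Galois
    group topologically, every condition below only has to be tested on [Fr].

    Rational points and words. The group [Uhat(G_phi, C)(1)] is the limit of the
    finite groups [H] of order prime to [p] with a map [mu : S -> H] such that
    [mu b * mu a * (mu b)^-1 = mu (b * a * b^-1)]. A rational point of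
    [U(G_phi, C)_(n, gamma)] is an element [u] of this limit that satisfies a
    Frobenius equation, lies above [a0^-1] and has class counts [n]. By compactness
    it exists if and only if, for all [H] and all [N], there is a word in [S] that
    has these properties in [H] and modulo [N] ([word_condition]). The component
    of a point in a product of groups [H] is a word, which gives one implication
    ([points_to_words]); for the other, the components of the point are the limits
    of the words along an ultrafilter ([words_to_points]).

    From words to residues. Let [B] be a central extension with algebraic residues
    along [C]: this amounts to a conjugation-equivariant lift [m : S -> B]
    ([lift_exists], [lift_algebraic]). The failure of [m] to commute with [Fr] is a
    [Q/Z(1)]-valued function on the conjugacy classes in [S], and its sum over a
    Frobenius orbit of classes is the value at [Fr] of the corestriction of the
    residue of [B] ([corestriction_orbit]). Apply the word condition to a finite
    subgroup of [B] through the image of [m]. The image of the word in [B] lifts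
    [a0^-1], so its Frobenius computes the residue at [gamma]; the Frobenius
    equation compares it with the defects of [m] at the letters. This is
    the vanishing of the sum of the residues at [Fr] ([word_residue]), and of the
    sum itself, which is a continuous character ([residue_sum_frob]).

    From residues to words. Given [H] and [N], pass to a finite group [A] that
    dominates them, lies above [G], is generated by the image of [S] and has an
    endomorphism compatible with the Frobenius. The kernel [Z] of [A -> G] is
    central, so finding the word means solving a linear equation: a given
    element of the finite abelian group [Z * T] must be in the image of a
    homomorphism [Z -> Z * T], where [T] records the class counts. If it is not, a
    character of [Z * T] kills the image but not this element. Pushing [A] out
    along the restriction of the character to [Z] gives a central extension of [G]
    by [Q/Z(1)]. As the character kills the image, the Frobenius of [A] descends to
    this extension after a correction by the class counts; the images of the
    elements of [S] lift [C], and the sum of the residues at [Fr] is not zero,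
    as the character does not kill the given element ([level_solution], [residues_to_words]). *)

Set Implicit Arguments.
Unset Strict Implicit.
Unset Printing Implicit Defensive.

Import GRing.Theory Num.Theory.

Local Open Scope classical_set_scope.
Local Open Scope ring_scope.

(** * The Frobenius in the absolute Galois group *)

Section FrobeniusDensity.
Variables (F : finFieldType) (K : closedFieldType) (iota : {rmorphism F -> K}).
Hypothesis algK : forall x : K, algebraicOver iota x.
Variable p : nat.
Hypothesis charF : p \in [pchar F].
Local Notation q := #|F|.

Lemma pcharK : p \in [pchar K]. Proof. exact: rmorph_pchar charF. Qed.

Lemma p_prime : prime p. Proof. by case/andP: charF. Qed.

Lemma q_gt1 : (1 < q)%N. Proof. exact: finNzRing_gt1. Qed.

Lemma card_pow : exists n, q = (p ^ n)%N.
Proof.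
by rewrite (card_pprimeChar charF); exists (logn p #|F|); rewrite -(card_pprimeChar charF).
Qed.

Lemma q_prime_to n : prime_to p n -> coprime q n.
Proof. by case: card_pow => m -> /andP[_ pn]; apply: coprimeXl. Qed.

Lemma qX_prime_to d : (0 < d)%N -> prime_to p (q ^ d).-1.
Proof.
move=> d0; have q1 : (1 < q ^ d)%N by rewrite -(expn0 q) ltn_exp2l ?q_gt1.
rewrite /prime_to -ltnS prednK ?q1 //=; last by rewrite (ltn_trans _ q1).
case: card_pow q1 => -[|m] qE q1; first by move: q1; rewrite qE exp1n.
have : coprime (q ^ d) (q ^ d).-1 by rewrite coprime_sym coprimePn // (ltn_trans _ q1).
by rewrite qE -expnM; case: d d0 {q1} => // d _; rewrite mulSn coprime_pexpl.
Qed.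

Fact frob_subproof : `[< is_galois iota (fun x => x ^+ q) >].
Proof.
have [n qE] := card_pow; have pK : p.-nat q.
  by rewrite qE pnatX pnat_id ?p_prime.
have qB : {morph (fun x : K => x ^+ q) : x y / x - y}.
  by move=> x y; rewrite exprDn_pchar ?exprNn_pchar // (eq_pnat _ (pcharf_eq pcharK)).
apply/asboolP; split.
- have inj : injective (fun x : K => x ^+ q).
    move=> x y /= /eqP; rewrite -subr_eq0 -qB => /eqP xy; apply/eqP.
    by rewrite -subr_eq0; move/eqP: xy; rewrite expf_eq0 => /andP[].
  have ex y : exists x : K, x ^+ q = y.
    have /closed_rootP[x] : size ('X^q - y%:P : {poly K}) != 1%N.
      by rewrite size_XnsubC ?eqSS -?lt0n // (ltn_trans _ q_gt1).
    by rewrite rootE !hornerE subr_eq0 => /eqP xy; exists x.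
  have [g gK] := choice ex; exists g => // x.
  by apply: inj; rewrite gK.
- exact: qB.
- by split=> [|x y]; rewrite ?expr1n ?exprMn.
by move=> a; rewrite -rmorphXn expf_card.
Qed.

Definition frob : absGal iota := AbsGal frob_subproof.

Lemma frobE x : frob x = x ^+ q. Proof. by []. Qed.

Lemma frobX j x : (frob ^+ j)%g x = x ^+ (q ^ j).
Proof.
elim: j x => [|j IHj] x; first by rewrite expr1.
by rewrite expgS galM IHj frobE -exprM expnSr.
Qed.

Lemma galX (s : absGal iota) x n : s (x ^+ n) = s x ^+ n.
Proof.
have [_ _ [s1 sM] _] := absGalP s.
by elim: n => [|n IHn]; rewrite ?expr0 // !exprS sM IHn.
Qed.

Lemma nat_finite_collision (T : finType) (f : nat -> T) :
  exists i j, (i < j)%N /\ f i = f j.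
Proof.
have : ~~ injectiveb [ffun i : 'I_#|T|.+1 => f i].
  apply/negP => /injectiveP /leq_card; rewrite card_ord ltnn //.
case/injectivePn => i [j ij]; rewrite !ffunE => fij.
case: (ltngtP i j) => [lt|gt|/ord_inj ji]; last by rewrite ji eqxx in ij.
- by exists i, j.
- by exists j, i.
Qed.

(** An algebraic element of [K] has finitely many powers, since these are
    linear combinations over a finite field of boundedly many of them. *)
Lemma algebraic_unity_root (x : K) : x != 0 -> exists2 n, prime_to p n & x ^+ n = 1.
Proof.
move=> x0; have [P P0 Px] := algK x.
pose f i := [ffun j : 'I_(size P) => ('X^i %% P : {poly F})`_j].
have [i [j [ij /ffunP fij]]] := nat_finite_collision f.
have xE k : x ^+ k = (map_poly iota ('X^k %% P : {poly F})).[x].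
  have := congr1 (fun R => (map_poly iota R).[x]) (divp_eq 'X^k P).
  by rewrite rmorphXn rmorphD rmorphM /= map_polyX !hornerE (rootP Px) mulr0 add0r.
have xij : x ^+ i = x ^+ j.
  rewrite !xE; congr (map_poly _ _).[x]; apply/polyP => k.
  have [kP|Pk] := ltnP k (size P); first by have := fij (Ordinal kP); rewrite !ffunE.
  have sz l : (size ('X^l %% P : {poly F})%R <= k)%N by apply: leq_trans Pk; rewrite ltnW ?ltn_modp.
  by rewrite !nth_default.
have xN : x ^+ (j - i) = 1.
  by apply: (mulfI (expf_neq0 i x0)); rewrite -exprD subnKC ?mulr1 // ltnW.
have N0 : (0 < j - i)%N by rewrite subn_gt0.
pose N := (j - i)%N; exists (N`_p^')%N.
  by rewrite /prime_to part_gt0 prime_coprime ?p_prime // -p'natE ?p_prime // part_pnat.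
apply/eqP; rewrite -subr_eq0; apply/eqP; set y := x ^+ _.
have yp : (y - 1) ^+ (N`_p)%N = 0.
  rewrite exprDn_pchar ?exprNn_pchar ?(eq_pnat _ (pcharf_eq pcharK)) ?part_pnat //.
  by rewrite expr1n -exprM mulnC partnC // xN subrr.
by move/eqP: yp; rewrite expf_eq0 => /andP[_ /eqP].
Qed.

Lemma finite_level (S : seq K) :
  exists2 d, (0 < d)%N & forall x, x \in S -> x ^+ (q ^ d) = x.
Proof.
elim: S => [|x S [d d0 dS]]; first by exists 1%N.
have [->|x0] := eqVneq x 0.
  exists d => // y; rewrite inE => /orP[/eqP->|/dS //].
  by rewrite expr0n expn_eq0 (gtn_eqF (ltnW q_gt1)).
have [n pn xn] := algebraic_unity_root x0.
have n0 : (0 < n)%N by case/andP: pn.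
exists (d * totient n)%N; first by rewrite muln_gt0 d0 totient_gt0.
move=> y; rewrite inE => /orP[/eqP->|/dS yd].
  rewrite mulnC expnM -(expr_mod _ xn) -modnXm (Euler_exp_totient (q_prime_to pn)).
  by rewrite modnXm exp1n expr_mod.
rewrite expnM; elim: (totient n) => [|k IHk]; rewrite ?expr1 // expnSr exprM IHk //.
Qed.

Lemma prim_root_exists n : prime_to p n -> exists z : K, n.-primitive_root z.
Proof.
case/andP=> n0 pn; have [rs rsE] := closed_field_poly_normal ('X^n - 1 : {poly K}).
rewrite (monicP (monic_Xn_sub_1 K n0)) scale1r in rsE.
have Urs : uniq rs.
  rewrite -separable_prod_XsubC -rsE; apply: separable_Xn_sub_1.
  rewrite natf_neq0_pchar (eq_pnat _ (eq_negn (pcharf_eq pcharK))).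
  by rewrite p'natE ?p_prime // -prime_coprime ?p_prime.
have /hasP[z _ zP] : has n.-primitive_root rs.
  apply: has_prim_root => //.
    by apply/allP=> z; rewrite -root_prod_XsubC -rsE.
  by rewrite -ltnS -(size_prod_XsubC rs id) -rsE size_Xn_sub_1.
by exists z.
Qed.

Definition gal_rmorphism (s : absGal iota) : {rmorphism K -> K} :=
  let: And4 _ sB sM _ := absGalP s in
  HB.pack (gal_fun s) (GRing.isZmodMorphism.Build K K (gal_fun s) sB)
    (GRing.isMonoidMorphism.Build K K (gal_fun s) sM).

Lemma gal_rmorphismE s : gal_rmorphism s =1 s.
Proof. by rewrite /gal_rmorphism; case: (absGalP s). Qed.

(** The polynomial ['X^q - 'X] has no roots besides the elements of [F]. *)
Lemma frob_fixed (c : K) : c ^+ q = c -> exists a, c = iota a.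
Proof.
move=> cq; have := congr1 (fun P => (map_poly iota P).[c]) (finField_genPoly F).
rewrite rmorphB /= map_polyXn map_polyX !hornerE cq subrr rmorph_prod horner_prod.
move=> /esym/eqP/prodf_eq0[a _]; rewrite rmorphB /= map_polyX map_polyC !hornerE.
by rewrite subr_eq0 => /eqP ->; exists a.
Qed.

(** The subfield with [q ^ d] elements is generated by a root of unity [y], whose
    conjugates are among the roots [y ^+ (q ^ i)] of a polynomial over [F]. *)
Lemma frob_dense (s : absGal iota) d : (0 < d)%N ->
  exists j, forall x, x ^+ (q ^ d) = x -> s x = (frob ^+ j)%g x.
Proof.
move=> d0; have [y yP] := prim_root_exists (qX_prime_to d0).
have qd : (q ^ d = (q ^ d).-1.+1)%N by rewrite prednK // expn_gt0 ltnW ?q_gt1.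
have yq : y ^+ (q ^ d) = y by rewrite qd exprS (prim_expr_order yP) mulr1.
pose f := \prod_(0 <= i < d) ('X - (y ^+ (q ^ i))%:P).
have ffrob : map_poly (gal_rmorphism frob) f = f.
  rewrite /f rmorph_prod /=; under eq_bigr do
    rewrite rmorphB /= map_polyX map_polyC /= gal_rmorphismE frobE -exprM -expnSr.
  rewrite -(big_add1 _ _ 0%N d.+1 xpredT (fun i => 'X - (y ^+ (q ^ i))%:P)).
  by case: (d) d0 yq => // e _ yq; rewrite big_nat_recr //= yq mulrC [RHS]big_ltn.
have sf : map_poly (gal_rmorphism s) f = f.
  apply/polyP => i; rewrite coef_map /= gal_rmorphismE.
  have [a ->] : exists a, f`_i = iota a.
    by apply: frob_fixed; rewrite -{2}ffrob coef_map /= gal_rmorphismE.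
  by have [_ _ _ ->] := absGalP s.
have : root f (s y).
  rewrite -sf -gal_rmorphismE fmorph_root /f rootE horner_prod.
  by apply/eqP; rewrite big_ltn // !hornerE subrr mul0r.
rewrite rootE horner_prod prodf_seq_eq0 => /hasP[j _]; rewrite !hornerE subr_eq0.
move=> /eqP sy; exists j => x xq; rewrite frobX.
have [->|x0] := eqVneq x 0.
  by rewrite -gal_rmorphismE rmorph0 expr0n expn_eq0 (gtn_eqF (ltnW q_gt1)).
have xn : x ^+ (q ^ d).-1 = 1 by apply: (mulfI x0); rewrite -exprS -qd mulr1.
by have [i ->] := prim_rootP yP xn; rewrite galX sy -!exprM mulnC.
Qed.

(** The fixed points of [frob ^+ d] form the subfield of degree [d], so this is
    congruence modulo the open subgroup of index [d]. *)
Definition agree d (s t : absGal iota) := forall x, x ^+ (q ^ d) = x -> s x = t x.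

Lemma galC_level (s : absGal iota) d x : x ^+ (q ^ d) = x -> s x ^+ (q ^ d) = s x.
Proof. by rewrite -galX => ->. Qed.

Lemma agreeM d s t s' t' : agree d s s' -> agree d t t' -> agree d (s * t)%g (s' * t')%g.
Proof. by move=> ss tt x xd; rewrite galM tt // ss ?galC_level. Qed.

Lemma agreeX d s t n : agree d s t -> agree d (s ^+ n)%g (t ^+ n)%g.
Proof.
move=> st; elim: n => [|n IHn] //; rewrite !expgS; exact: agreeM.
Qed.

Lemma agree_dvd d e s t : (d %| e)%N -> agree e s t -> agree d s t.
Proof.
case/dvdnP=> k -> st x xd; apply: st; rewrite mulnC expnM.
by elim: k => [|k IHk]; rewrite ?expr1 // expnSr exprM IHk.
Qed.

(** The stabilizer of a point is open, and every finite set of algebraic elements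
    lies in a finite subfield. *)
Lemma gal_action_level (X : Type) (act : absGal iota -> X -> X) (x : X) :
  is_gal_action act ->
  exists2 d, (0 < d)%N & forall s t, agree d s t -> act s x = act t x.
Proof.
case=> act1 actM /(_ x)[S Sx]; have [d d0 dS] := finite_level S.
exists d => // s t st; rewrite -[s](mulKVg t) actM [act (_ * s)%g _]Sx // => y /dS yd.
by rewrite galM st // galK.
Qed.

End FrobeniusDensity.

(** * Ultralimits *)

Section Ultralimits.
Variables (T : Type) (R : T -> T -> Prop).
Hypotheses (Rtrans : forall a b c, R a b -> R b c -> R a c)
  (Rdir : forall a b, exists c, R a c /\ R b c).

Lemma directed_ultrafilter (t0 : T) :
  exists2 U : set_system T, UltraFilter U & forall a, U [set c | R a c].
Proof.
pose B a := [set c | R a c].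
have PF : ProperFilter (filter_from [set: T] B).
  apply: filter_from_proper => [|a _]; last by have [c [ac _]] := Rdir a a; exists c.
  apply: filter_from_filter => [|a b _ _]; first by exists t0.
  by have [c [ac bc]] := Rdir a b; exists c => // d cd; split; apply: Rtrans cd.
have [U [UU sU]] := ultraFilterLemma PF.
by exists U => // a; apply: sU; exists a.
Qed.

End Ultralimits.

(** Functions to a finite set converge along an ultrafilter. *)
Lemma ultra_limit (T : Type) (U : set_system T) (X : choiceType) (f : T -> X)
    (s : seq X) : UltraFilter U -> U [set t | f t \in s] ->
  exists2 x, x \in s & U [set t | f t = x].
Proof.
move=> UU; elim: s => [|x s IHs] Us.
  by have /filter_ex[] := Us.
have [Ux|Ux] := in_ultra_setVsetC [set t | f t = x] UU.
  by exists x; rewrite ?mem_head.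
have [|y ys Uy] := IHs; last by exists y; rewrite // inE ys orbT.
apply: filterS (filterI Us Ux) => t /= [].
by rewrite inE => /orP[/eqP|].
Qed.

Section CompatibleRoots.
Variables (p : nat) (K : closedFieldType).
Hypothesis proot : forall n, prime_to p n -> exists z : K, n.-primitive_root z.

Local Notation Z1 := (Zhat1 p K).

(** Arbitrary primitive roots of unity become compatible in an ultralimit along
    the divisibility order: the component at [m] is the limit of
    [w n ^+ (n %/ m)]. *)
Lemma compatible_primitive_roots :
  exists z : Z1, forall n, prime_to p n -> n.-primitive_root (z n).
Proof.
have [w wP] : {w : nat -> K & forall n, prime_to p n -> n.-primitive_root (w n)}.
  apply: (@choice _ _ (fun n z => prime_to p n -> n.-primitive_root z)) => n.
  by have [/proot[z zP]|] := boolP (prime_to p n); [exists z|exists 0].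
pose T := {n | prime_to p n}.
pose D (a b : T) := (sval a %| sval b)%N.
have [] := @directed_ultrafilter T (fun a b => D a b) _ _ (exist (prime_to p) 1%N (prime_to1 p)).
- by move=> a b c; apply: dvdn_trans.
- move=> a b; have ab : prime_to p (sval a * sval b) by rewrite prime_toM (svalP a) (svalP b).
  exists (exist (prime_to p) _ ab); split; [apply/dvdn_mulr/dvdnn|apply/dvdn_mull/dvdnn].
move=> U UU Udvd.
have lim m : exists z : K, prime_to p m ->
    U [set n : T | (m %| sval n)%N /\ z = w (sval n) ^+ (sval n %/ m)].
  have [pm|] := boolP (prime_to p m); last by exists 0.
  have := Udvd (exist (prime_to p) m pm); rewrite /D /= => Um.
  pose f (n : T) := w (sval n) ^+ (sval n %/ m).
  have [|z _ Uz] := @ultra_limit T U _ f [seq w m ^+ i | i : 'I_m] UU.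
    apply: filterS Um => n /= mn; have wn := dvdn_prim_root (wP _ (svalP n)) mn.
    rewrite /f; have [i ->] := prim_rootP (wP m pm) (prim_expr_order wn).
    by apply/mapP; exists i; rewrite ?mem_enum.
  by exists z => _; apply: filterS (filterI Um Uz) => n [].
have [z0 z0P] := choice lim.
pose z n := if prime_to p n then z0 n else 1.
have zprim n : prime_to p n -> n.-primitive_root (z n).
  move=> pn; rewrite /z pn; have /filter_ex[k /= [nk ->]] := z0P n pn.
  by have := dvdn_prim_root (wP _ (svalP k)) nk.
have zZ : is_Zhat1 p z.
  split=> [n /negbTE pn|n pn|m d pmd]; first by rewrite /z pn.
  - exact: prim_expr_order (zprim n pn).
  have pm : prime_to p m by move: pmd; rewrite prime_toM => /andP[].
  have [k /= [[mdk zmd] [mk zm]]] := filter_ex (filterI (z0P _ pmd) (z0P _ pm)).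
  rewrite /z pm pmd zmd zm -exprM; congr (_ ^+ _).
  have d0 : (0 < d)%N by case/andP: pmd; rewrite muln_gt0 => /andP[].
  by rewrite divnMA divnK // dvdn_divRL // mulnC.
by exists (MkZhat1 (asboolT zZ)).
Qed.

End CompatibleRoots.

(** * Cocharacters and a generator of the roots of unity *)

Section Zeta.
Local Open Scope group_scope.
Variables (p : nat) (K : closedFieldType).
Local Notation Z1 := (Zhat1 p K).
Variable z0 : Z1.
Hypothesis z0P : forall n, prime_to p n -> n.-primitive_root (z0 n).

Lemma prime_to_gt0 n : prime_to p n -> (0 < n)%N. Proof. by case/andP. Qed.

Implicit Types z w : Z1.

Lemma zexpE (z : Z1) k n : (z ^+ k) n = (z n ^+ k)%R.
Proof. by elim: k => [|k IHk]; rewrite ?expr0 // expgS exprS -IHk. Qed.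

Lemma muexpE (x : muinf p K) k : mu_val (x ^+ k) = (mu_val x ^+ k)%R.
Proof. by elim: k => [|k IHk]; rewrite ?expr0 // expgS exprS -IHk. Qed.

Lemma expg_modn (E : groupType) (e : E) n k : e ^+ n = 1 -> e ^+ (k %% n) = e ^+ k.
Proof.
move=> en; rewrite {2}(divn_eq k n) expgnDr mulnC expgnA en expg1n mul1g //.
Qed.

Lemma expg_eqmod (E : groupType) (e : E) n i j :
  e ^+ n = 1 -> i = j %[mod n] -> e ^+ i = e ^+ j.
Proof. by move=> en ij; rewrite -(expg_modn i en) ij expg_modn. Qed.

Lemma zeta_topgen : topgen z0.
Proof.
move=> w n pn; have [_ wX _] := Zhat1P w.
by have [i ->] := prim_rootP (z0P pn) (wX n pn); exists i.
Qed.

(** The discrete logarithm of [z] to the base [z0] at level [n]. *)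
Definition zlog (z : Z1) (n : nat) : nat :=
  xget 0%N [set k | (k < n)%N /\ z n = (z0 n ^+ k)%R].

Lemma zlogP z n : prime_to p n -> (zlog z n < n)%N /\ z n = (z0 n ^+ zlog z n)%R.
Proof.
move=> pn; have [_ zX _] := Zhat1P z; rewrite /zlog.
apply: (@xgetPex _ 0%N [set k | (k < n)%N /\ z n = (z0 n ^+ k)%R]).
by have [i ->] := prim_rootP (z0P pn) (zX n pn); exists (nat_of_ord i).
Qed.

Lemma zlogE z n : prime_to p n -> z n = (z0 n ^+ zlog z n)%R.
Proof. by case/(zlogP z). Qed.

Lemma zlog_eq z n k : prime_to p n -> z n = (z0 n ^+ k)%R -> zlog z n = k %[mod n].
Proof.
by move=> pn zk; apply/eqP; rewrite -(eq_prim_root_expr (z0P pn)) -zk -zlogE.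
Qed.

Lemma zlog1 n : prime_to p n -> zlog z0 n = 1 %[mod n].
Proof. by move=> pn; apply: zlog_eq. Qed.

Lemma zlogM z w n : prime_to p n -> zlog (z * w) n = zlog z n + zlog w n %[mod n].
Proof. by move=> pn; apply: zlog_eq => //; rewrite exprD -!zlogE. Qed.

Lemma zlog_mod z m n : prime_to p m -> (n %| m)%N -> zlog z m = zlog z n %[mod n].
Proof.
move=> pm /dvdnP[d mE]; have pdm := pm; rewrite mE mulnC in pdm.
have pn : prime_to p n by move: pdm; rewrite prime_toM => /andP[].
apply/esym/zlog_eq => //.
have [_ _ zT] := Zhat1P z; have [_ _ z0T] := Zhat1P z0.
rewrite -(zT _ _ pdm) -(z0T _ _ pdm) mE [(d * n)%N]mulnC (zlogE _ pdm).
by rewrite exprAC.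
Qed.

Lemma topgen_zpow (z : Z1) : topgen z -> exists l, z = zpow l z0.
Proof.
move=> zg.
have lc n : prime_to p n -> coprime (zlog z n) n.
  move=> pn; have [k z0k] := zg z0 n pn; rewrite (zlogE z pn) -exprM in z0k.
  have /eqP : (z0 n ^+ (zlog z n * k) == z0 n ^+ 1)%R by rewrite -z0k expr1.
  move/eqP; rewrite (eq_prim_root_expr (z0P pn)) => /eqP kE.
  have : coprime (zlog z n * k) n by rewrite -coprime_modl kE coprime_modl coprime1n.
  by rewrite coprimeMl => /andP[].
have lt n : prime_to p n -> (zlog z n < n)%N by case/(zlogP z).
have lm m d : prime_to p (m * d) -> zlog z (m * d)%N = zlog z m %[mod m].
  by move=> pmd; apply: zlog_mod; rewrite ?dvdn_mulr.
exists (ZhatUnit lt lc lm); apply/val_inj/funext => n /=.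
have [pn|pn] := boolP (prime_to p n); first exact: zlogE.
by have [-> // _ _] := Zhat1P z; have [-> // _ _] := Zhat1P z0; rewrite expr1n.
Qed.

Section CocharValue.
Variable E : groupType.
Implicit Types (g h : cochar p K E) (e : E).

Lemma cochar1 g : g 1 = 1.
Proof. by apply: (@mulgI _ (g 1)); rewrite -cocharM !mulg1. Qed.

Lemma cocharX g z k : g (z ^+ k) = g z ^+ k.
Proof. by elim: k => [|k IHk]; rewrite ?cochar1 // !expgS cocharM IHk. Qed.

Lemma cochar_zlog g : exists2 n, prime_to p n &
  forall m z, prime_to p m -> (n %| m)%N -> g z = g z0 ^+ zlog z m.
Proof.
have [n pn gn] := cochar_cont g; exists n => // m z pm nm.
rewrite -cocharX; apply: gn; rewrite zexpE (zlogE z pn).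
apply/eqP; rewrite (eq_prim_root_expr (z0P pn)); apply/eqP/esym.
exact: zlog_mod.
Qed.

(** A continuous homomorphism from [Zhat'(1)] is determined by the image of a
    generator, which can be any element of finite order prime to [p]. *)
Lemma cochar_inj g h : g z0 = h z0 -> g = h.
Proof.
move=> gh; apply: cochar_eq => z.
have [n pn gE] := cochar_zlog g; have [m pm hE] := cochar_zlog h.
have pnm : prime_to p (n * m) by rewrite prime_toM pn.
by rewrite (gE _ z pnm) ?dvdn_mulr // (hE _ z pnm) ?dvdn_mull // gh.
Qed.

Lemma cochar_torsion g : exists2 n, prime_to p n & g z0 ^+ n = 1.
Proof.
have [n pn gn] := cochar_cont g; exists n => //; rewrite -cocharX -[RHS](cochar1 g).
by apply: gn; rewrite zexpE (prim_expr_order (z0P pn)).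
Qed.

Lemma cochar_val g z n k : prime_to p n -> g z0 ^+ n = 1 ->
  z n = (z0 n ^+ k)%R -> g z = g z0 ^+ k.
Proof.
move=> pn gn zk; have [m pm gE] := cochar_zlog g.
have pnm : prime_to p (n * m) by rewrite prime_toM pn.
rewrite (gE _ z pnm) ?dvdn_mull //; apply: expg_eqmod gn _.
by rewrite zlog_mod ?dvdn_mulr //; apply: zlog_eq.
Qed.

Lemma cochar_of_subproof e n : prime_to p n -> e ^+ n = 1 ->
  exists g, g z0 = e.
Proof.
move=> pn en.
have gM : {morph (fun z : Z1 => e ^+ zlog z n) : z w / z * w}.
  by move=> z w /=; rewrite -expgnDr; apply: expg_eqmod en _; apply: zlogM.
have gc : zcontinuous (fun z : Z1 => e ^+ zlog z n).
  by exists n => // z w zw; apply: expg_eqmod en _; apply: zlog_eq; rewrite // -zlogE.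
by exists (Cochar gM gc) => /=; rewrite (expg_eqmod en (zlog1 pn)).
Qed.

End CocharValue.

Definition torsion_prime_to (E : groupType) : Prop :=
  forall e : E, exists2 n, prime_to p n & e ^+ n = 1.

Lemma tame_prime_to (G : finGroupType) : coprime #|G| p -> prime_to p #|G|.
Proof.
by move=> Gp; rewrite /prime_to coprime_sym Gp andbT; apply/card_gt0P; exists 1.
Qed.

Lemma torsion_finite (G : finGroupType) : coprime #|G| p -> torsion_prime_to G.
Proof.
move=> Gp e; exists #|G|; first exact: tame_prime_to.
by rewrite -cardsT expg_cardG ?inE.
Qed.

Section Coch.
Variables (E : groupType) (tE : torsion_prime_to E).

Definition coch_sig (e : E) : {g : cochar p K E | g z0 = e} :=
  cid (let: ex_intro2 n pn en := tE e in cochar_of_subproof pn en).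

(** By [cochE] and [cochK], evaluation at [z0] is a bijection from [E(-1)] to [E]. *)
Definition coch (e : E) : cochar p K E := sval (coch_sig e).

Lemma cochE e : coch e z0 = e. Proof. exact: svalP (coch_sig e). Qed.

Lemma cochK (g : cochar p K E) : coch (g z0) = g. Proof. by apply: cochar_inj; rewrite cochE. Qed.

End Coch.
End Zeta.

(** * Roots of unity as fractions *)

Section RootsAsFractions.
Local Open Scope group_scope.
Variables (p : nat) (K : closedFieldType) (z0 : Zhat1 p K).
Hypothesis z0P : forall n, prime_to p n -> n.-primitive_root (z0 n).
Local Notation mu := (muinf p K).
Implicit Types x y : mu.

Lemma muC x y : x * y = y * x.
Proof. by apply: val_inj; rewrite /= mulrC. Qed.

Lemma mu_zroot x : exists n a, prime_to p n /\ x = zroot z0 n ^+ a.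
Proof.
have [n pn xn] := muinfP x; have [a xa] := prim_rootP (z0P pn) xn.
by exists n, a; split=> //; apply: val_inj; rewrite [RHS]muexpE.
Qed.

Lemma zroot_eq n m a b : prime_to p n -> prime_to p m ->
  zroot z0 n ^+ a = zroot z0 m ^+ b <-> (a * m = b * n %[mod n * m])%N.
Proof.
move=> pn pm; have pnm : prime_to p (n * m) by rewrite prime_toM pn.
have pmn : prime_to p (m * n) by rewrite mulnC.
have [_ _ z0T] := Zhat1P z0.
have nE : (zroot z0 n ^+ a = zroot z0 (n * m) ^+ (a * m) :> K)%g.
  by rewrite !muexpE /= [(a * m)%N]mulnC exprM z0T.
have mE : (zroot z0 m ^+ b = zroot z0 (n * m) ^+ (b * n) :> K)%g.
  by rewrite !muexpE /= [(b * n)%N]mulnC exprM [(n * m)%N]mulnC z0T.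
split=> [e|/eqP e]; last first.
  apply: val_inj; rewrite [LHS]nE [RHS]mE !muexpE /=; apply/eqP.
  by rewrite (eq_prim_root_expr (z0P pnm)).
apply/eqP; rewrite -(eq_prim_root_expr (z0P pnm)); apply/eqP.
by move/(congr1 (@mu_val p K)): e; rewrite nE mE !muexpE.
Qed.

Lemma toQZ_eq (a b : rat) : toQZ a = toQZ b <-> (a - b)%R \is a Num.int.
Proof.
rewrite /toQZ; split=> [/eqP|ab]; first by rewrite -Quotient.idealrBE.
by apply/eqP; rewrite -Quotient.idealrBE.
Qed.

Lemma toQZD (a b : rat) : toQZ (a + b)%R = (toQZ a + toQZ b)%R.
Proof. exact: raddfD. Qed.

Lemma int_frac_sub (i j M : nat) : (0 < M)%N ->
  ((i%:R / M%:R - j%:R / M%:R)%R \is a @Num.int rat) <-> i = j %[mod M].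
Proof.
move=> M0; have M0' : (M%:R != 0 :> rat)%R by rewrite pnatr_eq0 -lt0n.
rewrite -mulrBl; split=> [/intrP[z zE]|ij].
  have ijz : (i%:Z = z * M%:Z + j%:Z)%R.
    apply: (@intr_inj rat); rewrite rmorphD rmorphM /= -zE.
    by rewrite -!pmulrn mulfVK // subrK.
  have := congr1 (fun t => (t %% M)%Z) ijz; rewrite modzMDl !modz_nat.
  by case.
rewrite (divn_eq i M) (divn_eq j M) ij !natrD opprD addrACA subrr addr0.
by rewrite !natrM -mulrBl mulfK // rpredB ?rpred_nat // natr_int.
Qed.

Lemma frac_eq n m a b : prime_to p n -> prime_to p m ->
  toQZ (a%:R / n%:R)%R = toQZ (b%:R / m%:R)%R <-> (a * m = b * n %[mod n * m])%N.
Proof.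
move=> pn pm; have [n0 m0] := (prime_to_gt0 pn, prime_to_gt0 pm).
have nm0 : (0 < n * m)%N by rewrite muln_gt0 n0.
have n0' : (n%:R != 0 :> rat)%R by rewrite pnatr_eq0 -lt0n.
have m0' : (m%:R != 0 :> rat)%R by rewrite pnatr_eq0 -lt0n.
rewrite toQZ_eq -(int_frac_sub _ _ nm0) !natrM.
suff -> : (a%:R / n%:R - b%:R / m%:R = a%:R * m%:R / (n%:R * m%:R) - b%:R * n%:R / (n%:R * m%:R) :> rat)%R by [].
by congr (_ - _)%R; [rewrite -mulf_div mulfV ?mulr1|rewrite [(n%:R * m%:R)%R]mulrC -mulf_div mulfV ?mulr1].
Qed.

(** The isomorphism of [Q/Z(1)] with the prime-to-[p] part of [Q/Z] given by [z0]. *)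
Definition qz (x : mu) : QZ :=
  xget 0%R [set t | exists a n, [/\ prime_to p n, x = zroot z0 n ^+ a
                                  & t = toQZ (a%:R / n%:R)%R]].

Lemma qz_zroot n a : prime_to p n -> qz (zroot z0 n ^+ a) = toQZ (a%:R / n%:R)%R.
Proof.
move=> pn; rewrite /qz; set A := (X in xget _ X).
have [b [m [pm e ->]]] : A (xget 0%R A).
  by apply: xgetPex; exists (toQZ (a%:R / n%:R)%R), a, n.
by apply/esym/frac_eq => //; apply/zroot_eq.
Qed.

Lemma qz_inj : injective qz.
Proof.
move=> x y; have [n [a [pn ->]]] := mu_zroot x; have [m [b [pm ->]]] := mu_zroot y.
by rewrite !qz_zroot // => /frac_eq e; apply/zroot_eq => //; apply: e.
Qed.

Lemma qzM x y : qz (x * y) = (qz x + qz y)%R.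
Proof.
have [n [a [pn xE]]] := mu_zroot x; have [m [b [pm yE]]] := mu_zroot y.
have pnm : prime_to p (n * m) by rewrite prime_toM pn.
have xE' : x = zroot z0 (n * m) ^+ (a * m).
  by rewrite xE; apply/zroot_eq => //; rewrite -!mulnA [(n * m)%N]mulnC.
have yE' : y = zroot z0 (n * m) ^+ (b * n).
  by rewrite yE; apply/zroot_eq => //; rewrite mulnA.
by rewrite xE' yE' -expgnDr !qz_zroot // -toQZD -mulrDl natrD.
Qed.

Lemma qz1 : qz 1 = 0%R.
Proof. by apply: (@addrI _ (qz 1)); rewrite addr0 -qzM mulg1. Qed.

Lemma qzX x k : qz (x ^+ k) = (qz x *+ k)%R.
Proof. by elim: k => [|k IHk]; rewrite ?qz1 // expgS qzM IHk mulrS. Qed.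

Section Shift.
Variables (E : groupType) (incl : mu -> E).
Hypotheses (inclM : {morph incl : x y / x * y})
  (inclC : forall x e, incl x * e = e * incl x).

Lemma incl1 : incl 1 = 1.
Proof. by apply: (@mulgI _ (incl 1)); rewrite -inclM !mulg1. Qed.

Lemma inclX x k : incl (x ^+ k) = incl x ^+ k.
Proof. by elim: k => [|k IHk]; rewrite ?incl1 // !expgS inclM IHk. Qed.

Lemma inclV x : incl x^-1 = (incl x)^-1.
Proof. by apply: (@mulgI _ (incl x)); rewrite -inclM !mulgV incl1. Qed.

(** In terms of values at [z0], the torsor structure over [Q/Z] on the lifts of a
    cocharacter becomes translation by [Q/Z(1)]. *)
Lemma shift_by_qz t (g g' : cochar p K E) :
  shift_by incl t g g' <-> exists2 x, t = qz x & g' z0 = incl x * g z0.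
Proof.
split=> [[a [n [pn -> g'E]]]|[x -> g'E]].
  by exists (zroot z0 n ^+ a); rewrite ?qz_zroot.
have [n [a [pn xE]]] := mu_zroot x; exists a, n; rewrite -qz_zroot -?xE //.
split=> //.
have hM : {morph (fun z => incl (zroot z n ^+ a) * g z) : z w / z * w}.
  move=> z w; have -> : zroot (z * w) n ^+ a = zroot z n ^+ a * zroot w n ^+ a.
    by apply: val_inj; rewrite [LHS]muexpE [RHS]/= !muexpE /= exprMn.
  by rewrite inclM cocharM !mulgA; congr (_ * _); rewrite -!mulgA [g z * _](esym (inclC _ _)).
have hc : zcontinuous (fun z => incl (zroot z n ^+ a) * g z).
  have [m pm gm] := cochar_cont g; exists (n * m)%N; first by rewrite prime_toM pn.
  move=> z w zw; have [_ _ zT] := Zhat1P z; have [_ _ wT] := Zhat1P w.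
  have pnm : prime_to p (n * m) by rewrite prime_toM pn.
  have pmn : prime_to p (m * n) by rewrite mulnC.
  have zwn : zroot z n = zroot w n by apply: val_inj; rewrite /= -(zT _ _ pnm) zw wT.
  rewrite zwn (gm z w) //; rewrite -(zT _ _ pmn) mulnC zw mulnC -(wT _ _ pmn).
  by [].
have /(congr1 (fun f : cochar p K E => f _)) : g' = Cochar hM hc.
  by apply: (cochar_inj z0P) => /=; rewrite g'E -xE.
by move=> h z; rewrite h.
Qed.

End Shift.
End RootsAsFractions.

(** * Galois actions determined by the Frobenius *)

Section FrobeniusAction.
Variables (F : finFieldType) (K : closedFieldType) (iota : {rmorphism F -> K}).
Hypothesis algK : forall x : K, algebraicOver iota x.
Variable p : nat.
Hypothesis charF : p \in [pchar F].
Local Notation q := #|F|.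
Local Notation Fr := (frob iota charF).
Local Notation agree := (@agree F K iota).

(** The powers of the Frobenius are distinguished by their action on a generator
    of the subfield of degree [d], so [Fr] has order [d] at level [d]. *)
Lemma agree_frob_mod d i j : (0 < d)%N -> agree d (Fr ^+ i)%g (Fr ^+ j)%g ->
  i = j %[mod d].
Proof.
move=> d0; have q1 := q_gt1 F.
have [y yP] := prim_root_exists iota charF (qX_prime_to charF d0).
have qd : (q ^ d = (q ^ d).-1.+1)%N by rewrite prednK // expn_gt0 ltnW.
have yq : y ^+ (q ^ d) = y by rewrite qd exprS (prim_expr_order yP) mulr1.
have yqm k : y ^+ (q ^ k) = y ^+ (q ^ (k %% d)).
  rewrite {1}(divn_eq k d) expnD exprM; congr (_ ^+ _).
  by elim: (k %/ d)%N => [|m IHm]; rewrite ?expr1 // mulSn expnD exprM yq.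
move=> /(_ y yq); rewrite !frobX (yqm i) (yqm j) => /eqP.
rewrite (eq_prim_root_expr yP); case: d d0 {qd yP yq yqm} => // -[|d] _ /eqP.
  by rewrite !modn1.
have small k : (q ^ (k %% d.+2) < (q ^ d.+2).-1)%N.
  have kd : (k %% d.+2 <= d.+1)%N by rewrite -ltnS ltn_pmod.
  apply: (@leq_ltn_trans (q ^ d.+1)); first by rewrite leq_exp2l.
  rewrite -ltnS prednK ?expn_gt0 ?(ltnW q1) // [(q ^ d.+2)%N]expnS.
  have q2 : (1 < q ^ d.+1)%N by rewrite -(expn0 q) ltn_exp2l.
  by apply: (@leq_trans (2 * q ^ d.+1)); rewrite ?leq_mul2r ?q1 ?orbT // mul2n -addnn -addn2 leq_add2l.
by rewrite (modn_small (small i)) (modn_small (small j)) => /eqP; rewrite eqn_exp2l // => /eqP.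
Qed.

Section Build.
Local Open Scope group_scope.
Variables (E : groupType) (f : E -> E).
Hypotheses (fM : {morph f : x y / x * y})
  (fper : forall e, exists2 d, (0 < d)%N & iter d f e = e).

Let per e := sval (cid2 (fper e)).
Let per_gt0 e : (0 < per e)%N. Proof. by rewrite /per; case: cid2. Qed.
Let perE e : iter (per e) f e = e. Proof. by rewrite /per; case: cid2. Qed.

Lemma iter_period e i j : i = j %[mod per e] -> iter i f e = iter j f e.
Proof.
have red k : iter k f e = iter (k %% per e) f e.
  rewrite {1}(divn_eq k (per e)) addnC iterD; congr iter.
  by elim: (k %/ per e)%N => [|m IHm] //; rewrite mulSn iterD IHm perE.
by move=> ij; rewrite red ij -red.
Qed.

Let fexp (s : absGal iota) d (d0 : (0 < d)%N) := sval (cid (frob_dense charF s d0)).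

(** The automorphism [f] has finite order on each orbit, so its powers can be indexed
    by the completion of the integers, which is the Galois group. *)
Definition frob_act (s : absGal iota) (e : E) : E := iter (fexp s (per_gt0 e)) f e.

Lemma frob_actE s e d j : (per e %| d)%N -> agree d s (Fr ^+ j) ->
  frob_act s e = iter j f e.
Proof.
move=> pd /(agree_dvd pd) sj; apply: iter_period.
apply: (agree_frob_mod (per_gt0 e)) => x xd; rewrite -sj //.
by rewrite /fexp; case: cid => /= k ->.
Qed.

Lemma frob_common s (es : seq E) : exists2 j,
  forall e, e \in es -> frob_act s e = iter j f e &
  exists2 d, (0 < d)%N & agree d s (Fr ^+ j).
Proof.
pose d := (\prod_(e <- es) per e)%N.
have d0 : (0 < d)%N by apply: prodn_gt0.
have [j sj] := frob_dense charF s d0; exists j; last by exists d.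
move=> e ees; apply: (@frob_actE _ _ d) => //.
by rewrite /d (big_rem e) //= dvdn_mulr.
Qed.

Lemma iter_morph k : {morph iter k f : x y / x * y}.
Proof. by elim: k => // k IHk x y; rewrite /= IHk fM. Qed.

Lemma frob_act_gal : is_gal_action frob_act.
Proof.
split=> [e|s t e|e].
- by rewrite (@frob_actE _ _ (per e) 0%N).
- have [j tj] := frob_dense charF t (per_gt0 e).
  have te : frob_act t e = iter j f e by apply: (@frob_actE _ _ (per e)).
  pose D := (per e * per (iter j f e))%N.
  have D0 : (0 < D)%N by rewrite muln_gt0 !per_gt0.
  have [i si] := frob_dense charF s D0.
  rewrite te (@frob_actE s _ D i) ?dvdn_mull // -iterD.
  apply: (@frob_actE _ _ (per e)) => //; rewrite expgnDr; apply: agreeM => //.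
  exact: agree_dvd (dvdn_mulr _ _) si.
have [y yP] := prim_root_exists iota charF (qX_prime_to charF (per_gt0 e)).
exists [:: y] => s sy; rewrite (@frob_actE _ _ (per e) 0%N) // => x xd.
have [->|x0] := eqVneq x 0%R; first by rewrite -gal_rmorphismE rmorph0.
have qd : (q ^ per e = (q ^ per e).-1.+1)%N by rewrite prednK // expn_gt0 ltnW ?q_gt1.
have xn : (x ^+ (q ^ per e).-1 = 1)%R by apply: (mulfI x0); rewrite -exprS -qd mulr1 xd.
by have [i ->] := prim_rootP yP xn; rewrite galX sy ?mem_head.
Qed.

Lemma frob_actM s : {morph frob_act s : x y / x * y}.
Proof.
move=> x y; have [j js _] := frob_common s [:: x; y; x * y].
by rewrite !js ?iter_morph // !inE ?eqxx ?orbT.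
Qed.

(** The absolute Galois group is procyclic, generated by the Frobenius: an action
    is the same as an automorphism all of whose orbits are finite. *)
Definition frob_etale : etale_action iota E := EtaleAction frob_act_gal frob_actM.

Lemma frob_etaleE e : frob_etale Fr e = f e.
Proof. by rewrite [LHS](@frob_actE _ _ (per e) 1%N). Qed.

End Build.

Section Star.
Local Open Scope group_scope.
Variables (z0 : Zhat1 p K) (z0P : forall n, prime_to p n -> n.-primitive_root (z0 n)).
Variables (E : groupType) (aE : etale_action iota E) (tE : torsion_prime_to p E).
Local Notation coch := (coch z0P tE).

(** The Galois action on [E(-1)], transported to [E] by evaluation at [z0]. *)
Definition star (s : absGal iota) (e : E) : E := gal_cochar aE s (coch e) z0.

Lemma starE s (g : cochar p K E) : gal_cochar aE s g z0 = star s (g z0).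
Proof. by rewrite /star cochK. Qed.

Lemma gal_cocharM s t (g : cochar p K E) :
  gal_cochar aE (s * t) g = gal_cochar aE s (gal_cochar aE t g).
Proof.
have [_ aM _] := eact_gal aE; apply: cochar_eq => z.
rewrite -[LHS]/(aE (s * t) (g (gal_zhat (s * t)^-1 z))) invMg aM.
by congr (aE s (aE t (g _))); apply/val_inj/funext.
Qed.

Lemma star_action : is_gal_action star.
Proof.
have [a1 aM ac] := eact_gal aE; split=> [e|s t e|e].
- rewrite -[LHS]/(aE 1 (coch e (gal_zhat 1^-1 z0))) a1 invg1 -[RHS](cochE z0P tE).
  by congr (coch e _); apply/val_inj/funext. 
- by rewrite /star gal_cocharM cochK.
have [S Se] := ac e; have [n pn gn] := cochar_cont (coch e).
exists (z0 n :: S) => s sS; rewrite /star /= (gn _ z0); last first.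
  by rewrite -[LHS]/(s^-1 (z0 n)) -{1}(sS (z0 n)) ?mem_head // galK.
by rewrite cochE Se // => y yS; apply: sS; rewrite inE yS orbT.
Qed.

Lemma starM s t e : star (s * t) e = star s (star t e).
Proof. by have [_ ->] := star_action. Qed.

Lemma star1 e : star 1 e = e.
Proof. by have [-> _] := star_action. Qed.

Lemma star_inj s : injective (star s).
Proof. by move=> e e' /(congr1 (star s^-1)); rewrite -!starM mulVg !star1. Qed.

Lemma gal_zhat_frob (z : Zhat1 p K) : gal_zhat Fr z = z ^+ q.
Proof. by apply/val_inj/funext => n; rewrite [RHS]zexpE. Qed.

(** Frobenius raises [z0] to the power [q]. *)
Lemma star_frob e : star Fr e ^+ q = aE Fr e.
Proof. by rewrite /star -cocharX -gal_zhat_frob /= gal_zhatK cochE. Qed.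

Lemma star_conj s x e : star s (x * e * x^-1) = aE s x * star s e * (aE s x)^-1.
Proof.
rewrite -[e in LHS](cochE z0P tE) -[_ * _ * _]/(cochar_conj x (coch e) z0) -starE.
by rewrite /star /= !eactM eactV.
Qed.

Lemma conj_classE (g : cochar p K E) : conj_class g = [set h | exists x, h z0 = x * g z0 * x^-1].
Proof.
apply/seteqP; split=> [h [x ->]|h [x hx]]; first by exists x.
by exists x; apply: (cochar_inj z0P).
Qed.

End Star.

Section StarMorphism.
Local Open Scope group_scope.
Variables (z0 : Zhat1 p K) (z0P : forall n, prime_to p n -> n.-primitive_root (z0 n)).
Variables (E : groupType) (aE : etale_action iota E) (tE : torsion_prime_to p E).
Variables (E' : groupType) (aE' : etale_action iota E') (tE' : torsion_prime_to p E').
Variable f : E -> E'.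
Hypotheses (fM : {morph f : x y / x * y}) (f_gal : forall s e, f (aE s e) = aE' s (f e)).

Lemma star_morph s e : f (star z0P aE tE s e) = star z0P aE' tE' s (f e).
Proof.
rewrite -[e in RHS](cochE z0P tE) -[f (coch z0P tE e z0)]/(cochar_map fM (coch z0P tE e) z0) -starE.
by rewrite /star /= f_gal.
Qed.

End StarMorphism.

Section StarShift.
Local Open Scope group_scope.
Variables (z0 : Zhat1 p K) (z0P : forall n, prime_to p n -> n.-primitive_root (z0 n)).
Variables (E : groupType) (aE : etale_action iota E) (tE : torsion_prime_to p E).
Variable incl : muinf p K -> E.
Hypotheses (inclM : {morph incl : x y / x * y})
  (inclC : forall x e, incl x * e = e * incl x)
  (incl_gal : forall (s : absGal iota) x y, mu_val y = s (mu_val x) ->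
    aE s (incl x) = incl y).

Lemma shift_by_gal t s (g g' : cochar p K E) : shift_by incl t g g' ->
  shift_by incl t (gal_cochar aE s g) (gal_cochar aE s g').
Proof.
case=> a [n [pn -> g'E]]; exists a, n; split=> // z /=.
rewrite g'E eactM; congr (_ * _); apply: incl_gal.
by rewrite !muexpE galX /= galKV.
Qed.

(** The Galois group acts trivially on [Q/Z(1)(-1)], a subgroup of [Q/Z]. *)
Lemma star_incl s x e : star z0P aE tE s (incl x * e) = incl x * star z0P aE tE s e.
Proof.
have : shift_by incl (qz z0 x) (coch z0P tE e) (coch z0P tE (incl x * e)).
  by apply/(shift_by_qz z0P inclM inclC); exists x; rewrite ?cochE.
move=> /(shift_by_gal s)/(shift_by_qz z0P inclM inclC)[y /(qz_inj z0P) <-].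
by [].
Qed.

End StarShift.
End FrobeniusAction.

(** * Conjugacy classes of cocharacters and their Galois orbits *)

Section GeometricClasses.
Local Open Scope group_scope.
Variables (F : finFieldType) (K : closedFieldType) (iota : {rmorphism F -> K}).
Hypothesis algK : forall x : K, algebraicOver iota x.
Variable p : nat.
Hypothesis charF : p \in [pchar F].
Local Notation Fr := (frob iota charF).
Variables (z0 : Zhat1 p K) (z0P : forall n, prime_to p n -> n.-primitive_root (z0 n)).
Variables (G : finGroupType) (aG : etale_action iota G) (tameG : coprime #|G| p).
Variable C : conj_subscheme p aG.

Definition tG : torsion_prime_to p G := torsion_finite tameG.
Local Notation coG := (coch z0P tG).
Definition starG := star z0P aG tG.

(** Evaluation at [z0] identifies [G(-1)] with [G], and [C] with this set. *)
Definition pointsC : {set G} := [set a | `[< cs_set C (coG a) >]]%SET.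
Local Notation S := pointsC.

Lemma pointsCE (g : cochar p K G) : (g z0 \in S) = `[< cs_set C g >].
Proof. by rewrite inE cochK. Qed.

Lemma pointsCP a : reflect (cs_set C (coG a)) (a \in S).
Proof. by rewrite inE; apply: asboolP. Qed.

Lemma pointsC_conj x a : a \in S -> x * a * x^-1 \in S.
Proof.
move=> /pointsCP Ca; rewrite -[a](cochE z0P tG) -[_ * _ * _]/(cochar_conj x (coG a) z0).
by rewrite pointsCE; apply/asboolP/cs_conj.
Qed.

Lemma pointsC_conjg x a : a \in S -> a ^ x \in S.
Proof. by move=> aS; rewrite conjgE -{2}[x]invgK mulgA pointsC_conj. Qed.

Lemma pointsC_star s a : a \in S -> starG s a \in S.
Proof.
move=> /pointsCP Ca; rewrite /starG -[a in star _ _ _ _ a](cochE z0P tG) -starE.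
by rewrite pointsCE; apply/asboolP/cs_gal.
Qed.

Lemma generated_by_points : generates C -> <<S>> = [set: G]%SET.
Proof.
move=> genC; apply/eqP; rewrite finset.eqEsubset finset.subsetT -genC gen_subG /=.
apply/fintype.subsetP=> x; rewrite inE => /asboolP[g Cg [z <-]].
have [n pn gn] := cochar_zlog z0P g; rewrite (gn n z) //.
by apply/groupX/mem_gen; rewrite pointsCE; apply/asboolP.
Qed.

Definition classesC : {set {set G}} := [set a ^: [set: G]%SET | a in S]%SET.

Lemma classesC_sub A a : A \in classesC -> a \in A -> a \in S.
Proof. by case/imsetP=> b bS -> /imsetP[x _ ->]; apply: pointsC_conjg. Qed.

Lemma classesC_mem a : a \in S -> a ^: [set: G]%SET \in classesC.
Proof. by move=> aS; apply/imsetP; exists a. Qed.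

Lemma classesC_eq A a : A \in classesC -> a \in A -> A = a ^: [set: G]%SET.
Proof. by case/imsetP=> b bS -> /class_eqP ->. Qed.

Lemma classesC_repr A : A \in classesC -> repr A \in A.
Proof. by case/imsetP=> b bS ->; rewrite (mem_repr b) ?class_refl. Qed.

(** Under evaluation at [z0], conjugacy classes in [G(-1)] are conjugacy classes of
    [G] ([conj_class_cls]). *)
Definition cls (A : {set G}) : set (cochar p K G) := [set g | g z0 \in A].

Lemma cls_inj : injective cls.
Proof.
move=> A B AB; apply/setP=> a; have := congr1 (fun X => X (coG a)) AB.
rewrite /cls /= cochE => e; by apply/idP/idP; rewrite e.
Qed.

Lemma conj_class_cls (g : cochar p K G) : conj_class g = cls (g z0 ^: [set: G]%SET).
Proof.
rewrite (conj_classE z0P); apply/seteqP; split=> [h [x hx]|h] /=.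
  apply/imsetP; exists x^-1; rewrite ?inE // hx conjgE invgK mulgA //.
by case/imsetP=> x _ ->; exists x^-1; rewrite conjgE invgK mulgA.
Qed.

Lemma geom_classesE : geom_classes C = cls @` [set` classesC].
Proof.
apply/seteqP; split=> [_ [g Cg <-]|_ [A /imsetP[a /pointsCP Ca ->] <-]].
  exists (g z0 ^: [set: G]%SET); last by rewrite conj_class_cls.
  by apply: classesC_mem; rewrite pointsCE; apply/asboolP.
by exists (coG a); rewrite ?conj_class_cls ?cochE.
Qed.

Lemma starG_inj s : injective (starG s). Proof. exact: star_inj. Qed.

Lemma starG_conj s x a : starG s (x * a * x^-1) = aG s x * starG s a * (aG s x)^-1.
Proof. exact: star_conj. Qed.

Lemma starG_class s a : starG s @: (a ^: [set: G]%SET) = starG s a ^: [set: G]%SET.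
Proof.
have [a1 aM _] := eact_gal aG.
apply/setP=> b; apply/imsetP/imsetP=> [[_ /imsetP[x _ ->] ->]|[x _ ->]].
  exists (aG s x^-1)^-1; rewrite ?inE // conjgE -{2}[x]invgK mulgA starG_conj.
  by rewrite conjgE invgK mulgA.
exists (a ^ (aG s^-1 x)); first by rewrite memJ_class ?inE.
rewrite [a ^ _]conjgE -{2}[aG _ x]invgK mulgA starG_conj eactV.
by rewrite -!aM mulgV a1 invgK conjgE mulgA.
Qed.

Lemma classesC_star s A : A \in classesC -> starG s @: A \in classesC.
Proof.
by case/imsetP=> a aS ->; rewrite starG_class classesC_mem ?pointsC_star.
Qed.

Lemma gal_class_cls s A : gal_class aG s (cls A) = cls (starG s @: A).
Proof.
apply/seteqP; split=> [_ [g gA <-]|g /= /imsetP[a aA ga]].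
  have : gal_cochar aG s g z0 \in starG s @: A by rewrite (starE z0P aG tG) imset_f.
  by [].
exists (coG a); first by rewrite /cls /= cochE.
by apply: (cochar_inj z0P); rewrite (starE z0P aG tG) cochE ga.
Qed.

Definition frob_class (A : {set G}) : {set G} := starG Fr @: A.

Lemma frob_class_inj : injective frob_class.
Proof. exact: imset_inj (@starG_inj Fr). Qed.

Definition frob_perm : {perm {set G}} := perm frob_class_inj.

Lemma starG_setM s t (A : {set G}) : starG (s * t) @: A = starG s @: (starG t @: A).
Proof. by rewrite -imset_comp; apply: eq_imset => a /=; rewrite /starG starM. Qed.

Lemma frob_permX j A : (frob_perm ^+ j) A = starG (Fr ^+ j) @: A.
Proof.
elim: j A => [|j IHj] A; first by rewrite perm1 -[LHS]imset_id; apply: eq_imset => a; rewrite /starG star1.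
by rewrite expgSr permM IHj permE /frob_class expgS starG_setM.
Qed.

(** Finitely many open stabilizers contain a common open subgroup. *)
Lemma uniform_level (I : finType) (X : Type) (act : absGal iota -> X -> X) (x : I -> X) :
  is_gal_action act ->
  exists2 d, (0 < d)%N & forall s t, agree d s t -> forall i, act s (x i) = act t (x i).
Proof.
move=> actP; have /choice[d dP] i : exists d, (0 < d)%N /\
    forall s t, agree d s t -> act s (x i) = act t (x i).
  by have [d d0 dP] := gal_action_level algK charF (x i) actP; exists d.
exists (\prod_i d i)%N; first by rewrite prodn_gt0 // => i; case: (dP i).
move=> s t st i; have [_ di] := dP i; apply: di; apply: agree_dvd st.
by rewrite (bigD1 i) //= dvdn_mulr.
Qed.

Lemma starG_dense s : exists j, forall a, starG s a = starG (Fr ^+ j) a.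
Proof.
have [d d0 dP] := uniform_level (id : G -> G) (star_action z0P aG tG).
by have [j sj] := frob_dense charF s d0; exists j => a; apply: dP.
Qed.

(** The Galois orbits are the cycles of the Frobenius, by density. *)
Lemma gal_orbitE (A : {set G}) :
  [set starG s @: A | s in [set: absGal iota]] = [set` porbit frob_perm A].
Proof.
apply/seteqP; split=> [_ [s _ <-]|B /= /porbitP[j ->]].
  have [j sj] := starG_dense s; apply/porbitP; exists j; rewrite frob_permX.
  exact: eq_imset.
by exists (Fr ^+ j); rewrite ?frob_permX.
Qed.

Lemma classesC_frob j A : ((frob_perm ^+ j) A \in classesC) = (A \in classesC).
Proof.
apply/idP/idP=> [|AC]; last by rewrite frob_permX classesC_star.
rewrite frob_permX => /(classesC_star (Fr ^+ j)^-1).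
rewrite -starG_setM mulVg [X in X \in _](_ : _ = A) // -[RHS]imset_id.
by apply: eq_imset => a; rewrite /starG star1.
Qed.

Definition orbitsC : {set {set {set G}}} := [set porbit frob_perm A | A in classesC]%SET.

Lemma pi0E : pi0 C = (fun O : {set {set G}} => cls @` [set` O]) @` [set` orbitsC].
Proof.
have orbE A : [set gal_class aG s (cls A) | s in [set: absGal iota]] =
              cls @` [set` porbit frob_perm A].
  rewrite -gal_orbitE; apply/seteqP; split=> [_ [s _ <-]|_ [_ [s _ <-] <-]].
    by exists (starG s @: A); rewrite ?gal_class_cls //; exists s.
  by exists s; rewrite ?gal_class_cls.
rewrite /pi0 geom_classesE; apply/seteqP; split.
  move=> _ [_ [A AC <-] <-]; exists (porbit frob_perm A); rewrite ?orbE //=.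
  by apply: imset_f.
move=> _ [O /= /imsetP[A AC ->] <-]; exists (cls A); last exact: orbE.
by exists A.
Qed.

Lemma orbit_set_inj : injective (fun O : {set {set G}} => cls @` [set` O]).
Proof.
move=> O O' OO; apply/setP=> A; apply/idP/idP=> AO.
  have : (cls @` [set` O]) (cls A) by exists A.
  by rewrite OO => -[B BO /cls_inj <-].
have : (cls @` [set` O']) (cls A) by exists A.
by rewrite -OO => -[B BO /cls_inj <-].
Qed.

Lemma field_degreeE (O : {set {set G}}) : field_degree (cls @` [set` O]) = #|O|.
Proof.
have -> : cls @` [set` O] = [set` [fset cls A | A in O]%fset].
  apply/seteqP; split=> [_ [A AO <-]|_ /imfsetP[A AO ->]] /=; last by exists A.
  by apply/imfsetP; exists A.
by rewrite /field_degree set_fsetK card_imfset /= -?cardE //; apply: cls_inj.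
Qed.

Lemma geom_ptE (O : {set {set G}}) : O != finset.set0 ->
  exists2 A, A \in O & geom_pt (cls @` [set` O]) = cls A.
Proof.
case/set0Pn=> A AO; have : (cls @` [set` O]) (geom_pt (cls @` [set` O])).
  by apply: (@xgetPex _ set0 (cls @` [set` O])); exists (cls A), A.
by case=> B BO BE; exists B.
Qed.

(** Summing over the Galois orbits of classes, then over the classes of an orbit. *)
Lemma sum_pi0 (V : zmodType) (f : set (set (cochar p K G)) -> V) (v : {set G} -> V) :
  (forall O, O \in orbitsC -> f (cls @` [set` O]) = (\sum_(A in O) v A)%R) ->
  (\sum_(c \in pi0 C) f c = \sum_(A in classesC) v A)%R.
Proof.
move=> fE; rewrite pi0E fsbig_image; last by move=> O O' _ _ /orbit_set_inj.
rewrite fsbig_finite /=; last exact: finite_finpred.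
rewrite (partition_big_imset (porbit frob_perm)) /=.
transitivity (\sum_(O in orbitsC) f (cls @` [set` O]))%R.
  rewrite -[RHS]big_enum; apply: perm_big; rewrite uniq_perm ?enum_uniq ?fset_uniq //.
  move=> O; rewrite mem_enum in_fset_set; last exact: finite_finpred.
  by apply/idP/idP => [/set_mem|OC]; rewrite ?inE.
apply: eq_bigr => O OC; rewrite fE //; apply: eq_bigl => A.
case/imsetP: OC => B BC ->; rewrite eq_porbit_mem.
apply/idP/andP=> [AB|[]//]; split=> //; case/porbitP: AB => j ->.
by rewrite classesC_frob.
Qed.

End GeometricClasses.

(** * Algebraic residues as conjugation-equivariant lifts *)

Section CentralExtension.
Local Open Scope group_scope.
Variables (F : finFieldType) (K : closedFieldType) (iota : {rmorphism F -> K}).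
Hypothesis algK : forall x : K, algebraicOver iota x.
Variable p : nat.
Hypothesis charF : p \in [pchar F].
Variables (z0 : Zhat1 p K) (z0P : forall n, prime_to p n -> n.-primitive_root (z0 n)).
Variables (G : finGroupType) (aG : etale_action iota G) (tameG : coprime #|G| p).
Variable C : conj_subscheme p aG.
Local Notation coG := (coch z0P (tG tameG)).
Local Notation starG := (starG z0P aG tameG).
Local Notation S := (pointsC z0P tameG C).
Local Notation classesC := (classesC z0P tameG C).
Local Notation cls := (@cls K p z0 G).
Local Notation qz := (qz z0).
Variable B : central_ext p aG.
Local Notation pr := (@ce_proj F K iota p G aG B).
Local Notation incl := (@ce_incl F K iota p G aG B).

Lemma ce_proj1 : pr 1 = 1.
Proof. by apply: (@mulgI _ (pr 1)); rewrite -ce_projM !mulg1. Qed.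

Lemma ce_projV e : pr e^-1 = (pr e)^-1.
Proof. by apply: (@mulgI _ (pr e)); rewrite -ce_projM !mulgV ce_proj1. Qed.

Lemma ce_projX e k : pr (e ^+ k) = pr e ^+ k.
Proof. by elim: k => [|k IHk]; rewrite ?ce_proj1 // !expgS ce_projM IHk. Qed.

Lemma ce_proj_incl x : pr (incl x) = 1.
Proof. by apply/ce_exact; exists x. Qed.

Lemma ce_projJ e b : pr (e * b * e^-1) = pr e * pr b * (pr e)^-1.
Proof. by rewrite !ce_projM ce_projV. Qed.

Lemma ce_same_proj e e' : pr e = pr e' -> exists x, e = incl x * e'.
Proof.
move=> ee'; have /ce_exact[x xE] : pr (e * e'^-1) = 1 by rewrite ce_projM ce_projV ee' mulgV.
by exists x; rewrite -xE mulgKV.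
Qed.

Lemma muinf_torsion (x : muinf p K) : exists2 n, prime_to p n & x ^+ n = 1.
Proof.
have [n pn xn] := muinfP x; exists n => //.
by apply: val_inj; rewrite [LHS]muexpE xn.
Qed.

Lemma ce_torsion : torsion_prime_to p B.
Proof.
move=> e; have [n pn en] := torsion_finite tameG (pr e).
have /ce_exact[x xE] : pr (e ^+ n) = 1 by rewrite ce_projX.
have [m pm xm] := muinf_torsion x; exists (n * m)%N; first by rewrite prime_toM pn.
by rewrite expgnA xE -(inclX (@ce_inclM _ _ _ _ _ _ B)) xm (incl1 (@ce_inclM _ _ _ _ _ _ B)).
Qed.

Local Notation coB := (coch z0P ce_torsion).
Local Notation starB := (star z0P (ce_act B) ce_torsion).

Lemma starB_incl s x e : starB s (incl x * e) = incl x * starB s e.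
Proof.
apply: star_incl; [exact: ce_inclM|exact: ce_central|].
exact: ce_incl_gal.
Qed.

Lemma starB_proj s e : pr (starB s e) = starG s (pr e).
Proof. exact: star_morph (@ce_projM _ _ _ _ _ _ B) (@ce_proj_gal _ _ _ _ _ _ B) _ _. Qed.

Lemma shiftB t (g g' : cochar p K B) :
  shift_by incl t g g' <-> exists2 x, t = qz x & g' z0 = incl x * g z0.
Proof. by apply: shift_by_qz; [exact: z0P|exact: ce_inclM|exact: ce_central]. Qed.

Lemma pi0_points c (g : cochar p K G) : pi0 C c -> c (conj_class g) -> g z0 \in S.
Proof.
rewrite (pi0E algK charF z0P tameG) => -[O /imsetP[A Acl ->] <-] [D DO].
rewrite (conj_class_cls z0P) => /(cls_inj z0P tameG) DE.
have gC : g z0 ^: [set: G]%SET \in classesC.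
  by rewrite -DE; case/porbitP: DO => j ->; rewrite classesC_frob.
exact: classesC_sub gC (class_refl _ _).
Qed.

(** The sections [M_c] over the classes in [C] that make the residues algebraic,
    evaluated at [z0] and collected in one function ([lift_exists]); conversely such
    a function gives all the sections ([lift_sectionP]). *)
Definition is_lift (m : G -> B) : Prop :=
  (forall a, a \in S -> pr (m a) = a) /\
  (forall e a, a \in S -> m (pr e * a * (pr e)^-1) = e * m a * e^-1).

Lemma lift_exists :
  (forall c, pi0 C c -> algebraic_residue B c) -> exists m, is_lift m.
Proof.
move=> alg; have exM c : exists M : set (cochar p K B), pi0 C c -> residue_section c M.
  by have [/alg[M MP]|nc] := pselect (pi0 C c); [exists M|exists set0].
have [M MP] := choice exM.
pose orb (a : G) : set (set (cochar p K G)) :=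
  [set gal_class aG s (conj_class (coG a)) | s in [set: absGal iota]].
have orbP a : a \in S -> pi0 C (orb a).
  by move=> /pointsCP Ca; exists (conj_class (coG a)) => //; exists (coG a).
have orbC a : orb a (conj_class (coG a)).
  exists 1 => //; rewrite (conj_class_cls z0P) (gal_class_cls z0P aG tameG); congr cls.
  by rewrite -[RHS]imset_id; apply: eq_imset => b; apply: star1.
have exm a : exists e, a \in S ->
    exists b : cochar p K B, [/\ M (orb a) b, cochar_proj b = coG a & e = b z0].
  have [aS|] := boolP (a \in S); last by exists 1.
  have [_ [_ _ sur]] := MP _ (orbP a aS).
  have [b Mb bE] := sur (coG a) (orbC a).
  by exists (b z0) => _; exists b.
have [m mP] := choice exm.
exists m; split=> [a aS|e a aS].
  have [b [_ bE ->]] := mP a aS; rewrite -[RHS](cochE z0P (tG tameG)) -bE //.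
have aS' := pointsC_conj (pr e) aS.
have [b [Mb bE ->]] := mP a aS; have [b' [Mb' bE' ->]] := mP _ aS'.
have conjE : coG (pr e * a * (pr e)^-1) = cochar_conj (pr e) (coG a).
  by apply: (cochar_inj z0P); rewrite cochE /= cochE.
have orbE : orb (pr e * a * (pr e)^-1) = orb a.
  rewrite /orb conjE; congr [set _ | _ in _]; apply/funext => s; congr (gal_class _ _ _).
  rewrite !(conj_class_cls z0P); congr cls; rewrite /= cochE; apply/class_eqP.
  by apply/imsetP; exists (pr e)^-1; rewrite ?inE // conjgE invgK mulgA.
have [Mconj [_ inj _]] := MP _ (orbP a aS); rewrite orbE in Mb'.
suff -> : b' = cochar_conj e b by [].
apply: inj; rewrite ?inE //; first exact: Mconj.
rewrite bE' conjE -bE; apply: (cochar_inj z0P) => /=; first by rewrite ce_projJ.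
Qed.

Section Lift.
Variable m : G -> B.
Hypothesis mP : is_lift m.

Lemma lift_proj a : a \in S -> pr (m a) = a. Proof. by case: mP => h _; apply: h. Qed.

Lemma liftJ e a : a \in S -> m (pr e * a * (pr e)^-1) = e * m a * e^-1.
Proof. by case: mP => _; apply. Qed.

Definition lift_section (c : set (set (cochar p K G))) : set (cochar p K B) :=
  [set b | c (conj_class (cochar_proj b)) /\ b z0 = m (pr (b z0))].

Lemma lift_sectionP c : pi0 C c -> residue_section c (lift_section c).
Proof.
move=> cC; split=> [e b [cb bm]|].
  have bS : pr (b z0) \in S by apply: (pi0_points cC cb).
  split; last by rewrite /= ce_projJ liftJ // -bm.
  suff -> : conj_class (cochar_proj (cochar_conj e b)) = conj_class (cochar_proj b) by [].
  rewrite !(conj_class_cls z0P); congr cls; rewrite /= ce_projJ; apply/class_eqP.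
  by apply/imsetP; exists (pr e)^-1; rewrite ?inE // conjgE invgK mulgA.
split=> [b []//|b b'|g cg].
  rewrite !inE => -[_ bm] [_ bm'] bb'; apply: (cochar_inj z0P).
  by rewrite bm bm'; congr m; exact: (congr1 (fun h : cochar p K G => h z0) bb').
have gS : g z0 \in S by apply: (pi0_points cC cg).
have gE : cochar_proj (coB (m (g z0))) = g.
  by apply: (cochar_inj z0P); rewrite /= cochE lift_proj.
exists (coB (m (g z0))) => //; split; rewrite ?gE //.
by rewrite cochE lift_proj.
Qed.

Lemma lift_algebraic c : pi0 C c -> algebraic_residue B c.
Proof. by move=> cC; exists (lift_section c); apply: lift_sectionP. Qed.

(** The lift need not be Galois equivariant. Its defect has values in the central
    kernel and is constant on conjugacy classes ([defect_class]). *)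
Definition defect (s : absGal iota) (a : G) : muinf p K :=
  xget 1 [set x | starB s (m a) = incl x * m (starG s a)].

Lemma defectE s a : a \in S -> starB s (m a) = incl (defect s a) * m (starG s a).
Proof.
move=> aS; have [x xE] : exists x, starB s (m a) = incl x * m (starG s a).
  by apply: ce_same_proj; rewrite starB_proj !lift_proj ?pointsC_star.
by rewrite /defect; apply: (@xgetPex _ 1 [set x | starB s (m a) = incl x * m (starG s a)]); exists x.
Qed.

Lemma defect_eq s a x : a \in S -> starB s (m a) = incl x * m (starG s a) -> defect s a = x.
Proof. by move=> aS; rewrite defectE // => /mulIg/ce_incl_inj. Qed.

Lemma defect_conj s x a : a \in S -> defect s (x * a * x^-1) = defect s a.
Proof.
move=> aS; apply: defect_eq; first exact: pointsC_conj.
have [e <-] := ce_proj_surj B x.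
rewrite liftJ // star_conj defectE // starG_conj -ce_proj_gal.
by rewrite liftJ ?pointsC_star // !mulgA ce_central.
Qed.

Lemma defect_class s A a b : A \in classesC -> a \in A -> b \in A ->
  defect s a = defect s b.
Proof.
move=> Acl aA; rewrite (classesC_eq Acl aA) => /imsetP[x _ ->].
by rewrite conjgE -{2}[x]invgK mulgA defect_conj // (classesC_sub Acl aA).
Qed.

Lemma defectM s t a : a \in S ->
  defect (s * t) a = defect s (starG t a) * defect t a.
Proof.
move=> aS; apply: defect_eq => //; rewrite starM defectE // starB_incl.
rewrite defectE ?pointsC_star // ce_inclM /starG starM mulgA.
by rewrite -!ce_inclM muC.
Qed.

Lemma defect_level : exists2 d, (0 < d)%N &
  forall s t, agree d s t -> forall a, a \in S -> defect s a = defect t a.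
Proof.
have [d d0 dP] := uniform_level algK charF m (star_action z0P (ce_act B) ce_torsion).
have [e e0 eP] := uniform_level algK charF (id : G -> G) (star_action z0P aG (tG tameG)).
exists (d * e)%N => [|s t st a aS]; first by rewrite muln_gt0 d0.
apply: defect_eq => //; rewrite (dP s t) ?defectE //; last exact: agree_dvd (dvdn_mulr _ (dvdnn d)) st.
by congr (_ * m _); apply/esym/eP; apply: agree_dvd (dvdn_mull _ (dvdnn e)) st.
Qed.

(** Any two sections above a class differ by a shift, which the action of the
    Galois group preserves, so the residue can be computed on the section defined
    by [m]. *)
Lemma residueE c A s : pi0 C c -> geom_pt c = cls A -> A \in classesC ->
  c (cls A) -> starG s @: A = A -> residue B c s = qz (defect s (repr A)).
Proof.
move=> cC cA Acl cclsA sA; have rA := classesC_repr Acl; set a := repr A.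
have aS : a \in S by apply: classesC_sub Acl rA.
have clsg (g : cochar p K G) : g z0 \in A -> conj_class g = cls A.
  by move=> gA; rewrite (conj_class_cls z0P) -(classesC_eq Acl gA).
have dA b : b \in A -> defect s b = defect s a by move=> bA; apply: defect_class Acl bA rA.
have SA b : b \in A -> b \in S by apply: classesC_sub.
have stA b : b \in A -> starG s b \in A by move=> bA; rewrite -sA imset_f.
pose good t (M : set (cochar p K B)) := residue_section c M /\
  let Mc := (M : set (cochar p K B)) `&` [set g | geom_pt c (cochar_proj g)] in
  gal_cochar (ce_act B) s @` Mc = [set g' | exists2 g, Mc g & shift_by incl t g g'].
have good0 : good (qz (defect s a)) (lift_section c).
  split; first exact: lift_sectionP.
  rewrite cA /=; apply/seteqP; split=> [_ [b [[cb bm] bA] <-]|b' [b [[cb bm] bA]]].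
    have bA' : pr (b z0) \in A by [].
    exists (coB (m (starG s (pr (b z0))))).
      have prE : cochar_proj (coB (m (starG s (pr (b z0))))) z0 = starG s (pr (b z0)).
        by rewrite /= cochE lift_proj ?pointsC_star ?SA.
      split; last by rewrite /= /cls /= -[_ \in A]/(cochar_proj _ z0 \in A) prE stA.
      split; first by rewrite clsg ?prE ?stA.
      by rewrite cochE lift_proj ?pointsC_star ?SA.
    apply/shiftB; exists (defect s a) => //.
    by rewrite cochE (starE z0P (ce_act B) ce_torsion) {1}bm defectE ?SA // dA.
  have bA' : pr (b z0) \in A by [].
  move=> /shiftB[x /(qz_inj z0P) <- b'E].
  have /imsetP[a' a'A a'E] : pr (b z0) \in starG s @: A by rewrite sA.
  exists (coB (m a')).
    have prE : cochar_proj (coB (m a')) z0 = a' by rewrite /= cochE lift_proj ?SA.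
    split; last by rewrite /= /cls /= -[_ \in A]/(cochar_proj _ z0 \in A) prE.
    split; first by rewrite clsg ?prE.
    by rewrite cochE lift_proj ?SA.
  apply: (cochar_inj z0P); rewrite (starE z0P (ce_act B) ce_torsion) cochE.
  by rewrite b'E bm a'E defectE ?SA // dA.
have : exists2 M, residue_section c M & good (residue B c s) M.
  have [M M1 M2] : [set t | exists2 M, residue_section c M & 
     let Mc := (M : set (cochar p K B)) `&` [set g | geom_pt c (cochar_proj g)] in
     gal_cochar (ce_act B) s @` Mc = [set g' | exists2 g, Mc g & shift_by incl t g g']] (residue B c s).
    by apply: xgetPex; exists (qz (defect s a)), (lift_section c); case: good0.
  by exists M.
case=> M _ [[Mconj [_ Minj Msur]] /= Mgal].
have [b Mb bE] : exists2 b, M b & cochar_proj b = coG a.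
  by have [|b Mb bE] := Msur (coG a); [rewrite /= clsg ?cochE|exists b].
have prb : pr (b z0) = a by rewrite -[RHS](cochE z0P (tG tameG)) -bE.
have [x bx] : exists x, b z0 = incl x * m a.
  by apply: ce_same_proj; rewrite prb lift_proj.
have : (gal_cochar (ce_act B) s @` (M `&` [set g | geom_pt c (cochar_proj g)]))
    (gal_cochar (ce_act B) s b).
  by exists b => //; split=> //=; rewrite cA bE /cls /= cochE.
rewrite Mgal => -[b1 [Mb1 b1A]] /shiftB[y -> yE]; congr qz.
have /imsetP[u _ uE] : starG s a \in a ^: [set: G]%SET.
  by rewrite -(classesC_eq Acl rA) stA.
have [e eE] := ce_proj_surj B u^-1.
rewrite (starE z0P (ce_act B) ce_torsion) bx starB_incl defectE // in yE.
have prb1 : pr (b1 z0) = starG s a.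
  have := congr1 pr yE; rewrite !ce_projM !ce_proj_incl !mul1g => <-.
  by rewrite lift_proj ?pointsC_star.
have uE' : starG s a = pr e * a * (pr e)^-1 by rewrite uE eE conjgE invgK mulgA.
have b1E : b1 = cochar_conj e b.
  apply: Minj; rewrite ?inE //; first exact: Mconj.
  by apply: (cochar_inj z0P); rewrite /= prb1 ce_projJ prb.
have eE' : e * (incl x * m a) * e^-1 = incl x * (e * m a * e^-1).
  by rewrite !mulgA -(ce_central x e).
move: yE; rewrite b1E /= bx uE' liftJ // eE' !mulgA -!ce_inclM -!mulgA.
by move=> /mulIg/ce_incl_inj; rewrite muC => /mulIg.
Qed.

End Lift.
End CentralExtension.

(** * Corestriction as a sum over an orbit *)

(** The powers of [s] run [j] times through the orbit of [x]. *)
Lemma sum_iter_porbit (T : finType) (V : zmodType) (s : {perm T}) (x : T) (w : T -> V) j :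
  (\sum_(0 <= k < j * #|porbit s x|) w ((s ^+ k)%g x) = (\sum_(y in porbit s x) w y) *+ j)%R.
Proof.
set O := porbit s x; have per i : (s ^+ (i + #|O|))%g x = (s ^+ i)%g x.
  by rewrite addnC expgnDr permM [(s ^+ #|O|)%g x]permX iter_porbit.
have one : (\sum_(0 <= k < #|O|) w ((s ^+ k)%g x) = \sum_(y in O) w y)%R.
  have -> : (\sum_(y in O) w y = \sum_(y <- traject s x #|O|) w y)%R.
    rewrite -[LHS]big_enum; apply: perm_big; apply: uniq_perm; rewrite ?enum_uniq ?uniq_traject_porbit //.
    by move=> y; rewrite mem_enum porbit_traject.
  have -> : traject s x #|O| = [seq (s ^+ k)%g x | k <- index_iota 0 #|O|].
    apply: (@eq_from_nth _ x); rewrite size_traject ?size_map ?size_iota ?subn0 // => i iO.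
    by rewrite nth_traject // (nth_map 0%N) ?size_iota ?subn0 // nth_iota ?subn0 // permX.
  by rewrite big_map.
elim: j => [|j IHj]; first by rewrite mul0n big_geq.
rewrite mulSn [in LHS](@big_cat_nat _ _ _ #|O|) ?leq_addr //= one mulrS; congr (_ + _)%R.
rewrite -{1}[#|O|]add0n [in LHS]big_addn addnC addnK -IHj.
by apply: eq_bigr => k _; rewrite per.
Qed.

Section Corestriction.
Local Open Scope group_scope.
Variables (F : finFieldType) (K : closedFieldType) (iota : {rmorphism F -> K}).
Hypothesis algK : forall x : K, algebraicOver iota x.
Variable p : nat.
Hypothesis charF : p \in [pchar F].
Local Notation Fr := (frob iota charF).
Variables (z0 : Zhat1 p K) (z0P : forall n, prime_to p n -> n.-primitive_root (z0 n)).
Variables (G : finGroupType) (aG : etale_action iota G) (tameG : coprime #|G| p).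
Variable C : conj_subscheme p aG.
Local Notation starG := (starG z0P aG tameG).
Local Notation S := (pointsC z0P tameG C).
Local Notation classesC := (classesC z0P tameG C).
Local Notation cls := (@cls K p z0 G).
Local Notation qz := (qz z0).
Local Notation fperm := (frob_perm charF z0P aG tameG).
Variable n : set (cochar p K G) -> nat.
Hypothesis nF : forall s cb, geom_classes C cb -> n (gal_class aG s cb) = n cb.
Variable B : central_ext p aG.
Variables (m : G -> B) (mP : is_lift z0P tameG C m).
Local Notation defect := (defect z0P tameG m).

(** On the stabilizer of the class [A] this is the residue ([residueE]). On the whole
    group it is a cocycle ([class_defectM]) in the functions on classes. *)
Definition class_defect s (A : {set G}) : QZ := qz (defect s (repr A)).
Local Notation v := class_defect.

Lemma class_defectM s t A : A \in classesC ->
  v (s * t) A = (v s (starG t @: A) + v t A)%R.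
Proof.
move=> Acl; have rA := classesC_repr Acl; have rS := classesC_sub Acl rA.
have tA := classesC_star t Acl.
rewrite /v (defectM mP) // (qzM z0P); congr (qz _ + _)%R.
apply: (defect_class mP s tA); first exact: imset_f.
exact: classesC_repr tA.
Qed.

Lemma class_defect1 A : A \in classesC -> v 1 A = 0%R.
Proof.
move=> Acl; have := class_defectM 1 1 Acl; rewrite mulg1.
have -> : starG 1 @: A = A by rewrite -[RHS]imset_id; apply: eq_imset => a; apply: star1.
by move/esym/(canRL (addrK _)); rewrite subrr.
Qed.

Lemma class_defect_frobX j A : A \in classesC ->
  v (Fr ^+ j) A = (\sum_(0 <= k < j) v Fr ((fperm ^+ k)%g A))%R.
Proof.
move=> Acl; elim: j => [|j IHj]; first by rewrite class_defect1 ?big_geq.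
by rewrite big_nat_recr //= -IHj expgS class_defectM // addrC frob_permX.
Qed.

Lemma weight_orbit j A : A \in classesC -> n (cls ((fperm ^+ j) A)) = n (cls A).
Proof.
move=> Acl; rewrite frob_permX -(gal_class_cls z0P aG tameG) nF //.
by rewrite (geom_classesE z0P tameG); exists A.
Qed.

Lemma starG_setX (s : absGal iota) j k (A : {set G}) : (forall a, starG s a = starG (Fr ^+ j) a) ->
  starG (s ^+ k) @: A = (fperm ^+ (j * k)) A.
Proof.
move=> sj; elim: k A => [|k IHk] A.
  by rewrite muln0 perm1 -[RHS]imset_id; apply: eq_imset => a; apply: star1.
rewrite expgSr starG_setM mulnS expgnDr permM -IHk frob_permX.
by have -> : starG s @: A = starG (Fr ^+ j) @: A by apply: eq_imset.
Qed.

(** The transfer: on the Frobenius, with [k] the length of the orbit, the residue at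
    [Fr ^+ k] of one class is the sum over the orbit of the defects at [Fr]. *)
Lemma corestriction_orbit O s : O \in orbitsC charF z0P tameG C ->
  (cor (field_degree (cls @` [set` O])) (residue B (cls @` [set` O]))
     *+ n (geom_pt (cls @` [set` O])))%R s =
  (\sum_(A in O) v s A *+ n (cls A))%R.
Proof.
move=> OC; have /imsetP[A1 A1cl OE] := OC.
have Ocl A : A \in O -> A \in classesC.
  by rewrite OE => /porbitP[j ->]; rewrite classesC_frob.
have O0 : O != finset.set0 by apply/set0Pn; exists A1; rewrite OE porbit_id.
have [A0 A0O A0E] := geom_ptE z0 O0.
have OE0 : O = porbit fperm A0.
  by apply/eqP; rewrite OE eq_sym eq_porbit_mem -OE.
rewrite (field_degreeE z0P tameG) A0E; set k := #|O|.
have [d d0 dP] := defect_level algK charF mP.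
have [e e0 eP] := uniform_level algK charF (id : G -> G) (star_action z0P aG (tG tameG)).
have de0 : (0 < d * e)%N by rewrite muln_gt0 d0.
have [j sj] := frob_dense charF s de0.
have sjd : agree d s (Fr ^+ j) := agree_dvd (dvdn_mulr _ (dvdnn d)) sj.
have sje a : starG s a = starG (Fr ^+ j) a.
  by apply: eP; apply: agree_dvd (dvdn_mull _ (dvdnn e)) sj.
have rS A : A \in O -> repr A \in S.
  by move=> /Ocl Acl; apply: classesC_sub Acl (classesC_repr Acl).
have sumO w : (\sum_(0 <= i < j) \sum_(A in O) w ((fperm ^+ i)%g A) = (\sum_(A in O) w A) *+ j :> QZ)%R.
  rewrite -[j in RHS]subn0 -sumr_const_nat; apply: eq_bigr => i _.
  rewrite [RHS](reindex_inj (@perm_inj _ (fperm ^+ i))) /=; apply: eq_bigl => A.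
  by rewrite OE0 -!eq_porbit_mem porbit_perm.
have kE : v (s ^+ k) A0 = (\sum_(A in O) v s A)%R.
  have -> : v (s ^+ k) A0 = v (Fr ^+ (j * k)) A0.
    by congr (qz _); rewrite expgnA; apply: dP; [apply: agreeX|apply: rS].
  rewrite class_defect_frobX ?Ocl // {1}/k OE0 sum_iter_porbit -OE0 -sumO exchange_big /=.
  apply: eq_bigr => A AO; rewrite -class_defect_frobX ?Ocl //.
  by congr (qz _); apply/esym/dP; rewrite ?rS.
have -> : (cor k (residue B (cls @` [set` O])) *+ n (cls A0))%R s =
          (cor k (residue B (cls @` [set` O])) s *+ n (cls A0))%R.
  by elim: (n (cls A0)) => [|i IHi]; rewrite ?mulr0n // !mulrS -IHi.
have cC : pi0 C (cls @` [set` O]) by rewrite (pi0E algK charF z0P tameG); exists O.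
have cA : (cls @` [set` O]) (cls A0) by exists A0.
have sA : starG (s ^+ k) @: A0 = A0.
  rewrite (starG_setX _ _ sje) mulnC expgnA permX_fix //.
  by rewrite permX /k OE0 iter_porbit.
rewrite /cor (residueE algK charF mP cC A0E (Ocl _ A0O) cA sA).
rewrite -[qz _]/(v _ A0) kE -sumrMnl; apply: eq_bigr => A AO; congr (_ *+ _)%R.
have /porbitP[i ->] : A \in porbit fperm A0 by rewrite -OE0.
by rewrite weight_orbit ?Ocl.
Qed.

Lemma corestriction_sum s :
  (\sum_(c \in pi0 C) cor (field_degree c) (residue B c) *+ n (geom_pt c))%R s =
  (\sum_(A in classesC) v s A *+ n (cls A))%R.
Proof.
rewrite (@sum_pi0 _ _ _ algK _ charF _ z0P _ _ tameG C _ _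
  (fun A => (fun s => v s A *+ n (cls A))%R)).
  by elim/big_rec2: _ => // A y x _ <-.
move=> O OC; apply/funext => t; rewrite corestriction_orbit //.
by elim/big_rec2: _ => // A y x _ ->.
Qed.

End Corestriction.

(** * Twists and the residue at a rational point *)

Section TwistEvaluation.
Local Open Scope group_scope.
Variables (F : finFieldType) (K : closedFieldType) (iota : {rmorphism F -> K}).
Variables (G : finGroupType) (aG : etale_action iota G) (P : torsor aG) (x0 : P).
Variables (E : groupType) (aE : etale_action iota E) (pr : E -> G).
Hypothesis pr_gal : forall s e, pr (aE s e) = aG s (pr e).
Hypothesis pr_surj : forall g, exists e, pr e = g.
Hypothesis pr_conj : forall e e' b, pr e = pr e' -> e^-1 * b * e = e'^-1 * b * e'.
Hypothesis prM : {morph pr : e f / e * f}.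

(** The following lemmas are stated for a surjection [pr] to [G] whose fibres act by the
    same conjugations, to apply to the twists of [G] and of its central extensions. *)
Lemma torsor_translate (x : P) : exists e : E, x = t_act x0 (pr e).
Proof.
have [g [<- _]] := t_simply_transitive x0 x.
by have [e <-] := pr_surj g; exists e.
Qed.

(** A point of the torsor identifies the twisted group with the original one. *)
Lemma twist_eval_inj (f h : twist P pr) : f x0 = h x0 -> f = h.
Proof.
move=> fh; apply/val_inj/ffunP=> x; have [e ->] := torsor_translate x.
by rewrite [LHS](twistP f) [RHS](twistP h) fh.
Qed.

Lemma twist_eval_surj (b : E) : exists f : twist P pr, f x0 = b.
Proof.
have [t tP] := choice torsor_translate.
have act_inj e e' (x : P) : t_act x (pr e) = t_act x (pr e') -> pr e = pr e'.
  have [g [_ gU]] := t_simply_transitive x (t_act x (pr e)).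
  by move=> ee'; rewrite -(gU _ erefl) -(gU _ (esym ee')).
have fP : twist_pred pr [ffun x : P => (t x)^-1 * b * t x].
  apply/asboolP => x e; rewrite !ffunE.
  have -> : e^-1 * ((t x)^-1 * b * t x) * e = (t x * e)^-1 * b * (t x * e).
    by rewrite invMg !mulgA.
  apply: pr_conj; apply: (act_inj _ _ x0).
  by rewrite -tP prM t_actM -tP.
exists (Twist fP); rewrite ffunE.
have /act_inj t1 : t_act x0 (pr (t x0)) = t_act x0 (pr 1).
  rewrite -tP -[LHS](t_act1); congr (t_act _ _).
  by apply: (@mulgI _ (pr 1)); rewrite -prM !mulg1.
by rewrite (pr_conj _ t1) invg1 mul1g mulg1.
Qed.

Lemma twist_act_frame (s : absGal iota) (h : E) (f : twist P pr) :
  t_gal s^-1 x0 = t_act x0 (pr h) ->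
  gal_twist pr_gal s f x0 = aE s (h^-1 * f x0 * h).
Proof. by move=> hE; rewrite ffunE hE (twistP f). Qed.

Lemma twist_expE (f : twist P pr) k x : (f ^+ k) x = f x ^+ k.
Proof.
elim: k => [|k IHk]; first by rewrite ffunE.
by rewrite !expgS twistM IHk.
Qed.

Lemma twist_torsion p : torsion_prime_to p E -> torsion_prime_to p (twist P pr).
Proof.
move=> tE f; have [n pn fn] := tE (f x0); exists n => //.
by apply: twist_eval_inj; rewrite twist_expE fn ffunE.
Qed.

End TwistEvaluation.

Section ResidueAtPoint.
Local Open Scope group_scope.
Variables (F : finFieldType) (K : closedFieldType) (iota : {rmorphism F -> K}).
Hypothesis algK : forall x : K, algebraicOver iota x.
Variable p : nat.
Hypothesis charF : p \in [pchar F].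
Local Notation q := #|F|.
Local Notation Fr := (frob iota charF).
Variables (z0 : Zhat1 p K) (z0P : forall n, prime_to p n -> n.-primitive_root (z0 n)).
Variables (G : finGroupType) (aG : etale_action iota G) (tameG : coprime #|G| p).
Local Notation qz := (qz z0).
Variable B : central_ext p aG.
Local Notation pr := (@ce_proj F K iota p G aG B).
Local Notation incl := (@ce_incl F K iota p G aG B).
Variables (P : torsor aG) (x0 : P) (g : cochar p K (twistG P)).
Hypothesis gF : gal_fixed (twistG_action P) g.

Local Notation TB := (twistB B P).
Local Notation aT := (twistB_action B P).
Local Notation inclT := (@twistB_incl F K iota p G aG B P).

Lemma ce_conj_proj (e e' b : B) : pr e = pr e' -> e^-1 * b * e = e'^-1 * b * e'.
Proof.
case/ce_same_proj=> x ->; rewrite invMg -!mulgA; congr (_ * _).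
by rewrite [b * _]mulgA -ce_central -!mulgA mulKg.
Qed.

Let evT_inj := @twist_eval_inj F K iota G aG P x0 B pr (@ce_proj_surj _ _ _ _ _ _ B).
Let evT_surj := @twist_eval_surj F K iota G aG P x0 B pr (@ce_proj_surj _ _ _ _ _ _ B)
  ce_conj_proj (@ce_projM _ _ _ _ _ _ B).

Lemma twistB_torsion : torsion_prime_to p TB.
Proof. exact: (twist_torsion x0 (@ce_proj_surj _ _ _ _ _ _ B) (@ce_torsion _ _ _ _ _ _ tameG B)). Qed.
Local Notation coT := (coch z0P twistB_torsion).
Local Notation starT := (star z0P aT twistB_torsion).

Lemma twistB_inclM : {morph inclT : x y / x * y}.
Proof. by move=> x y; apply: evT_inj; rewrite ffunE twistM !ffunE ce_inclM. Qed.

Lemma twistB_incl_inj : injective inclT.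
Proof.
move=> x y /(congr1 (fun f : TB => f x0)); rewrite !ffunE.
exact: ce_incl_inj.
Qed.

Lemma twistB_inclC x (f : TB) : inclT x * f = f * inclT x.
Proof. by apply: evT_inj; rewrite !twistM ffunE ce_central. Qed.

Lemma twistB_incl_gal (s : absGal iota) x y : mu_val y = s (mu_val x) ->
  aT s (inclT x) = inclT y.
Proof. by move=> xy; apply: evT_inj; rewrite !ffunE; apply: ce_incl_gal. Qed.

Let shiftT t (h h' : cochar p K TB) :
  shift_by inclT t h h' <-> exists2 x, t = qz x & h' z0 = inclT x * h z0.
Proof. by apply: shift_by_qz; [exact: z0P|exact: twistB_inclM|exact: twistB_inclC]. Qed.

Let lifts (h : cochar p K TB) := forall z (x : P), pr (h z x) = g z x.

(** The lift condition at all points of the torsor and all [z] follows from the one at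
    [x0] and [z0], by equivariance and by [cochar_inj]. *)
Lemma lifts_base (h : cochar p K TB) : pr (h z0 x0) = g z0 x0 -> lifts h.
Proof.
move=> hg; have all x : pr (h z0 x) = g z0 x.
  have [b ->] := torsor_translate x0 (@ce_proj_surj _ _ _ _ _ _ B) x.
  by rewrite [h z0 _](twistP (h z0)) [RHS](twistP (g z0)) -hg !ce_projM ce_projV.
move=> z x.
have prxM : {morph (fun f : TB => pr (f x)) : a b / a * b}.
  by move=> a b; rewrite twistM ce_projM.
have : cochar_map prxM h = cochar_ev x g by apply: (cochar_inj z0P); apply: all.
by move/(congr1 (fun c : cochar p K G => c z)).
Qed.

Lemma lifts_exist : exists2 h : TB, pr (h x0) = g z0 x0 & lifts (coT h).
Proof.
have [b bE] := ce_proj_surj B (g z0 x0); have [h hE] := evT_surj b.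
by exists h; rewrite ?hE //; apply: lifts_base; rewrite cochE hE.
Qed.

Lemma lifts_same (h h' : cochar p K TB) : lifts h -> lifts h' ->
  exists x, h' z0 = inclT x * h z0.
Proof.
move=> hP h'P; have [|x xE] := @ce_same_proj F K iota p G aG B (h' z0 x0) (h z0 x0).
  by rewrite hP h'P.
by exists x; apply: evT_inj; rewrite twistM ffunE.
Qed.

Lemma lifts_gal s (h : cochar p K TB) : lifts h -> lifts (gal_cochar aT s h).
Proof.
move=> hP; apply: lifts_base; rewrite -[g in RHS](gF s) /= !ffunE.
by rewrite ce_proj_gal hP.
Qed.

(** The value of the residue at a rational point of the inertia stack is a
    continuous character, given on the Frobenius by comparing the twisted
    Frobenius of a lift with its [q]-th power. *)
Lemma residue_at_character : exists rho : absGal iota -> muinf p K,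
  [/\ forall s, residue_at B g s = qz (rho s),
      forall s t, rho (s * t) = rho s * rho t,
      exists2 d, (0 < d)%N & forall s t, agree d s t -> rho s = rho t
    & forall e h : B, pr e = g z0 x0 -> t_gal Fr^-1 x0 = t_act x0 (pr h) ->
        ce_act B Fr (h^-1 * e * h) = incl (rho Fr ^+ q) * e ^+ q].
Proof.
have [h hx0 hP] := lifts_exist.
have rex s : exists x, starT s h = inclT x * h.
  have [x xE] := lifts_same hP (lifts_gal s hP); exists x.
  by rewrite -[h in RHS](cochE z0P twistB_torsion) -xE.
have [rho rhoE] := choice rex.
have starI s x f : starT s (inclT x * f) = inclT x * starT s f.
  by apply: star_incl; [exact: twistB_inclM|exact: twistB_inclC|exact: twistB_incl_gal].
exists rho; split.
- move=> s; rewrite /residue_at; set A := (X in xget _ X).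
  have [g' g'P /shiftT[x -> g'E]] : A (xget 0%R A).
    apply: xgetPex; exists (qz (rho s)), (coT h) => //.
    by apply/shiftT; exists (rho s); rewrite // cochE (starE z0P aT twistB_torsion) cochE.
  have [y yE] := lifts_same hP g'P; rewrite cochE in yE; congr qz.
  apply: twistB_incl_inj; move: g'E.
  rewrite (starE z0P aT twistB_torsion) yE starI rhoE mulgA -twistB_inclM muC twistB_inclM -mulgA.
  by move=> /mulIg.
- move=> s t; apply: twistB_incl_inj; apply: (@mulIg _ h).
  by rewrite -rhoE starM rhoE starI rhoE mulgA -twistB_inclM muC.
- have [d d0 dP] := gal_action_level algK charF h (star_action z0P aT twistB_torsion).
  exists d => // s t st; apply: twistB_incl_inj; apply: (@mulIg _ h).
  by rewrite -!rhoE; apply: dP.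
move=> e k eE kE.
have [f fE] := evT_surj e.
have fP : lifts (coT f) by apply: lifts_base; rewrite cochE fE.
have [y yE] := lifts_same hP fP; rewrite !cochE in yE.
have sf : starT Fr f = inclT (rho Fr) * f.
  by rewrite yE starI rhoE mulgA -twistB_inclM muC twistB_inclM -mulgA.
have := congr1 (fun u : TB => u x0) (star_frob charF z0P aT twistB_torsion f).
rewrite sf twist_expE twistM ffunE fE.
rewrite (twist_act_frame (@ce_proj_gal _ _ _ _ _ _ B) f kE) fE => <-.
rewrite expgMn; last exact: ce_central.
by rewrite (inclX (@ce_inclM _ _ _ _ _ _ B)).
Qed.

End ResidueAtPoint.

(** * The sum of the residues at the Frobenius *)

Section FrobeniusCriterion.
Local Open Scope group_scope.
Variables (F : finFieldType) (K : closedFieldType) (iota : {rmorphism F -> K}).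
Hypothesis algK : forall x : K, algebraicOver iota x.
Variable p : nat.
Hypothesis charF : p \in [pchar F].
Local Notation q := #|F|.
Local Notation Fr := (frob iota charF).
Variables (z0 : Zhat1 p K) (z0P : forall n, prime_to p n -> n.-primitive_root (z0 n)).
Variables (G : finGroupType) (aG : etale_action iota G) (tameG : coprime #|G| p).
Variable C : conj_subscheme p aG.
Local Notation starG := (starG z0P aG tameG).
Local Notation classesC := (classesC z0P tameG C).
Local Notation cls := (@cls K p z0 G).
Local Notation qz := (qz z0).
Variable n : set (cochar p K G) -> nat.
Hypothesis nF : forall s cb, geom_classes C cb -> n (gal_class aG s cb) = n cb.
Variable B : central_ext p aG.
Local Notation pr := (@ce_proj F K iota p G aG B).
Local Notation incl := (@ce_incl F K iota p G aG B).
Variables (m : G -> B) (mP : is_lift z0P tameG C m).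
Variables (P : torsor aG) (x0 : P) (g : cochar p K (twistG P)).
Hypothesis gF : gal_fixed (twistG_action P) g.

(** The sum of all residues is a continuous character, so it vanishes as soon as
    it vanishes on the Frobenius. *)
Lemma residue_sum_frob : exists r : muinf p K,
  ((residue_at B g + \sum_(c \in pi0 C)
     cor (field_degree c) (residue B c) *+ n (geom_pt c) = 0 :> (absGal iota -> QZ))%R
    <-> (qz r + \sum_(A in classesC) class_defect z0P tameG m Fr A *+ n (cls A) = 0)%R) /\
  (forall e h : B, pr e = g z0 x0 -> t_gal Fr^-1 x0 = t_act x0 (pr h) ->
        ce_act B Fr (h^-1 * e * h) = incl (r ^+ q) * e ^+ q).
Proof.
have [rho [rhoE rhoM [d d0 dP] rhoF]] := residue_at_character algK charF z0P tameG B x0 gF.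
exists (rho Fr); split=> //.
pose L s := (qz (rho s) + \sum_(A in classesC) class_defect z0P tameG m s A *+ n (cls A))%R.
have LE s : (residue_at B g + \sum_(c \in pi0 C)
     cor (field_degree c) (residue B c) *+ n (geom_pt c))%R s = L s.
  by rewrite /L -(corestriction_sum algK charF nF mP) -rhoE.
split=> [L0|LF]; first by rewrite -/(L Fr) -LE L0.
have LM s t : L (s * t) = (L s + L t)%R.
  rewrite /L rhoM (qzM z0P) addrACA; congr (_ + _)%R.
  transitivity (\sum_(A in classesC) (class_defect z0P tameG m s (starG t @: A) *+ n (cls (starG t @: A)) + class_defect z0P tameG m t A *+ n (cls A)))%R.
    apply: eq_bigr => A Acl; rewrite (class_defectM mP) // mulrnDl.
    by rewrite -(gal_class_cls z0P aG tameG) nF // (geom_classesE z0P tameG); exists A.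
  rewrite big_split /=; congr (_ + _)%R.
  have tinj : injective (fun A : {set G} => starG t @: A).
    exact: imset_inj (@starG_inj _ _ _ _ _ z0P _ aG tameG t).
  rewrite [RHS](reindex_inj tinj) /=; apply: eq_bigl => A.
  apply/idP/idP=> [|Acl]; first exact: classesC_star.
  have -> : A = starG t^-1 @: (starG t @: A).
    rewrite -starG_setM mulVg -[LHS]imset_id; apply: eq_imset => a.
    by rewrite /starG star1.
  exact: classesC_star.
have LX j : L (Fr ^+ j) = 0%R.
  elim: j => [|j IHj]; last by rewrite expgS LM IHj [L _]LF addr0.
  by apply: (@addrI _ (L 1)); rewrite -[in LHS]LM mulg1 addr0.
have [e e0 eP] := defect_level algK charF mP.
apply/funext => s; rewrite LE.
have de0 : (0 < d * e)%N by rewrite muln_gt0 d0.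
have [j sj] := frob_dense charF s de0.
rewrite -[RHS](LX j) /L; congr (qz _ + _)%R.
  by apply: dP; apply: agree_dvd (dvdn_mulr _ (dvdnn d)) sj.
apply: eq_bigr => A Acl; congr (qz _ *+ _)%R; apply: eP.
  by apply: agree_dvd (dvdn_mull _ (dvdnn e)) sj.
exact: classesC_sub Acl (classesC_repr Acl).
Qed.

End FrobeniusCriterion.

(** * Words and their images in a central extension *)

Section FiniteSubgroup.
Local Open Scope group_scope.
Variables (E : groupType) (s : seq E).

(** A finite subgroup of an infinite group is given by its list of elements, from
    which the type [finsub] of its elements gets a finite group structure. *)
Definition group_list : Prop :=
  [/\ 1 \in s, forall x y, x \in s -> y \in s -> x * y \in s
    & forall x, x \in s -> x^-1 \in s].

Definition finsub (cl : group_list) : Type := seq_sub s.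

Variable cl : group_list.

HB.instance Definition _ := Finite.on (finsub cl).

Definition finsub_val (x : finsub cl) : E := ssval x.

Lemma finsub_inj : injective finsub_val. Proof. exact: val_inj. Qed.

Definition finsub_one : finsub cl := SeqSub (let: And3 c _ _ := cl in c).
Definition finsub_mul (x y : finsub cl) : finsub cl :=
  SeqSub (let: And3 _ c _ := cl in c _ _ (ssvalP x) (ssvalP y)).
Definition finsub_inv (x : finsub cl) : finsub cl :=
  SeqSub (let: And3 _ _ c := cl in c _ (ssvalP x)).

Fact finsub_mulA : associative finsub_mul.
Proof. by move=> x y z; apply: val_inj; apply: mulgA. Qed.
Fact finsub_mul1 : left_id finsub_one finsub_mul.
Proof. by move=> x; apply: val_inj; apply: mul1g. Qed.
Fact finsub_1mul : right_id finsub_one finsub_mul.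
Proof. by move=> x; apply: val_inj; apply: mulg1. Qed.
Fact finsub_mulV : left_inverse finsub_one finsub_inv finsub_mul.
Proof. by move=> x; apply: val_inj; apply: mulVg. Qed.
Fact finsub_Vmul : right_inverse finsub_one finsub_inv finsub_mul.
Proof. by move=> x; apply: val_inj; apply: mulgV. Qed.

HB.instance Definition _ := isGroup.Build (finsub cl)
  finsub_mulA finsub_mul1 finsub_1mul finsub_mulV finsub_Vmul.

Definition finsub_group : finGroupType := finsub cl.

End FiniteSubgroup.

(** By Cauchy's theorem. *)
Lemma prime_to_card (p : nat) (H : finGroupType) : prime p ->
  torsion_prime_to p H -> prime_to p #|H|.
Proof.
move=> pp tH; rewrite /prime_to; apply/andP; split; first by apply/card_gt0P; exists 1%g.
rewrite prime_coprime //; apply/negP; rewrite -cardsT => /(Cauchy pp)[x _ xp].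
have [n /andP[_ pn] xn] := tH x.
move: pn; rewrite prime_coprime // => /negP; apply.
by rewrite -xp order_dvdn xn.
Qed.

Section WordCondition.
Local Open Scope group_scope.
Variables (F : finFieldType) (K : closedFieldType) (iota : {rmorphism F -> K}).
Hypothesis algK : forall x : K, algebraicOver iota x.
Variable p : nat.
Hypothesis charF : p \in [pchar F].
Local Notation q := #|F|.
Local Notation Fr := (frob iota charF).
Variables (z0 : Zhat1 p K) (z0P : forall n, prime_to p n -> n.-primitive_root (z0 n)).
Variables (G : finGroupType) (aG : etale_action iota G) (tameG : coprime #|G| p).
Variable C : conj_subscheme p aG.
Local Notation starG := (starG z0P aG tameG).
Local Notation S := (pointsC z0P tameG C).
Local Notation classesC := (classesC z0P tameG C).
Local Notation qz := (qz z0).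

Definition equivariant (H : groupType) (mu : G -> H) : Prop :=
  forall a b, a \in S -> b \in S -> mu b * mu a * (mu b)^-1 = mu (b * a * b^-1).

(** The Frobenius on points, in the frame of a torsor with [Fr^-1 x0 = x0.h]. *)
Definition twisted_frob (h : G) (a : G) : G := starG Fr (h^-1 * a * h).

(** Words in the points of [C], seen as approximations of a rational point of
    [U]: the Frobenius condition holds in a finite quotient, and the class
    counts are prescribed modulo [N]. *)
Definition word_condition (h a0 : G) (nA : {set G} -> nat) : Prop :=
  forall (H : finGroupType) (mu : G -> H) N, prime_to p #|H| -> prime_to p N ->
    equivariant mu ->
  exists w : seq G, [/\ all (mem S) w,
    \prod_(a <- w) mu (twisted_frob h a) ^+ q = (\prod_(a <- w) mu a) ^+ q,
    \prod_(a <- w) a = a0^-1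
    & forall A, A \in classesC -> count (mem A) w = nA A %[mod N]].

Lemma muinf_common (I : finType) (x : I -> muinf p K) :
  exists2 N, prime_to p N & forall i, x i ^+ N = 1.
Proof.
have ex i : exists N, prime_to p N /\ x i ^+ N = 1.
  by have [N pN xN] := muinf_torsion (x i); exists N.
have [N NP] := choice ex; exists (\prod_i N i)%N.
  by elim/big_ind: _ => [|m k pm pk|i _]; rewrite ?prime_to1 ?prime_toM ?pm //; case: (NP i).
by move=> i; have [_ xN] := NP i; rewrite (bigD1 i) //= expgnA xN expg1n.
Qed.

(** On [Q/Z(1)], raising to the power [q] is the action of the Frobenius. *)
Lemma muinf_expq_inj (x : muinf p K) : x ^+ q = 1 -> x = 1.
Proof.
move=> xq; apply: val_inj; apply: (@gal_inj _ _ _ Fr).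
by rewrite [LHS]frobE -[LHS]muexpE xq [RHS]frobE expr1n.
Qed.

Lemma sum_word (V : zmodType) (v : {set G} -> V) (w : seq G) : all (mem S) w ->
  (\sum_(a <- w) v (a ^: [set: G]%SET) = \sum_(A in classesC) v A *+ count (mem A) w)%R.
Proof.
elim: w => [_|a w IHw /= /andP[aS wS]]; first by rewrite big_nil big1.
have vE : v (a ^: [set: G]%SET) = (\sum_(A in classesC) v A *+ (a \in A))%R.
  rewrite (bigD1 (a ^: [set: G]%SET)) /=; last exact: classesC_mem.
  rewrite class_refl mulr1n big1 ?addr0 // => A /andP[Acl Aa].
  case: (boolP (a \in A)) => // aA; case/negP: Aa.
  by rewrite (classesC_eq Acl aA).
by rewrite big_cons vE IHw // -big_split; apply: eq_bigr => A _; rewrite /= mulrnDr.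
Qed.

Section FromExtension.
Variable B : central_ext p aG.
Local Notation pr := (@ce_proj F K iota p G aG B).
Local Notation incl := (@ce_incl F K iota p G aG B).
Let inclM := @ce_inclM _ _ _ _ _ _ B.

(** A finite subgroup of the extension through given lifts: the products of a set
    theoretic section with the roots of unity of a large order. *)
Lemma finite_subextension (m : G -> B) : exists (s : seq B),
  group_list s /\ forall a, m a \in s.
Proof.
have [T TP] := choice (@ce_proj_surj _ _ _ _ _ _ B).
have mex a : exists x, m a = incl x * T (pr (m a)).
  by apply: ce_same_proj; rewrite TP.
have [y yE] := choice mex.
have cex (gh : G * G) : exists x, T gh.1 * T gh.2 = incl x * T (gh.1 * gh.2).
  by apply: ce_same_proj; rewrite ce_projM !TP.
have [c cE0] := choice cex.
have cE g g' : T g * T g' = incl (c (g, g')) * T (g * g') by exact: (cE0 (g, g')).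
have [t tE] : exists t, T 1 = incl t by apply/ce_exact; rewrite TP.
have [N1 pN1 yN] := muinf_common y; have [N2 pN2 cN] := muinf_common c.
have [N3 pN3 tN] := muinf_torsion t.
pose N := (N1 * (N2 * N3))%N; have pN : prime_to p N by rewrite !prime_toM pN1 pN2.
have {}yN a : y a ^+ N = 1 by rewrite expgnA yN expg1n.
have {}cN a : c a ^+ N = 1 by rewrite /N mulnCA expgnA cN expg1n.
have {}tN : t ^+ N = 1 by rewrite /N mulnA mulnC expgnA tN expg1n.
pose s := [seq incl (zroot z0 N ^+ i) * T a | i <- seq.iota 0 N, a <- enum G].
have sP e : reflect (exists2 x, x ^+ N = 1 & e = incl x * T (pr e)) (e \in s).
  apply: (iffP allpairsP) => [[[i a] [/= _ _ ->]]|[x xN eE]].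
    exists (zroot z0 N ^+ i); last by rewrite ce_projM ce_proj_incl mul1g TP.
    rewrite -expgnA mulnC expgnA; apply: val_inj; rewrite [LHS]muexpE muexpE /=.
    by rewrite (prim_expr_order (z0P pN)) expr1n.
  have [i xi] : exists i : 'I_N, mu_val x = (z0 N ^+ i)%R.
    have [|i xi] := @prim_rootP _ _ _ (z0P pN) (mu_val x); last by exists i.
    by rewrite -muexpE xN.
  exists (nat_of_ord i, pr e); rewrite mem_iota mem_enum /= add0n; split=> //.
  by rewrite {1}eE; congr (incl _ * _); apply: val_inj; rewrite [RHS]muexpE.
have muN x x' : x ^+ N = 1 -> x' ^+ N = 1 -> (x * x' : muinf p K) ^+ N = 1.
  by move=> xN x'N; rewrite expgMn ?xN ?x'N ?mulg1 //; apply: muC.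
exists s; split=> [|a]; last by apply/sP; exists (y a).
have s1 : 1 \in s.
  apply/sP; exists t^-1; last by rewrite ce_proj1 tE -inclM mulVg (incl1 inclM).
  by rewrite expVgn tN invg1.
split=> // [e e' /sP[x xN eE] /sP[x' x'N e'E]|e /sP[x xN eE]].
  apply/sP; exists (x * x' * c (pr e, pr e')); first by rewrite !muN.
  rewrite {1}eE {1}e'E -mulgA [T _ * _]mulgA -(ce_central x') -!mulgA cE.
  by rewrite ce_projM !inclM !mulgA.
have [z zE] : exists z, e^-1 = incl z * T (pr e^-1) by apply: ce_same_proj; rewrite TP.
apply/sP; exists z => //.
have : incl (x * z * c (pr e, pr e^-1) * t) = incl 1.
  have : incl x * T (pr e) * (incl z * T (pr e^-1)) = 1 by rewrite -eE -zE mulgV.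
  rewrite -mulgA [T _ * _]mulgA -(ce_central z) -!mulgA cE.
  by rewrite /= -ce_projM mulgV ce_proj1 tE -!inclM (incl1 inclM) !mulgA.
move/ce_incl_inj => xzct.
have -> : z = (x * c (pr e, pr e^-1) * t)^-1.
  by apply: (@mulIg _ (x * c (pr e, pr e^-1) * t)); rewrite mulVg -xzct !mulgA [z * x]muC.
by rewrite expVgn muN ?invg1 // muN.
Qed.

Variables (m : G -> B) (mP : is_lift z0P tameG C m).
Local Notation defect := (defect z0P tameG m).
Variables (h a0 : G) (nA : {set G} -> nat) (r : muinf p K).
Hypothesis rP : forall e k : B, pr e = a0 -> pr k = h ->
  ce_act B Fr (k^-1 * e * k) = incl (r ^+ q) * e ^+ q.

Lemma prod_incl (w : seq G) (x : G -> muinf p K) (f : G -> B) :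
  \prod_(a <- w) (incl (x a) * f a) = incl (\prod_(a <- w) x a) * \prod_(a <- w) f a.
Proof.
elim: w => [|a w IHw]; first by rewrite !big_nil mulg1 (incl1 inclM).
rewrite !big_cons IHw inclM -!mulgA; congr (_ * _).
by rewrite !mulgA ce_central.
Qed.

(** The product [v] of the lifts of the letters of a word approximating a rational
    point lifts the inverse of [a0]. Its Frobenius is computed in two ways: by the
    residue [r] at [a0], and letter by letter, which gives the defects of [m]. *)
Lemma word_residue : word_condition h a0 nA ->
  (qz r + \sum_(A in classesC) class_defect z0P tameG m Fr A *+ nA A = 0)%R.
Proof.
move=> wc; have [s [cl ms]] := finite_subextension m.
have [N pN dN] := muinf_common (fun a => defect Fr a).
pose H := finsub_group cl; pose iv : H -> B := @finsub_val _ _ cl.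
have ivM : {morph iv : x y / x * y} by [].
have tH : torsion_prime_to p H.
  move=> x; have [n pn xn] := ce_torsion tameG (iv x); exists n => //.
  apply: (@finsub_inj _ _ cl); rewrite -[RHS]/(1 : B) -{}xn.
  by elim: (n) => // k IHk; rewrite !expgS -IHk.
pose mu a : H := SeqSub (ms a).
have muE : equivariant mu.
  move=> a b aS bS; apply: (@finsub_inj _ _ cl).
  rewrite -[LHS]/(m b * m a * (m b)^-1) -[RHS]/(m (b * a * b^-1)).
  by rewrite -(liftJ mP (m b)) // (lift_proj mP).
have [w [wS wF wa wn]] := wc H mu N (prime_to_card (p_prime charF) tH) pN muE.
have ivprod (f : G -> H) : iv (\prod_(a <- w) f a) = \prod_(a <- w) iv (f a).
  by elim: (w) => [|a u IHu]; rewrite ?big_nil // !big_cons ivM IHu.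
have ivX x k : iv (x ^+ k) = iv x ^+ k.
  by elim: k => // k IHk; rewrite !expgS ivM IHk.
pose v := \prod_(a <- w) m a.
have vF : \prod_(a <- w) m (twisted_frob h a) ^+ q = v ^+ q.
  have := congr1 iv wF; rewrite ivprod ivX ivprod => <-.
  by apply: eq_bigr => a _; rewrite ivX.
have wSa a : a \in w -> a \in S by move=> aw; apply: (allP wS).
have prv : pr v = a0^-1.
  rewrite -wa /v; elim: (w) wSa => [|a u IHu] uS; first by rewrite !big_nil ce_proj1.
  rewrite !big_cons ce_projM (lift_proj mP) ?uS ?mem_head // IHu // => b bu.
  by rewrite uS // inE bu orbT.
have [k kE] := ce_proj_surj B h.
have fV e : ce_act B Fr (e : B)^-1 = (ce_act B Fr e)^-1 by apply: eactV.
have FM := eactM (ce_act B) Fr.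
(* Letter by letter: the Frobenius equation for the word turns the product of the
   lifts of the shifted letters into a power of [v]. *)
pose D := \prod_(a <- w) defect Fr a.
have Fv : ce_act B Fr (k^-1 * v * k) = incl (D ^+ q) * v ^+ q.
  have -> : ce_act B Fr (k^-1 * v * k) = \prod_(a <- w) ce_act B Fr (k^-1 * m a * k).
    rewrite /v; elim: (w) => [|a u IHu]; first by rewrite !big_nil mulg1 mulVg eact1.
    by rewrite !big_cons -IHu -FM !mulgA mulgK.
  have DX : D ^+ q = \prod_(a <- w) defect Fr a ^+ q.
    rewrite /D; elim: (w) => [|a u IHu]; first by rewrite !big_nil expg1n.
    by rewrite !big_cons -IHu expgMn //; apply: muC.
  rewrite DX -vF -prod_incl; apply: eq_big_seq => a /wSa aS.
  have aE : h^-1 * a * h = h^-1 * a * (h^-1)^-1 by rewrite invgK.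
  have aS' : h^-1 * a * h \in S by rewrite aE pointsC_conj.
  have conjE : k^-1 * m a * k = m (h^-1 * a * h).
    by rewrite aE -kE -ce_projV (liftJ mP) // invgK.
  rewrite conjE -(star_frob charF z0P (ce_act B) (@ce_torsion _ _ _ _ _ _ tameG B)) (defectE mP) //.
  rewrite expgMn; last exact: ce_central.
  by rewrite -(inclX inclM) aE (defect_conj mP) // -aE.
(* By the residue, as [v^-1] lifts [a0]. *)
have rE : incl (r ^+ q) * (v^-1) ^+ q = (incl (D ^+ q) * v ^+ q)^-1.
  have prv' : pr v^-1 = a0 by rewrite ce_projV prv invgK.
  by rewrite -(rP prv' kE) -Fv -fV !invMg invgK mulgA.
have : (r * D) ^+ q = 1.
  rewrite expgMn; last exact: muC.
  have RE : incl (r ^+ q) = (incl (D ^+ q))^-1.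
    apply: (@mulIg _ ((v ^+ q)^-1)); rewrite -expVgn rE invMg expVgn.
    by rewrite -(inclV inclM) ce_central.
  by apply: (@ce_incl_inj _ _ _ _ _ _ B); rewrite inclM (incl1 inclM) RE mulVg.
move/muinf_expq_inj/(congr1 qz); rewrite (qzM z0P) (qz1 z0P) => rD.
rewrite -[RHS]rD; congr (_ + _)%R.
have -> : qz D = (\sum_(a <- w) class_defect z0P tameG m Fr (a ^: [set: G]%SET))%R.
  transitivity (\sum_(a <- w) qz (defect Fr a))%R.
    rewrite /D; elim: (w) => [|a u IHu]; first by rewrite !big_nil (qz1 z0P).
    by rewrite !big_cons (qzM z0P) IHu.
  apply: eq_big_seq => a /wSa aS; congr qz.
  have acl := classesC_mem aS.
  exact: (defect_class mP Fr acl (class_refl _ _) (classesC_repr acl)).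
rewrite sum_word //; apply: eq_bigr => A Acl.
rewrite /class_defect -!(qzX z0P); congr qz.
by apply: expg_eqmod (dN _) _; rewrite wn.
Qed.

End FromExtension.
End WordCondition.

(** * Characters of finite abelian groups and cocycles *)

Section SeparatingCharacter.
Import algC classfun character.
Local Open Scope group_scope.
Variables (p : nat) (K : closedFieldType).
Variables (z0 : Zhat1 p K) (z0P : forall n, prime_to p n -> n.-primitive_root (z0 n)).

(** Complex characters of [D / I] separate its elements; their values are roots of
    unity, whose discrete logarithms are transported to [Q/Z(1)]. *)
Lemma separating_character (gT : finGroupType) (D I : {group gT}) (d : gT) :
  prime_to p #|D| -> abelian D -> I \subset D -> d \in D -> d \notin I ->
  exists psi : gT -> muinf p K,
    [/\ {in D &, {morph psi : x y / x * y}}, {in I, forall x, psi x = 1}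
      & psi d <> 1].
Proof.
move=> pD abD sID dD dI.
have nID : D \subset 'N(I) by apply: sub_abelian_norm.
have abQ : abelian (D / I) by apply: quotient_abelian.
have [i chi_d] : exists i : Iirr (D / I), coset I d \notin cfker 'chi_i.
  apply/existsP; rewrite -negb_forall; apply/negP => /forallP all_ker.
  have : coset I d \in (\bigcap_i cfker 'chi[D / I]_i)%SET by apply/finset.bigcapP.
  rewrite TI_cfker_irr => /finset.set1P d1; case/negP: dI.
  by apply: coset_idr d1; apply: (fintype.subsetP nID).
have chi_lin : 'chi_i \is a linear_char by apply: char_abelianP.
pose N := #|(D / I)%G|; have N0 : (0 < N)%N by apply: cardG_gt0.
have pN : prime_to p N.
  move: pD; rewrite -(Lagrange sID) mulnC prime_toM.
  by rewrite -card_quotient // => /andP[].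
have [om omP] := C_prim_root_exists N0.
have chiN x : x \in D -> ('chi_i (coset I x) ^+ N = 1)%R.
  move=> xD; have xQ : coset I x \in D / I by apply: mem_quotient.
  have /dvdnP[k ->] : (#[coset I x] %| N)%N by apply: order_dvdG.
  by rewrite mulnC exprM lin_char_unity_root // expr1n.
have logP x : exists k : nat, x \in D -> ('chi_i (coset I x) = om ^+ k)%R.
  case: (boolP (x \in D)) => [xD|_]; last by exists 0%N.
  by have [k kE] := prim_rootP omP (chiN x xD); exists (nat_of_ord k).
have [lg lgE] := choice logP.
pose psi x := zroot z0 N ^+ lg x.
have psi_eq x k : x \in D -> ('chi_i (coset I x) = om ^+ k)%R -> psi x = zroot z0 N ^+ k.
  move=> xD; rewrite lgE // => /eqP; rewrite (eq_prim_root_expr omP) => /eqP kE.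
  apply: expg_eqmod kE; apply: val_inj; rewrite [LHS]muexpE /=.
  exact: prim_expr_order (z0P pN).
exists psi; split=> [x y xD yD|x xI|].
- rewrite (psi_eq _ (lg x + lg y)%N) ?groupM ?expgnDr //.
  have xN := fintype.subsetP nID _ xD; have yN := fintype.subsetP nID _ yD.
  by rewrite morphM // lin_charM ?mem_quotient // !lgE // exprD.
- rewrite (psi_eq _ 0%N) ?(fintype.subsetP sID) // expr0.
  by rewrite coset_id // lin_char1.
move=> psid; case/negP: chi_d.
have chi1 : ('chi_i (coset I d) = 1)%R.
  rewrite lgE //; apply/eqP; rewrite -(prim_order_dvd omP).
  have /(congr1 (@mu_val p K)) := psid; rewrite muexpE /= => /eqP.
  by rewrite -(prim_order_dvd (z0P pN)).
by rewrite cfkerEirr inE chi1 lin_char1.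
Qed.

End SeparatingCharacter.

Section CocycleExtension.
Local Open Scope group_scope.
Variables (G M : groupType) (c : G -> G -> M).

(** Normalised cocycles, as the group law of the extension then has unit [(1, 1)]. *)
Record cocycle : Prop := Cocycle {
  coc_abelian : forall x y : M, x * y = y * x;
  coc1g : forall g, c 1 g = 1;
  cocg1 : forall g, c g 1 = 1;
  cocM : forall g h k, c g h * c (g * h) k = c h k * c g (h * k)
}.

Definition cocext (coc : cocycle) : Type := (G * M)%type.

Variable coc : cocycle.
HB.instance Definition _ := Choice.on (cocext coc).

Definition coc_mul (e f : cocext coc) : cocext coc :=
  (e.1 * f.1, e.2 * f.2 * c e.1 f.1).
Definition coc_one : cocext coc := (1, 1).
Definition coc_inv (e : cocext coc) : cocext coc := (e.1^-1, (e.2 * c e.1 e.1^-1)^-1).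

Let mC := coc_abelian coc.

Fact coc_mulA : associative coc_mul.
Proof.
move=> [g x] [h y] [k z]; rewrite /coc_mul /= mulgA; congr (_, _).
by rewrite -!mulgA; congr (_ * (_ * _)); rewrite -(cocM coc) [RHS]mulgA [c g h * z]mC -mulgA.
Qed.

Fact coc_mul1 : left_id coc_one coc_mul.
Proof. by case=> g x; rewrite /coc_mul /= !mul1g (coc1g coc) mulg1. Qed.

Fact coc_1mul : right_id coc_one coc_mul.
Proof. by case=> g x; rewrite /coc_mul /= !mulg1 (cocg1 coc) mulg1. Qed.

Lemma coc_invC g : c g g^-1 = c g^-1 g.
Proof. by have := cocM coc g g^-1 g; rewrite mulgV mulVg (coc1g coc) (cocg1 coc) !mulg1. Qed.

Fact coc_mulV : left_inverse coc_one coc_inv coc_mul.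
Proof.
case=> g x; rewrite /coc_mul /coc_one /= mulVg; congr (_, _).
by rewrite coc_invC -mulgA mulVg.
Qed.

Fact coc_Vmul : right_inverse coc_one coc_inv coc_mul.
Proof.
case=> g x; rewrite /coc_mul /coc_one /= mulgV; congr (_, _).
by rewrite [x * _]mC -mulgA mulVg.
Qed.

HB.instance Definition _ := isGroup.Build (cocext coc)
  coc_mulA coc_mul1 coc_1mul coc_mulV coc_Vmul.

Definition cocext_group : groupType := cocext coc.

End CocycleExtension.

Lemma etale_frobX (F : finFieldType) (K : closedFieldType) (iota : {rmorphism F -> K})
    (p : nat) (charF : p \in [pchar F]) (E : groupType) (aE : etale_action iota E) j e :
  aE (frob iota charF ^+ j)%g e = iter j (aE (frob iota charF)) e.
Proof.
have [a1 aM _] := eact_gal aE.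
by elim: j => [|j IHj]; rewrite ?a1 // expgS aM IHj.
Qed.

(** The inverse of the Frobenius extracts the root of order [q]. *)
Lemma muinf_root_q (F : finFieldType) (K : closedFieldType) (iota : {rmorphism F -> K})
    (p : nat) (charF : p \in [pchar F]) (y : muinf p K) :
  exists r : muinf p K, (r ^+ #|F|)%g = y.
Proof.
have [n pn yn] := muinfP y; pose x := ((frob iota charF)^-1)%g (mu_val y).
have xP : `[< exists2 n, prime_to p n & (x ^+ n = 1)%R >].
  apply/asboolP; exists n => //; rewrite /x -galX yn.
  by have [_ _ [-> _] _] := absGalP ((frob iota charF)^-1)%g.
exists (Muinf xP); apply: val_inj; rewrite [LHS]muexpE /= -(frobE iota charF).
exact: galKV.
Qed.

(** * The extension defined by an obstructing character *)

Section LevelExtension.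
Local Open Scope group_scope.
Variables (F : finFieldType) (K : closedFieldType) (iota : {rmorphism F -> K}).
Hypothesis algK : forall x : K, algebraicOver iota x.
Variable p : nat.
Hypothesis charF : p \in [pchar F].
Local Notation q := #|F|.
Local Notation Fr := (frob iota charF).
Variables (z0 : Zhat1 p K) (z0P : forall n, prime_to p n -> n.-primitive_root (z0 n)).
Variables (G : finGroupType) (aG : etale_action iota G) (tameG : coprime #|G| p).
Variable C : conj_subscheme p aG.
Hypothesis genC : generates C.
Local Notation starG := (starG z0P aG tameG).
Local Notation S := (pointsC z0P tameG C).
Local Notation classesC := (classesC z0P tameG C).
Local Notation qz := (qz z0).
Local Notation mu := (muinf p K).

(** A finite quotient of the group generated by the symbols, above [G], with the
    endomorphism that the Frobenius induces. *)
Variables (gT : finGroupType) (ev : G -> gT) (sigma : gT -> gT) (pi : gT -> G).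
Hypotheses (evE : equivariant z0P tameG C ev)
  (sigmaM : {morph sigma : u v / u * v})
  (sigma_ev : forall a, a \in S -> sigma (ev a) = ev (starG Fr a) ^+ q)
  (piM : {morph pi : u v / u * v}) (pi_ev : forall a, a \in S -> pi (ev a) = a).

Definition level_group : {group gT} := <<(ev @: S)%SET>>%G.
Local Notation A := level_group.

Section Morphisms.
Variables (X Y : finGroupType) (f : X -> Y).
Hypothesis fM : {morph f : x y / x * y}.
Lemma gmorph1 : f 1 = 1.
Proof. by apply: (@mulgI _ (f 1)); rewrite -fM !mulg1. Qed.
Lemma gmorphV x : f x^-1 = (f x)^-1.
Proof. by apply: (@mulgI _ (f x)); rewrite -fM !mulgV gmorph1. Qed.
Lemma gmorphX x k : f (x ^+ k) = f x ^+ k.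
Proof. by elim: k => [|k IHk]; rewrite ?gmorph1 // !expgS fM IHk. Qed.
End Morphisms.

Lemma ev_level a : a \in S -> ev a \in A.
Proof. by move=> aS; apply/mem_gen/imset_f. Qed.

(** No inverses are needed, because the group is finite. *)
Lemma level_word u : u \in A -> exists2 w, all (mem S) w & u = \prod_(a <- w) ev a.
Proof.
case/gen_prodgP=> n [c cS ->].
have /choice[b bE] (i : 'I_n) : exists a, a \in S /\ c i = ev a.
  by have /imsetP[a aS ->] := cS i; exists a.
exists [seq b i | i <- index_enum 'I_n].
  by apply/allP=> _ /mapP[i _ ->]; case: (bE i).
by rewrite big_map; apply: eq_bigr => i _; case: (bE i).
Qed.

Lemma level_conj u a : u \in A -> a \in S -> u * ev a * u^-1 = ev (pi u * a * (pi u)^-1).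
Proof.
case/level_word=> w wS -> aS; elim: w wS => [_|b w IHw /= /andP[bS wS]].
  by rewrite !big_nil (gmorph1 piM) !invg1 !mulg1 !mul1g.
rewrite !big_cons piM pi_ev // !invMg !mulgA.
rewrite -[ev b * _ * ev a]mulgA -[ev b * (_ * _) * _]mulgA IHw //.
rewrite evE ?pointsC_conj //; congr (ev _); by rewrite !mulgA.
Qed.

(** Here the hypothesis that [C] generates [G] enters. *)
Lemma level_pi_surj g : exists2 u, u \in A & pi u = g.
Proof.
have /gen_prodgP[n [c cS ->]] : g \in <<S>> by rewrite (generated_by_points z0P tameG genC) inE.
exists (\prod_(i < n) ev (c i)); first by apply: group_prod => i _; apply: ev_level.
by rewrite (big_morph pi piM (gmorph1 piM)); apply: eq_bigr => i _; rewrite pi_ev.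
Qed.

Lemma level_sigma u : u \in A -> sigma u \in A.
Proof.
case/level_word=> w wS ->; elim: w wS => [_|b w IHw /= /andP[bS wS]].
  by rewrite big_nil (gmorph1 sigmaM).
rewrite big_cons sigmaM groupM ?IHw // sigma_ev // groupX // ev_level //.
exact: pointsC_star.
Qed.

Lemma pi_sigma u : u \in A -> pi (sigma u) = aG Fr (pi u).
Proof.
case/level_word=> w wS ->; elim: w wS => [_|b w IHw /= /andP[bS wS]].
  by rewrite big_nil (gmorph1 sigmaM) !(gmorph1 piM) eact1.
rewrite big_cons sigmaM !piM IHw // eactM; congr (_ * _).
rewrite sigma_ev // (gmorphX piM) !pi_ev ?pointsC_star //.
exact: star_frob.
Qed.

(** The kernel of the level over [G] is central, since [ev] is equivariant. *)
Lemma level_central z u : z \in A -> pi z = 1 -> u \in A -> z * u = u * z.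
Proof.
move=> zA z1 /level_word[w wS ->]; elim: w wS => [_|b w IHw /= /andP[bS wS]].
  by rewrite big_nil mulg1 mul1g.
have zb : z * ev b = ev b * z.
  by have := level_conj zA bS; rewrite z1 mul1g invg1 mulg1 => {2}<-; rewrite mulgKV.
by rewrite big_cons mulgA zb -mulgA IHw // mulgA.
Qed.

Section Extension.
(** The level is pushed out along a character [chi] of its central kernel. The
    identity [chi_sigma] says that [sigma], corrected by the character [tau], is
    compatible with the Frobenius of [Q/Z(1)] along [chi], so that it descends to the
    pushout. *)
Variables (chi : gT -> mu) (tau : gT -> mu).
Hypotheses
  (chiM : forall z y, z \in A -> y \in A -> pi z = 1 -> pi y = 1 -> chi (z * y) = chi z * chi y)
  (tauM : {morph tau : u v / u * v})
  (chi_sigma : forall z, z \in A -> pi z = 1 -> chi z ^+ q * tau z = chi (sigma z)).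

Let secP : exists s : G -> gT, [/\ s 1 = 1, forall g, s g \in A & forall g, pi (s g) = g].
Proof.
have ex g : exists u, [/\ u \in A, pi u = g & (g == 1) ==> (u == 1)].
  have [->|g1] := eqVneq g 1; first by exists 1; rewrite group1 (gmorph1 piM) eqxx.
  by have [u uA uE] := level_pi_surj g; exists u.
have [s sP] := choice ex; exists s; split=> [|g|g]; [|by case: (sP g)|by case: (sP g)].
by have [_ _] := sP 1; rewrite eqxx => /eqP.
Qed.
Let s := sval (cid secP).
Let s1 : s 1 = 1. Proof. by rewrite /s; case: cid => ? []. Qed.
Let sA g : s g \in A. Proof. by rewrite /s; case: cid => ? []. Qed.
Let sE g : pi (s g) = g. Proof. by rewrite /s; case: cid => ? []. Qed.

Let zz g h := s g * s h * (s (g * h))^-1.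
Let zzA g h : zz g h \in A. Proof. by rewrite !groupM ?groupV. Qed.
Let zz1 g h : pi (zz g h) = 1.
Proof. by rewrite !piM (gmorphV piM) !sE mulgV. Qed.

Let c g h := chi (zz g h).

Let chi1 : chi 1 = 1.
Proof.
by apply: (@mulgI _ (chi 1)); rewrite -chiM ?group1 ?(gmorph1 piM) // !mulg1.
Qed.

Lemma level_cocycle : cocycle c.
Proof.
split=> [x y|g|g|g h k]; first exact: muC.
- by rewrite /c /zz s1 !mul1g mulgV chi1.
- by rewrite /c /zz s1 !mulg1 mulgV chi1.
rewrite /c -!chiM ?zzA ?zz1 //; congr chi.
have -> : zz g h * zz (g * h) k = s g * s h * s k * (s (g * h * k))^-1.
  by rewrite /zz !mulgA mulgKV.
rewrite {2}/zz !mulgA (level_central (zzA h k) (zz1 h k) (sA g)).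
by rewrite /zz !mulgA mulgKV.
Qed.

Definition level_ext_group : groupType := cocext_group level_cocycle.
Local Notation E := level_ext_group.

Lemma level_extM (e f : E) : e * f = (e.1 * f.1, e.2 * f.2 * c e.1 f.1).
Proof. by []. Qed.

Let inE' (x : mu) : E := (1, x).

Lemma level_inclE x (e : E) : inE' x * e = (e.1, x * e.2).
Proof. by rewrite level_extM /= mul1g (coc1g level_cocycle) mulg1. Qed.

Lemma level_inclC x (e : E) : inE' x * e = e * inE' x.
Proof. by rewrite level_inclE level_extM /= mulg1 (cocg1 level_cocycle) mulg1 muC. Qed.

(** The pushout map from the level to the extension. It restricts to [chi] on the
    kernel ([theta_ker]). *)
Definition theta (u : gT) : E := (pi u, chi (u * (s (pi u))^-1)).

Let kerA u : u \in A -> u * (s (pi u))^-1 \in A.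
Proof. by move=> uA; rewrite groupM ?groupV. Qed.
Let ker1 u : pi (u * (s (pi u))^-1) = 1.
Proof. by rewrite piM (gmorphV piM) sE mulgV. Qed.

Lemma thetaM : {in A &, {morph theta : u v / u * v}}.
Proof.
move=> u v uA vA; rewrite level_extM /= /theta piM; congr (_, _).
have := (kerA uA, kerA vA, ker1 u, ker1 v).
have uE : u = u * (s (pi u))^-1 * s (pi u) by rewrite mulgKV.
have vE : v = v * (s (pi v))^-1 * s (pi v) by rewrite mulgKV.
move: (u * _) uE (v * _) vE => x uE y vE [[[xA yA] x1] y1].
have xyA : x * y \in A by rewrite groupM.
have xy1 : pi (x * y) = 1 by rewrite piM x1 y1 mulg1.
rewrite /c -(chiM xA yA x1 y1) -(chiM xyA (zzA _ _) xy1 (zz1 _ _)); congr chi.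
rewrite /zz !mulgA -[x * y * s (pi u)]mulgA (level_central yA y1 (sA _)).
by rewrite {1}uE {1}vE !mulgA.
Qed.

Lemma theta_ker z : z \in A -> pi z = 1 -> theta z = inE' (chi z).
Proof. by move=> zA z1; rewrite /theta z1 s1 invg1 mulg1. Qed.

Lemma theta1 : theta 1 = 1.
Proof. by apply: (@mulgI _ (theta 1)); rewrite -thetaM ?group1 // !mulg1. Qed.

Lemma thetaV u : u \in A -> theta u^-1 = (theta u)^-1.
Proof. by move=> uA; apply: (@mulgI _ (theta u)); rewrite -thetaM ?groupV // !mulgV theta1. Qed.

Lemma thetaX u k : u \in A -> theta (u ^+ k) = theta u ^+ k.
Proof.
move=> uA; elim: k => [|k IHk]; first by rewrite theta1.
by rewrite !expgS thetaM ?groupX // IHk.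
Qed.

Lemma theta_decomp (e : E) : e = inE' e.2 * theta (s e.1).
Proof.
case: e => g x; rewrite level_inclE /theta /= sE mulgV chi1.
by rewrite mulg1.
Qed.

(** Every element is [inE' x * theta u], and [level_frob_theta] shows that the value
    does not depend on this decomposition. *)
Definition level_frob (e : E) : E :=
  inE' (e.2 ^+ q * (tau (s e.1))^-1) * theta (sigma (s e.1)).

Let inM x y : inE' (x * y) = inE' x * inE' y.
Proof. by rewrite level_inclE. Qed.

Lemma level_frob_theta x u : u \in A ->
  level_frob (inE' x * theta u) = inE' (x ^+ q * (tau u)^-1) * theta (sigma u).
Proof.
move=> uA; set z := u * (s (pi u))^-1; have zA : z \in A by apply: kerA.
have z1 : pi z = 1 by apply: ker1.
have uE : u = z * s (pi u) by rewrite /z mulgKV.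
rewrite level_inclE /level_frob /= -/z.
rewrite [in RHS]uE sigmaM tauM [in RHS]thetaM ?level_sigma // [theta (sigma z)]theta_ker ?level_sigma //; last first.
  by rewrite pi_sigma // z1 eact1.
rewrite mulgA -inM; congr (inE' _ * _); rewrite expgMn; last exact: muC.
rewrite -chi_sigma // invMg -!mulgA; congr (_ * _).
rewrite [RHS]mulgA [(tau (s (pi u)))^-1 * _]muC -!mulgA.
by rewrite [(tau z)^-1 * _]muC -!mulgA mulgV mulg1 muC.
Qed.

Lemma level_frobM : {morph level_frob : e f / e * f}.
Proof.
move=> e f; rewrite {1}[e]theta_decomp {1}[f]theta_decomp.
have -> : inE' e.2 * theta (s e.1) * (inE' f.2 * theta (s f.1)) =
          inE' (e.2 * f.2) * theta (s e.1 * s f.1).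
  by rewrite thetaM // inM -!mulgA; congr (_ * _); rewrite !mulgA level_inclC.
rewrite level_frob_theta ?groupM // sigmaM thetaM ?level_sigma // /level_frob.
rewrite tauM invMg expgMn; last exact: muC.
set x := e.2 ^+ q; set y := f.2 ^+ q; set a := (tau (s e.1))^-1; set b := (tau _)^-1.
have -> : x * y * (b * a) = (x * a) * (y * b).
  by rewrite -!mulgA; congr (_ * _); rewrite [a * _]muC -!mulgA.
by rewrite inM -!mulgA; congr (_ * _); rewrite !mulgA level_inclC.
Qed.

Lemma level_frob_iter j x : iter j level_frob (inE' x) = inE' (x ^+ (q ^ j)).
Proof.
elim: j => [|j IHj] //=; rewrite IHj -[inE' (x ^+ _)]mulg1 -theta1 level_frob_theta //.
rewrite (gmorph1 sigmaM) theta1 mulg1 expnSr expgnA; congr inE'.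
have -> : tau 1 = 1 by apply: (@mulgI _ (tau 1)); rewrite -tauM !mulg1.
by rewrite invg1 mulg1.
Qed.

Lemma level_frob_fst (e : E) : (level_frob e).1 = aG Fr e.1.
Proof. by rewrite /level_frob level_inclE /= pi_sigma // sE. Qed.

Lemma level_frob_inj : injective level_frob.
Proof.
have inj1 e : level_frob e = 1 -> e = 1.
  move=> e1; have : aG Fr e.1 = aG Fr 1 by rewrite eact1 -level_frob_fst e1.
  have [a1 aM _] := eact_gal aG.
  move=> /(congr1 (aG Fr^-1)); rewrite -!aM mulVg !a1 => e0.
  move: e1; rewrite [e]theta_decomp e0 s1 theta1 mulg1.
  move: (level_frob_iter 1 e.2); rewrite /= => -> /(congr1 snd) /= eq.
  by rewrite expn1 in eq; rewrite (muinf_expq_inj iota charF eq).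
move=> e f ef; apply: (@mulIg _ f^-1); rewrite mulgV; apply: inj1.
have fV : level_frob f^-1 = (level_frob f)^-1.
  apply: (@mulgI _ (level_frob f)); rewrite -level_frobM !mulgV.
  by apply: (@mulgI _ (level_frob 1)); rewrite -level_frobM !mulg1.
by rewrite level_frobM fV ef mulgV.
Qed.

(** An orbit stays in the elements whose second component has bounded order, which are
    finite in number. The correction by [y] is a function on the finite group [G]. *)
Lemma level_frob_periodic e : exists2 d, (0 < d)%N & iter d level_frob e = e.
Proof.
pose y g := (level_frob (g, 1)).2.
have [N1 pN1 yN] := muinf_common y; have [N2 pN2 eN] := muinf_torsion e.2.
pose N := (N1 * N2)%N; have pN : prime_to p N by rewrite prime_toM pN1.
have frobE2 (f : E) : (level_frob f).2 = f.2 ^+ q * y f.1.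
  rewrite /y /level_frob !level_inclE /= expg1n mul1g !mulgA //.
have itN i : (iter i level_frob e).2 ^+ N = 1.
  elim: i => [|i IHi]; first by rewrite /N mulnC expgnA eN expg1n.
  rewrite iterS frobE2 expgMn; last exact: muC.
  by rewrite -expgnA mulnC expgnA IHi expg1n mul1g /N expgnA yN expg1n.
have lg i : exists k : 'I_N, mu_val (iter i level_frob e).2 = (z0 N ^+ k)%R.
  have [|k kE] := @prim_rootP _ _ _ (z0P pN) (mu_val (iter i level_frob e).2); last by exists k.
  by rewrite -muexpE itN.
have [k kE] := choice lg.
have [i [j [ij]]] := nat_finite_collision (fun i => ((iter i level_frob e).1, k i)).
case=> fij kij; exists (j - i)%N; first by rewrite subn_gt0.
have itE : iter i level_frob e = iter j level_frob e.
  rewrite [LHS]surjective_pairing [RHS]surjective_pairing fij; congr (_, _).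
  by apply: val_inj; rewrite /= !kE kij.
have iinj : injective (iter i level_frob).
  by elim: (i) => // l IHl u v /= /level_frob_inj /IHl.
by apply: iinj; rewrite -iterD subnKC // ltnW.
Qed.

Definition level_etale : etale_action iota E :=
  frob_etale iota charF level_frobM level_frob_periodic.

Lemma level_etaleE e : level_etale Fr e = level_frob e.
Proof. exact: frob_etaleE. Qed.

Let proj (e : E) : G := e.1.

Fact level_ext_incl_inj : injective inE'.
Proof. by move=> x y []. Qed.

Fact level_ext_exact (e : E) : proj e = 1 <-> exists x, e = inE' x.
Proof. by split=> [|[x ->]//]; case: e => g x /= ->; exists x. Qed.

(** Compatibility with the Galois group follows from compatibility with the Frobenius,
    by continuity and density. *)
Fact level_ext_incl_gal (t : absGal iota) x y : mu_val y = t (mu_val x) ->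
  level_etale t (inE' x) = inE' y.
Proof.
move=> yE; have [d d0 dP] := gal_action_level algK charF (inE' x) (eact_gal level_etale).
have [e e0 eP] := finite_level algK charF [:: mu_val x].
have de0 : (0 < d * e)%N by rewrite muln_gt0 d0.
have [j tj] := frob_dense charF t de0.
rewrite (dP _ (Fr ^+ j)); last exact: agree_dvd (dvdn_mulr _ (dvdnn d)) tj.
rewrite etale_frobX (eq_iter level_etaleE) level_frob_iter; congr inE'.
apply: val_inj; rewrite [LHS]muexpE [RHS]/= yE -(frobX iota charF); apply/esym.
by apply: (agree_dvd (dvdn_mull d (dvdnn e)) tj); apply: eP; rewrite mem_head.
Qed.

Fact level_ext_proj_gal (t : absGal iota) (e : E) : proj (level_etale t e) = aG t (proj e).
Proof.
have [d d0 dP] := gal_action_level algK charF e (eact_gal level_etale).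
have [l l0 lP] := gal_action_level algK charF (proj e) (eact_gal aG).
have dl0 : (0 < d * l)%N by rewrite muln_gt0 d0.
have [j tj] := frob_dense charF t dl0.
rewrite (dP _ (Fr ^+ j)); last exact: agree_dvd (dvdn_mulr _ (dvdnn d)) tj.
rewrite (lP _ (Fr ^+ j)); last exact: agree_dvd (dvdn_mull _ (dvdnn l)) tj.
rewrite !etale_frobX (eq_iter level_etaleE).
by elim: j {tj} => // j; rewrite !iterS => <-; apply: level_frob_fst.
Qed.

Definition level_ext : central_ext p aG :=
  @CentralExt F K iota p G aG E level_etale inE' proj
    inM level_ext_incl_inj (fun e f => erefl) (fun g => ex_intro _ (g, 1) erefl)
    level_ext_exact level_inclC level_ext_incl_gal level_ext_proj_gal.

Definition level_lift (a : G) : level_ext := theta (ev a).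

Lemma level_liftP : is_lift z0P tameG C level_lift.
Proof.
split=> [a aS|e a aS]; first exact: pi_ev.
have cj (i t l : E) : (forall f, i * f = f * i) -> i * t * l * (i * t)^-1 = t * l * t^-1.
  by move=> ic; rewrite invMg -!mulgA ic -!mulgA mulVg mulg1.
have := cj _ (theta (s e.1)) (level_lift a) (level_inclC e.2).
rewrite -theta_decomp => ->; rewrite -thetaV // -!thetaM ?groupM ?groupV ?ev_level //.
by rewrite level_conj // sE.
Qed.

Lemma level_frob_on_theta u : u \in A ->
  ce_act level_ext Fr (theta u) = ce_incl level_ext (tau u)^-1 * theta (sigma u) :> E.
Proof.
move=> uA; rewrite [LHS]level_etaleE -[theta u in LHS]mul1g -[1 in LHS]/(inE' 1).
by rewrite level_frob_theta // expg1n mul1g.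
Qed.

(** The defects of the lift at the Frobenius record the correction [tau]. *)
Lemma level_defect a : a \in S -> defect z0P tameG level_lift Fr a ^+ q = (tau (ev a))^-1.
Proof.
move=> aS; have := star_frob charF z0P (ce_act level_ext) (@ce_torsion _ _ _ _ _ _ tameG level_ext) (level_lift a).
rewrite (defectE level_liftP) // expgMn; last exact: ce_central.
rewrite -(inclX (@ce_inclM _ _ _ _ _ _ level_ext)) /level_lift -thetaX ?ev_level ?pointsC_star //.
rewrite level_frob_on_theta ?ev_level // sigma_ev //.
by move=> /mulIg/ce_incl_inj.
Qed.

End Extension.

Section Solution.
Variables (T : finGroupType) (R : gT -> T).
Hypotheses (TC : forall x y : T, x * y = y * x) (RM : {morph R : u v / u * v}).
Hypotheses (pgT : prime_to p #|gT|) (pT : prime_to p #|T|).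
Variables (h a0 : G) (nA : {set G} -> nat).
Hypothesis a0F : aG Fr (h^-1 * a0 * h) = a0 ^+ q.
Hypothesis no_obstruction : forall (B : central_ext p aG) (m : G -> B) (r : mu),
  is_lift z0P tameG C m ->
  (forall e k : B, ce_proj e = a0 -> ce_proj k = h ->
     ce_act B Fr (k^-1 * e * k) = ce_incl B (r ^+ q) * e ^+ q) ->
  (qz r + \sum_(A in classesC) class_defect z0P tameG m Fr A *+ nA A = 0)%R.

(** The class counts prescribed by [nA]. *)
Let target : T := \prod_(A in classesC) R (ev (repr A)) ^+ nA A.

Let kerset : {set gT} := [set u in A | pi u == 1]%SET.

Let kerP u : reflect (u \in A /\ pi u = 1) (u \in kerset).
Proof. by rewrite inE; apply: (iffP andP) => -[uA /eqP]. Qed.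

Lemma prod_exp_q (I : finType) (P : pred I) (f : I -> mu) :
  (\prod_(i | P i) f i) ^+ q = \prod_(i | P i) f i ^+ q.
Proof.
apply: (big_morph (fun x : mu => x ^+ q)); last exact: expg1n.
by move=> x y; apply: expgMn; apply: muC.
Qed.

Lemma prod_inv (I : finType) (P : pred I) (f : I -> mu) :
  (\prod_(i | P i) f i)^-1 = \prod_(i | P i) (f i)^-1.
Proof.
apply: (big_morph (fun x : mu => x^-1)); last exact: invg1.
by move=> x y; rewrite invMg muC.
Qed.

Lemma prod_qz (I : finType) (P : pred I) (f : I -> mu) :
  qz (\prod_(i | P i) f i) = (\sum_(i | P i) qz (f i))%R.
Proof. apply: (big_morph qz); [exact: qzM|exact: qz1]. Qed.

(** Duality: the equations for a rational point are linear in the central kernel.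
    A character obstructing their solution defines an extension of [G] by [Q/Z(1)]
    with a lift of [C]; up to sign and multiplication by [q], its value is the sum of
    the residues. *)
Lemma level_solution : exists k0 u, [/\ k0 \in A, pi k0 = h, u \in A &
  [/\ pi u = a0^-1, sigma (k0^-1 * u * k0) = u ^+ q & R u = target]].
Proof.
have [k0 k0A k0h] := level_pi_surj h; have [u0 u0A u0a] := level_pi_surj a0^-1.
pose w0 := sigma (k0^-1 * u0 * k0) * (u0 ^+ q)^-1.
have k0uA : k0^-1 * u0 * k0 \in A by rewrite !groupM ?groupV.
have w0A : w0 \in A by rewrite groupM ?level_sigma ?groupV ?groupX.
have w01 : pi w0 = 1.
  rewrite piM pi_sigma // !piM (gmorphV piM) k0h u0a (gmorphV piM) (gmorphX piM) u0a.
  have -> : h^-1 * a0^-1 * h = (h^-1 * a0 * h)^-1 by rewrite !invMg invgK mulgA.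
  by rewrite eactV a0F expVgn mulgV.
(* Changing the solution [u0] above [G] by [z] in the kernel changes the error in the
   Frobenius equation and the class counts by [Psi z]. *)
pose Psi (z : gT) : gT * T := (z ^+ q * (sigma z)^-1, R z).
have kM z y : z \in kerset -> y \in kerset -> z * y \in kerset.
  move=> /kerP[zA z1] /kerP[yA y1]; apply/kerP; split; first exact: groupM.
  by rewrite piM z1 y1 mulg1.
have k1 : 1 \in kerset by apply/kerP; rewrite group1 (gmorph1 piM).
have kS z : z \in kerset -> sigma z \in kerset.
  by move=> /kerP[zA z1]; apply/kerP; rewrite level_sigma // pi_sigma // z1 eact1.
have kX z n : z \in kerset -> z ^+ n \in kerset.
  by move=> zk; elim: n => [|n IHn] //; rewrite expgS kM.
have kV z : z \in kerset -> z^-1 \in kerset.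
  by move=> /kerP[zA z1]; apply/kerP; rewrite groupV zA (gmorphV piM) z1 invg1.
have kC z u : z \in kerset -> u \in A -> z * u = u * z.
  by move=> /kerP[zA z1] uA; apply: level_central.
have kA z : z \in kerset -> z \in A by case/kerP.
have PsiM : {in kerset &, {morph Psi : z y / z * y}}.
  move=> z y zk yk; congr (_, _); last exact: RM.
  rewrite expgMn; last exact: kC zk (kA _ yk).
  rewrite sigmaM invMg /= -!mulgA; congr (_ * _); rewrite mulgA.
  rewrite (kC (y ^+ q * (sigma y)^-1)) ?kM ?kX ?kV ?kS // groupV.
  exact/kA/kS.
pose Dset := [set x : gT * T | x.1 \in kerset]%SET.
have inD x : (x \in Dset) = (x.1 \in kerset) by rewrite [LHS]inE.
have Dg : group_set Dset.
  by apply/group_setP; split=> [|x y]; rewrite !inD //=; apply: kM.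
pose D := Group Dg.
have Ig : group_set [set Psi z | z in kerset]%SET.
  apply/group_setP; split=> [|_ _ /imsetP[z zk ->] /imsetP[y yk ->]].
    apply/imsetP; exists 1 => //; rewrite /Psi (gmorph1 sigmaM) (gmorph1 RM).
    by rewrite expg1n invg1 mulg1.
  by rewrite -PsiM // imset_f // kM.
pose Im := Group Ig.
have abD : abelian D.
  apply/centsP=> -[x f] xD [y g] yD; congr (_, _); last exact: TC.
  by move: xD yD; rewrite !inD /= => xk yk; apply: kC xk (kA _ yk).
have sID : Im \subset D.
  apply/fintype.subsetP => _ /imsetP[z zk ->]; rewrite inD /=.
  by rewrite kM ?kX ?kV ?kS.
pose d : gT * T := (w0, target * (R u0)^-1).
have dD : d \in D by rewrite inD /=; apply/kerP.
have [/imsetP[z zk]|dI] := boolP (d \in Im).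
  case=> w0E tE; have zA := kA _ zk; have z1 : pi z = 1 by case/kerP: zk.
  exists k0, (u0 * z); split; rewrite ?groupM //; split.
  - by rewrite piM u0a z1 mulg1.
  - have -> : k0^-1 * (u0 * z) * k0 = k0^-1 * u0 * k0 * z.
      by rewrite -!mulgA; congr (_ * (_ * _)); rewrite (kC z) // -mulgA.
    have se : sigma (k0^-1 * u0 * k0) = w0 * u0 ^+ q by rewrite /w0 mulgKV.
    rewrite sigmaM se w0E expgMn; last by rewrite /commute (kC z).
    rewrite -[_ * u0 ^+ q * _]mulgA (kC (z ^+ q * _)) ?kM ?kX ?kV ?kS //; last first.
      by rewrite groupM ?groupX ?level_sigma.
    by rewrite -!mulgA; congr (_ * _); rewrite mulgA (kC (sigma z)) ?kS ?groupX // mulgK.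
  - by rewrite RM -tE TC mulgKV.
(* Otherwise a character of [D] obstructs the solution. *)
have pD : prime_to p #|D|.
  have pgTT : prime_to p (#|gT| * #|T|) by rewrite prime_toM pgT.
  rewrite -card_prod -cardsT in pgTT.
  have /dvdnP[k kE] := cardSg (finset.subsetT D).
  by move: pgTT; rewrite kE prime_toM => /andP[].
have [psi [psiM psi1 psid]] := separating_character z0P pD abD sID dD dI.
pose chi z := psi (z, 1); pose t f := psi (1, f).
have inD1 z : z \in kerset -> (z, 1 : T) \in D by move=> zk; rewrite inD.
have inD2 f : (1 : gT, f) \in D by rewrite inD.
have psiE z f : z \in kerset -> psi (z, f) = chi z * t f.
  move=> zk; rewrite /chi /t -psiM ?inD1 //.
  by congr psi; congr (_, _); rewrite /= ?mulg1 ?mul1g.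
have tM : {morph t : f g / f * g}.
  by move=> f g; rewrite /t -psiM //; congr psi; congr (_, _); rewrite mulg1.
have chiM z y : z \in A -> y \in A -> pi z = 1 -> pi y = 1 -> chi (z * y) = chi z * chi y.
  move=> zA yA z1 y1; rewrite /chi -psiM; try (by apply/inD1/kerP).
  by congr psi; congr (_, _); rewrite mulg1.
have tauM : {morph (fun u => t (R u)) : u v / u * v} by move=> u v; rewrite RM tM.
have chi_sigma z : z \in A -> pi z = 1 -> chi z ^+ q * t (R z) = chi (sigma z).
  move=> zA z1; have zk : z \in kerset by apply/kerP.
  have szk := kS _ zk; have /kerP[szA sz1] := szk; have /kerP[zqA zq1] := kX _ q zk.
  have cV : chi (sigma z)^-1 = (chi (sigma z))^-1.
    apply: (@mulgI _ (chi (sigma z))); have /kerP[? ?] := kV _ szk.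
    rewrite -chiM // !mulgV; apply: (@mulgI _ (chi 1)).
    by rewrite -chiM ?group1 ?(gmorph1 piM) // !mulg1.
  have cX : chi (z ^+ q) = chi z ^+ q.
    elim: (q) => [|i IHi]; last first.
      by have /kerP[? ?] := kX _ i zk; rewrite !expgS chiM // IHi.
    by apply: (@mulgI _ (chi 1)); rewrite -chiM ?group1 ?(gmorph1 piM) // !mulg1.
  have := psi1 (Psi z) (imset_f _ zk); rewrite /Psi psiE ?kM ?kX ?kV ?kS //.
  have /kerP[? ?] := kV _ szk; rewrite chiM // cX cV => e1.
  apply: (@mulIg _ (chi (sigma z))^-1); rewrite mulgV -e1 -!mulgA; congr (_ * _).
  exact: muC.
pose B := level_ext chiM tauM chi_sigma.
pose m := level_lift chiM tauM chi_sigma.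
have mP : is_lift z0P tameG C m by apply: level_liftP.
pose th : gT -> B := theta chiM.
have thM u v : u \in A -> v \in A -> th (u * v) = th u * th v by apply: thetaM.
have thX u n : u \in A -> th (u ^+ n) = th u ^+ n by apply: thetaX.
have thV u : u \in A -> th u^-1 = (th u)^-1 by apply: thetaV.
have inclM := @ce_inclM _ _ _ _ _ _ B.
have inclX' x n : ce_incl B (x ^+ n) = ce_incl B x ^+ n by apply: inclX.
have inclV' x : ce_incl B x^-1 = (ce_incl B x)^-1 by apply: inclV.
have inclC x (e : B) : ce_incl B x * e = e * ce_incl B x by apply: ce_central.
have Fincl x : ce_act B Fr (ce_incl B x) = ce_incl B (x ^+ q).
  by apply: ce_incl_gal; rewrite muexpE.
have FM := eactM (ce_act B) Fr.
have FV e : ce_act B Fr (e : B)^-1 = (ce_act B Fr e)^-1 by apply: eactV.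
have tV f : t f^-1 = (t f)^-1.
  apply: (@mulgI _ (t f)); rewrite -tM !mulgV; apply: (@mulgI _ (t 1)).
  by rewrite -tM !mulg1.
(* The residue of the extension at [a0]. *)
have [r rE] := muinf_root_q iota charF (chi w0 * (t (R u0))^-1)^-1.
have rP (e k : B) : ce_proj e = a0 -> ce_proj k = h ->
    ce_act B Fr (k^-1 * e * k) = ce_incl B (r ^+ q) * e ^+ q.
  move=> ea0 kh; pose v := k0^-1 * u0 * k0.
  have [x xE] : exists x, e = ce_incl B x * (th u0)^-1.
    by apply: ce_same_proj; rewrite ea0 ce_projV /= u0a invgK.
  have [y yE] : exists y, k = ce_incl B y * th k0.
    by apply: ce_same_proj; rewrite kh /= k0h.
  have -> : k^-1 * e * k = ce_incl B x * (th v)^-1.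
    rewrite (ce_conj_proj e (_ : ce_proj k = ce_proj (th k0))); last by rewrite kh /= k0h.
    rewrite xE /v !thM ?groupM ?groupV // !thV // !invMg invgK !mulgA.
    by rewrite -(inclC x).
  rewrite FM Fincl FV level_frob_on_theta //.
  have -> : sigma v = w0 * u0 ^+ q by rewrite /w0 mulgKV.
  have -> : t (R v) = t (R u0).
    by rewrite /v !RM TC mulgA -RM mulgV (gmorph1 RM) mul1g.
  rewrite -/th thM ?groupX // thX // [th w0]theta_ker // rE xE.
  rewrite (expgMn _ (inclC _ _)) -inclX' expVgn.
  rewrite mulgA -inclM [in RHS]mulgA -inclM invMg mulgA.
  rewrite -(inclV' _) -inclC mulgA -inclM; congr (ce_incl B _ * _).
  by congr (_^-1 * _); rewrite muC.
have sum0 := no_obstruction mP rP; case: psid.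
(* The vanishing sum of the residues, written multiplicatively. Its [q]-th power is
   the equation [(psi d)^-1 = 1]. *)
have e1 : r * \prod_(A in classesC) defect z0P tameG m Fr (repr A) ^+ nA A = 1.
  apply: (qz_inj z0P); rewrite (qzM z0P) prod_qz (qz1 z0P) -[RHS]sum0; congr (_ + _)%R.
  by apply: eq_bigr => E _; rewrite (qzX z0P).
have e2 := congr1 (fun x => x ^+ q) e1.
rewrite /= (expgMn _ (muC _ _)) expg1n rE prod_exp_q in e2.
have e3 : \prod_(A in classesC) (defect z0P tameG m Fr (repr A) ^+ nA A) ^+ q = (t target)^-1.
  rewrite /target (big_morph t tM (_ : t 1 = 1)); last first.
    by apply: (@mulgI _ (t 1)); rewrite -tM !mulg1.
  rewrite prod_inv; apply: eq_bigr => E Ecl.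
  have aS := classesC_sub Ecl (classesC_repr Ecl).
  rewrite -expgnA mulnC expgnA (level_defect chiM tauM chi_sigma) // expVgn; congr (_^-1).
  by elim: (nA E) => [|i IHi]; rewrite ?expgS ?tM ?IHi //; apply/esym/(@mulgI _ (t 1)); rewrite -tM !mulg1.
rewrite e3 -invMg in e2.
have w0k : w0 \in kerset by apply/kerP.
rewrite psiE // tM tV.
have := congr1 (fun x => x^-1) e2; rewrite /= invgK invg1 => e4.
by rewrite -[RHS]e4 !mulgA; congr (_ * _); apply: muC.
Qed.

End Solution.
End LevelExtension.

(** * Words from the vanishing of residues *)

Section PowerGroup.
Variables (I : finType) (H : finGroupType).
Local Open Scope group_scope.

(** Finite functions are both a finite type and a group; the alias joins the two
    structures. *)
Definition power_group : Type := {ffun I -> H}.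
HB.instance Definition _ := Finite.on power_group.
HB.instance Definition _ := Group.on power_group.

Definition coord (i : I) (f : power_group) : H := (f : {ffun I -> H}) i.

Lemma coordM i : {morph coord i : f g / f * g}.
Proof. by move=> f g; rewrite /coord ffunE. Qed.

Lemma coord1 i : coord i 1 = 1.
Proof. by rewrite /coord ffunE. Qed.

Lemma coordX i f n : coord i (f ^+ n) = coord i f ^+ n.
Proof. by elim: n => [|n IHn]; rewrite ?coord1 // !expgS coordM IHn. Qed.

Lemma power_groupP (f g : power_group) : (forall i, coord i f = coord i g) -> f = g.
Proof. by move=> fg; apply/ffunP. Qed.

Lemma power_group_prime p : prime p -> prime_to p #|H| -> prime_to p #|(power_group : finGroupType)|.
Proof.
move=> pp pH; apply: prime_to_card pp _ => f; exists #|H| => //.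
apply: power_groupP => i; rewrite coordX coord1.
by rewrite -cardsT expg_cardG ?inE.
Qed.

End PowerGroup.

Section ResiduesToWords.
Local Open Scope group_scope.
Variables (F : finFieldType) (K : closedFieldType) (iota : {rmorphism F -> K}).
Hypothesis algK : forall x : K, algebraicOver iota x.
Variable p : nat.
Hypothesis charF : p \in [pchar F].
Local Notation q := #|F|.
Local Notation Fr := (frob iota charF).
Variables (z0 : Zhat1 p K) (z0P : forall n, prime_to p n -> n.-primitive_root (z0 n)).
Variables (G : finGroupType) (aG : etale_action iota G) (tameG : coprime #|G| p).
Variable C : conj_subscheme p aG.
Hypothesis genC : generates C.
Local Notation starG := (starG z0P aG tameG).
Local Notation S := (pointsC z0P tameG C).
Local Notation classesC := (classesC z0P tameG C).
Local Notation qz := (qz z0).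
Local Notation mu := (muinf p K).
Variables (h a0 : G) (nA : {set G} -> nat).
Hypothesis a0F : aG Fr (h^-1 * a0 * h) = a0 ^+ q.
Hypothesis no_obstruction : forall (B : central_ext p aG) (m : G -> B) (r : mu),
  is_lift z0P tameG C m ->
  (forall e k : B, ce_proj e = a0 -> ce_proj k = h ->
     ce_act B Fr (k^-1 * e * k) = ce_incl B (r ^+ q) * e ^+ q) ->
  (qz r + \sum_(A in classesC) class_defect z0P tameG m Fr A *+ nA A = 0)%R.

Local Notation equivariant := (equivariant z0P tameG C).

Section UniversalLevel.
Variable L : finGroupType.

Definition equivariantb (m : {ffun G -> L}) : bool :=
  [forall a in S, forall b in S, m b * m a * (m b)^-1 == m (b * a * b^-1)].

Lemma equivariantbP (m : {ffun G -> L}) : reflect (equivariant m) (equivariantb m).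
Proof.
apply: (iffP forall_inP) => [mE a b aS bS|mE a aS].
  by have /forall_inP/(_ b bS)/eqP := mE a aS.
by apply/forall_inP=> b bS; apply/eqP/mE.
Qed.

Lemma equivariantX (m : G -> L) a b j : equivariant m -> a \in S -> b \in S ->
  m b ^+ j * m a * (m b ^+ j)^-1 = m (b ^+ j * a * (b ^+ j)^-1).
Proof.
move=> mE aS bS; elim: j => [|j IHj]; first by rewrite !invg1 !mulg1 !mul1g.
rewrite !expgS !invMg; transitivity (m b * (m b ^+ j * m a * (m b ^+ j)^-1) * (m b)^-1).
  by rewrite !mulgA.
by rewrite IHj mE ?pointsC_conj // !mulgA.
Qed.

Fact equivariant_shift (m : {ffun G -> L}) : equivariantb m ->
  equivariantb [ffun a => m (starG Fr a) ^+ q].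
Proof.
move=> /equivariantbP mE; apply/equivariantbP => a b aS bS; rewrite !ffunE.
have [aS' bS'] := (pointsC_star Fr aS, pointsC_star Fr bS).
rewrite starG_conj -(star_frob charF z0P aG (tG tameG)) -/(starG Fr b).
rewrite -(equivariantX _ mE) //; set x := m _; set y := m _.
exact: (gmorphX (@conj_morph L (x ^+ q)) y q).
Qed.

Definition all_maps : finType := {m : {ffun G -> L} | equivariantb m}.

Definition shift_map (m : all_maps) : all_maps :=
  exist (fun m => is_true (equivariantb m)) _ (equivariant_shift (valP m)).

(** The Frobenius acts on equivariant maps to [L] by [shift_map], hence on the power
    of [L] indexed by all of them, whereas a single map need not be compatible with any
    endomorphism of [L]. *)
Definition univ : finGroupType := power_group all_maps L.
Definition univ_ev (a : G) : univ := [ffun m : all_maps => val m a].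
Definition univ_sigma (f : univ) : univ := [ffun m : all_maps => coord (shift_map m) f].

Lemma univ_evE : equivariant univ_ev.
Proof.
move=> a b aS bS; apply/ffunP => m; rewrite !ffunE.
by have /equivariantbP := valP m; apply.
Qed.

Lemma univ_sigmaM : {morph univ_sigma : f g / f * g}.
Proof. by move=> f g; apply/ffunP => m; rewrite !ffunE coordM. Qed.

Lemma univ_sigma_ev a : a \in S -> univ_sigma (univ_ev a) = univ_ev (starG Fr a) ^+ q.
Proof.
move=> aS; apply: power_groupP => m; rewrite coordX /coord !ffunE /coord !ffunE /=.
by [].
Qed.

End UniversalLevel.

Lemma Zp_pow_eq N i j : (inZp 1 : 'I_N.+1) ^+ i = inZp 1 ^+ j -> i = j %[mod N.+1].
Proof.
have e n : nat_of_ord ((inZp 1 : 'I_N.+1) ^+ n) = (n %% N.+1)%N.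
  by rewrite Zp_expg /= modnMml mul1n.
by move=> ij; rewrite -!e ij.
Qed.

(** With values in a cyclic group, so that products over words count letters modulo
    [N.+1]. *)
Definition class_indicator N (E : {set G}) (a : G) : 'I_N.+1 :=
  inZp 1 ^+ ((E \in classesC) && (a \in E)).

Lemma class_indicator_equivariant N E : equivariant (class_indicator N E).
Proof.
move=> a b aS bS; rewrite [class_indicator N E b * _]Zp_mulgC mulgK /class_indicator; congr (_ ^+ nat_of_bool _).
case: (boolP (E \in classesC)) => //= /classesC_eq Ecl.
apply/idP/idP => aE.
  by rewrite (Ecl _ aE); apply/imsetP; exists b^-1; rewrite ?inE // conjgE invgK mulgA.
rewrite (Ecl _ aE); apply/imsetP; exists b; rewrite ?inE // conjgE.
by rewrite -!mulgA mulVg mulg1 mulKg.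
Qed.

Lemma class_indicator_prod N E (w : seq G) : E \in classesC ->
  \prod_(a <- w) class_indicator N E a = inZp 1 ^+ count (mem E) w.
Proof.
move=> Ecl; elim: w => [|a w IHw]; first by rewrite big_nil.
by rewrite big_cons IHw /class_indicator Ecl /= -expgnDr.
Qed.

(** The given map to [H], the projection to [G] and the class counts modulo [N] are
    the components of the equivariant maps [mp E] to [L], hence seen in [univ L]. *)
Theorem residues_to_words : word_condition charF z0P tameG C h a0 nA.
Proof.
move=> H f [//|N] pH pN fE.
pose L : finGroupType := (H * G * 'I_N.+1)%type.
pose ind := class_indicator N.
pose mp (E : {set G}) : {ffun G -> L} := [ffun a => (f a, a, ind E a)].
have mpE E : equivariantb (mp E).
  apply/equivariantbP => a b aS bS; rewrite !ffunE; congr (_, _, _); first exact: fE.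
  exact: class_indicator_equivariant.
pose mE E : all_maps L := exist (fun m => is_true (equivariantb m)) _ (mpE E).
pose T : finGroupType := power_group {set G} 'I_N.+1.
pose R (u : univ L) : T := [ffun E => (coord (mE E) u).2].
pose pi (u : univ L) : G := (coord (mE finset.set0) u).1.2.
pose th (u : univ L) : H := (coord (mE finset.set0) u).1.1.
have piM : {morph pi : u v / u * v} by move=> u v; rewrite /pi coordM.
have thM : {morph th : u v / u * v} by move=> u v; rewrite /th coordM.
have RM : {morph R : u v / u * v}.
  by move=> u v; apply: power_groupP => E; rewrite coordM /coord !ffunE -/(coord _ _) coordM.
have evm E a : coord (mE E) (univ_ev L a) = (f a, a, ind E a).
  by rewrite /coord !ffunE.
have pi_ev a : a \in S -> pi (univ_ev L a) = a by rewrite /pi evm.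
have th_ev a : th (univ_ev L a) = f a by rewrite /th evm.
have R_ev E a : coord E (R (univ_ev L a)) = ind E a by rewrite /coord ffunE evm.
have TC (x y : T) : x * y = y * x.
  by apply: power_groupP => E; rewrite !coordM Zp_mulgC.
have pG : prime_to p #|G| by rewrite /prime_to coprime_sym tameG andbT; apply/card_gt0P; exists 1.
have pp := p_prime charF.
have pT : prime_to p #|T| by apply: power_group_prime; rewrite ?card_ord.
have pU : prime_to p #|univ L|.
  apply: power_group_prime => //; rewrite card_prod prime_toM card_ord pN andbT.
  by rewrite card_prod prime_toM pH.
have [k0 [u [k0A k0h uA [pu su Ru]]]] := level_solution algK genC (@univ_evE L)
  (@univ_sigmaM L) (@univ_sigma_ev L) piM pi_ev TC RM pU pT a0F no_obstruction.
have [w wS uE] := level_word uA.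
have wSa a : a \in w -> a \in S by move=> aw; apply: (allP wS).
exists w; split=> //.
- have thE : th (\prod_(a <- w) univ_ev L a) = \prod_(a <- w) f a.
    by rewrite (big_morph th thM (gmorph1 thM)); apply: eq_bigr => a _; apply: th_ev.
  have := congr1 th su; rewrite (gmorphX thM) uE thE => <-.
  have -> : k0^-1 * (\prod_(a <- w) univ_ev L a) * k0 =
      \prod_(a <- w) univ_ev L (h^-1 * a * h).
    rewrite -{2}[k0]invgK (big_morph _ (@conj_morph _ k0^-1) (gmorph1 (@conj_morph _ k0^-1))).
    apply: eq_big_seq => a /wSa aS.
    rewrite (level_conj (@univ_evE L) piM pi_ev) ?groupV // (gmorphV piM) k0h invgK //.
  rewrite (big_morph _ (@univ_sigmaM L) (gmorph1 (@univ_sigmaM L))).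
  rewrite (big_morph th thM (gmorph1 thM)); apply: eq_big_seq => a /wSa aS.
  have aS' : h^-1 * a * h \in S by rewrite -{2}[h]invgK pointsC_conj.
  by rewrite univ_sigma_ev // (gmorphX thM) th_ev.
- rewrite -pu uE (big_morph pi piM (gmorph1 piM)).
  by apply: eq_big_seq => a /wSa aS; rewrite pi_ev.
move=> E Ecl; have := congr1 (coord E) Ru; rewrite uE.
rewrite (big_morph R RM (gmorph1 RM)) !(big_morph _ (@coordM _ _ E) (@coord1 _ _ E)).
have -> : \prod_(a <- w) coord E (R (univ_ev L a)) = (inZp 1 : 'I_N.+1) ^+ count (mem E) w.
  by rewrite -class_indicator_prod //; apply: eq_bigr => a _; rewrite R_ev.
have -> : \prod_(A in classesC) coord E (R (univ_ev L (repr A)) ^+ nA A) = (inZp 1 : 'I_N.+1) ^+ nA E.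
  have -> : nA E = (\sum_(A in classesC) (repr A \in E) * nA A)%N.
    rewrite (bigD1 E) //= (classesC_repr Ecl) mul1n big1 ?addn0 // => A /andP[Acl AE].
    case: (boolP (repr A \in E)) => // rE; case/eqP: AE.
    by rewrite (classesC_eq Ecl rE) -(classesC_eq Acl (classesC_repr Acl)).
  rewrite (big_morph (fun k => (inZp 1 : 'I_N.+1) ^+ k) (expgnDr _) (expg0 _)).
  by apply: eq_bigr => A _; rewrite coordX R_ev /ind /class_indicator Ecl /= -expgnA.
exact: Zp_pow_eq.
Qed.

End ResiduesToWords.

(** * Finite quotients of the group of symbols *)

Section Realizations.
Local Open Scope group_scope.
Variables (F : finFieldType) (K : closedFieldType) (iota : {rmorphism F -> K}).
Hypothesis algK : forall x : K, algebraicOver iota x.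
Variable p : nat.
Hypothesis charF : p \in [pchar F].
Local Notation q := #|F|.
Local Notation Fr := (frob iota charF).
Local Notation Z1 := (Zhat1 p K).
Variables (z0 : Z1) (z0P : forall n, prime_to p n -> n.-primitive_root (z0 n)).
Variables (G : finGroupType) (aG : etale_action iota G) (tameG : coprime #|G| p).
Variable C : conj_subscheme p aG.
Local Notation starG := (starG z0P aG tameG).
Local Notation S := (pointsC z0P tameG C).
Local Notation classesC := (classesC z0P tameG C).
Local Notation cls := (@cls K p z0 G).
Local Notation equivariant := (equivariant z0P tameG C).
Variables (P : torsor aG) (x0 : P).
Local Notation X := (twistG P).
Local Notation CX := (twist_subscheme P C).
Local Notation aX := (twistG_action P).

Let id_surj (g : G) : exists e : G, id e = g. Proof. by exists g. Qed.
Let id_conj (e e' b : G) : id e = id e' -> e^-1 * b * e = e'^-1 * b * e'.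
Proof. by move=> ->. Qed.

Lemma twistG_ev_inj (f f' : X) : f x0 = f' x0 -> f = f'.
Proof. exact: (@twist_eval_inj F K iota G aG P x0 G id id_surj). Qed.

Lemma twistG_ev_surj (a : G) : exists f : X, f x0 = a.
Proof. exact: (@twist_eval_surj F K iota G aG P x0 G id id_surj id_conj (fun x y => erefl) a). Qed.

Definition frame_inv (a : G) : X := sval (cid (twistG_ev_surj a)).

Lemma frame_invE a : frame_inv a x0 = a.
Proof. exact: svalP (cid (twistG_ev_surj a)). Qed.

Lemma frame_invM : {morph frame_inv : a b / a * b}.
Proof. by move=> a b; apply: twistG_ev_inj; rewrite twistM !frame_invE. Qed.

Lemma twistG_torsion : torsion_prime_to p X.
Proof. exact: (@twist_torsion F K iota G aG P x0 G id id_surj p (tG tameG)). Qed.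

(** Evaluation at [z0] and at the point [x0] of the torsor identifies the cocharacters
    of the twisted group with the elements of [G]; the inverse is [symbol]. *)
Definition base_value (g : cochar p K X) : G := g z0 x0.
Local Notation rho := base_value.

Definition symbol (a : G) : cochar p K X := coch z0P twistG_torsion (frame_inv a).

Lemma symbolE a : rho (symbol a) = a.
Proof. by rewrite /base_value /symbol cochE frame_invE. Qed.

Lemma base_value_inj : injective rho.
Proof. by move=> g g' e; apply: (cochar_inj z0P); apply: twistG_ev_inj. Qed.

Lemma symbolK g : symbol (rho g) = g.
Proof. by apply: base_value_inj; rewrite symbolE. Qed.

Lemma rhoE g : rho g = cochar_ev x0 g z0. Proof. by []. Qed.

Lemma conj_class_frame (A : set (cochar p K G)) (g : cochar p K X) :
  (forall x h, A h -> A (cochar_conj x h)) -> (twist_set A : set (cochar p K X)) g <-> A (cochar_ev x0 g).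
Proof.
move=> Aconj; split=> [/(_ x0)//|A0 x].
have [e ->] := @torsor_translate F K iota G aG P x0 G id id_surj x.
have -> : cochar_ev (t_act x0 e) g = cochar_conj e^-1 (cochar_ev x0 g).
  apply: cochar_eq => z /=; rewrite /twistG_ev invgK.
  exact: (twistP (g z)).
exact: Aconj.
Qed.

Lemma points_frame g : cs_set CX g <-> rho g \in S.
Proof.
rewrite rhoE pointsCE; split=> [Cg|/asboolP Cg]; first by apply/asboolP/Cg.
by apply/(conj_class_frame _ (@cs_conj _ _ _ _ _ _ C)).
Qed.

Lemma symbol_mem a : a \in S -> cs_set CX (symbol a).
Proof. by move=> aS; apply/points_frame; rewrite symbolE. Qed.

Lemma base_value_conj f g : rho (cochar_conj f g) = f x0 * rho g * (f x0)^-1.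
Proof.
rewrite -[LHS]/((f * g z0 * f^-1) x0) !twistM; congr (_ * _).
by apply: (@mulgI _ (f x0)); rewrite -twistM !mulgV ffunE.
Qed.

Variable h : G.
Hypothesis hP : t_gal Fr^-1 x0 = t_act x0 h.
Local Notation tw := (twisted_frob charF z0P aG tameG h).

Lemma base_value_frob g : rho (gal_cochar aX Fr g) = tw (rho g).
Proof.
rewrite /twisted_frob /starG /star /base_value.
have -> : coch z0P (tG tameG) (h^-1 * g z0 x0 * h) = cochar_conj h^-1 (cochar_ev x0 g).
  by apply: (cochar_inj z0P); rewrite cochE /= invgK.
rewrite [LHS](twist_act_frame (fun s e => erefl) _ hP) /=; congr (aG Fr _).
by rewrite invgK.
Qed.

Lemma tw_mem a : a \in S -> tw a \in S.
Proof. by move=> aS; apply/pointsC_star; rewrite -{2}[h]invgK pointsC_conj. Qed.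

Lemma torsion_dvd (H : finGroupType) (x : H) : x ^+ #|H| = 1.
Proof. by rewrite -cardsT expg_cardG ?inE. Qed.

(** The power law determines the symbols at all generators [z] from those at [z0], so
    an equivariant map to a finite group defines a realization. *)
Section MapToRealization.
Variables (H : finGroupType) (mu : G -> H).
Hypotheses (pH : prime_to p #|H|) (muE : equivariant mu).

Definition real_sym (g : cochar p K X) (z : Z1) : H := mu (rho g) ^+ zlog z0 z #|H|.

Lemma zlog_zpow (l : Zhat_unit p) z n : prime_to p n ->
  zlog z0 (zpow l z) n = zlog z0 z n * l n %[mod n].
Proof. by move=> pn; apply: (zlog_eq z0P) => //=; rewrite (zlogE z0P z pn) exprM. Qed.

Fact real_pow g : cs_set CX g -> forall z, topgen z -> forall l : Zhat_unit p,
  real_sym g (zpow l z) = real_sym g z ^+ l #|H|.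
Proof.
move=> _ z _ l; rewrite /real_sym -expgnA.
by apply: expg_eqmod (torsion_dvd _) _; apply: zlog_zpow.
Qed.

Fact real_conj x g : cs_set CX x -> cs_set CX g -> forall y z, topgen y -> topgen z ->
  real_sym x y * real_sym g z * (real_sym x y)^-1 = real_sym (cochar_conj (x y) g) z.
Proof.
move=> /points_frame xS /points_frame gS y z _ _; rewrite /real_sym base_value_conj.
have pG := tame_prime_to tameG.
have pGH : prime_to p (#|G| * #|H|) by rewrite prime_toM pG.
have -> : mu (rho x) ^+ zlog z0 y #|H| = mu (rho x) ^+ zlog z0 y (#|G| * #|H|).
  apply: expg_eqmod (torsion_dvd _) _; apply/esym/(zlog_mod z0P) => //.
  exact: dvdn_mull.
have -> : x y x0 = rho x ^+ zlog z0 y (#|G| * #|H|).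
  rewrite -[x y x0]/(cochar_ev x0 x y) rhoE.
  rewrite (cochar_val z0P pG (torsion_dvd _) (zlogE z0P y pG)).
  apply: expg_eqmod (torsion_dvd _) _; apply/esym/(zlog_mod z0P) => //.
  exact: dvdn_mulr.
rewrite -(equivariantX _ muE) //.
exact: (gmorphX (@conj_morph H (mu (rho x) ^+ zlog z0 y (#|G| * #|H|)))
  (mu (rho g)) (zlog z0 z #|H|)).
Qed.

Definition realize : realization CX := Realization pH real_pow real_conj.

Lemma realize_z0 g : r_sym realize g z0 = mu (rho g).
Proof. by rewrite /= /real_sym (expg_eqmod (torsion_dvd _) (zlog1 z0P pH)). Qed.

End MapToRealization.

Definition real_map (r : realization CX) (a : G) : r := r_sym r (symbol a) z0.

Lemma z0_topgen : topgen z0. Proof. exact: zeta_topgen. Qed.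

Lemma real_mapE (r : realization CX) g : r_sym r g z0 = real_map r (rho g).
Proof. by rewrite /real_map symbolK. Qed.

Lemma real_map_equivariant (r : realization CX) : equivariant (real_map r).
Proof.
move=> a b aS bS; rewrite /real_map r_conj; try exact: symbol_mem; try exact: z0_topgen.
congr (r_sym r _ z0); apply: base_value_inj.
rewrite base_value_conj !symbolE; congr (_ * _ * _^-1); exact: (symbolE b).
Qed.

(** The property of a family of elements indexed by the symbols that makes it
    determined by its values at [z0]. *)
Definition power_law (Y : groupType) (f : cochar p K X -> Z1 -> Y) : Prop :=
  forall g, cs_set CX g -> exists N, [/\ prime_to p N, f g z0 ^+ N = 1
    & forall z, topgen z -> f g z = f g z0 ^+ zlog z0 z N].

Lemma real_power_law (r : realization CX) : power_law (r_sym r).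
Proof.
move=> g Cg; exists #|r|; split; [exact: r_prime|exact: torsion_dvd|].
move=> z zt; have [l zE] := topgen_zpow z0P zt; rewrite {1}zE r_pow //; last exact: z0_topgen.
apply: expg_eqmod (torsion_dvd _) _.
by rewrite zE; apply/esym/(zlog_eq z0P); rewrite //= ?r_prime.
Qed.

Lemma extends_at_z0 (Y : groupType) (f : cochar p K X -> Z1 -> Y) (r : realization CX)
    (th : r -> Y) : {morph th : x y / x * y} -> power_law f ->
  (forall a, a \in S -> th (real_map r a) = f (symbol a) z0) -> extends_sym f th.
Proof.
move=> thM fP thE; split=> // g Cg z zt.
have gS : rho g \in S by apply/points_frame.
have e0 : th (r_sym r g z0) = f g z0 by rewrite real_mapE thE // symbolK.
have [N [pN fN fz]] := fP g Cg; have [M [pM rM rz]] := @real_power_law r g Cg.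
have th1 : th 1 = 1 by apply: (@mulgI _ (th 1)); rewrite -thM !mulg1.
have thX x k : th (x ^+ k) = th x ^+ k.
  by elim: k => [|k IHk]; rewrite ?th1 // !expgS thM IHk.
rewrite rz // fz // thX e0.
have fM : f g z0 ^+ M = 1 by rewrite -e0 -thX rM th1.
have pNM : prime_to p (N * M) by rewrite prime_toM pN.
rewrite -(expg_eqmod fM (zlog_mod z0P z pNM (dvdn_mull N (dvdnn M)))).
by rewrite (expg_eqmod fN (zlog_mod z0P z pNM (dvdn_mulr M (dvdnn N)))).
Qed.

(** The value of a point of the profinite group in a realization is a product of
    symbols: the subgroup that they generate is a realization too. *)
Lemma value_word (u : Uhat1 CX) (r : realization CX) :
  exists2 w, all (mem S) w & u r = \prod_(a <- w) real_map r a.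
Proof.
pose A : {group r} := <<[set real_map r a | a in S]%SET>>%G.
have rA a : a \in S -> real_map r a \in A by move=> aS; apply/mem_gen/imset_f.
pose nu (a : G) : [subg A] := subg A (real_map r a).
have nuE : equivariant nu.
  move=> a b aS bS; apply: val_inj.
  rewrite -[LHS]/(sgval (nu b) * sgval (nu a) * (sgval (nu b))^-1) -[RHS]/(sgval (nu (b * a * b^-1))).
  by rewrite !subgK ?rA ?pointsC_conj // real_map_equivariant.
have pA : prime_to p #|{: [subg A]}|.
  have := r_prime r; rewrite -cardsT => pr.
  have cA : #|{: [subg A]}| = #|A| by rewrite card_sub; apply: eq_card => x; rewrite !inE.
  have /dvdnP[k kE] := cardSg (finset.subsetT A); rewrite cA.
  by move: pr; rewrite kE prime_toM => /andP[].
have ext : extends_sym (r_sym r) (@sgval r A : realize pA nuE -> r).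
  apply: extends_at_z0 => //; first exact: real_power_law.
  by move=> a aS; rewrite /real_map realize_z0 symbolE subgK ?rA.
have uA : u r \in A by rewrite -(ucomp_nat u ext) subgP.
by have [w wS uE] := level_word (ev := real_map r) uA; exists w.
Qed.

Local Notation indicator := (class_indicator z0P tameG C).

Lemma uhatX (u : Uhat CX) z k r : u (z ^+ k) r = u z r ^+ k.
Proof.
have u1 : u 1 r = 1 by apply: (@mulgI _ (u 1 r)); rewrite -UhatM !mulg1.
by elim: k => [|k IHk]; rewrite ?u1 // !expgS UhatM IHk.
Qed.

Lemma value_transport (v : Uhat1 CX) (r r' : realization CX) (f : r -> r') :
  {morph f : x y / x * y} -> (forall a, a \in S -> f (real_map r a) = real_map r' a) ->
  f (v r) = v r'.
Proof.
move=> fM fE; apply: ucomp_nat; apply: extends_at_z0 => //.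
exact: real_power_law.
Qed.

Lemma twisted_shift_equivariant (L : finGroupType) (mu : G -> L) : equivariant mu ->
  equivariant (fun a => mu (tw a) ^+ q).
Proof.
move=> mE a b aS bS; have [aS' bS'] := (tw_mem aS, tw_mem bS).
have -> : tw (b * a * b^-1) = tw b ^+ q * tw a * (tw b ^+ q)^-1.
  rewrite /twisted_frob (star_frob charF z0P aG (tG tameG)) -starG_conj; congr (starG _ _).
  by rewrite !invMg !invgK !mulgA !mulgK.
rewrite -(equivariantX _ mE) //; set x := mu _; set y := mu _.
exact: (gmorphX (@conj_morph L (x ^+ q)) y q).
Qed.

Lemma realize_map (H : finGroupType) (mu : G -> H) (pH : prime_to p #|H|)
  (muE : equivariant mu) a : real_map (realize pH muE) a = mu a.
Proof. by rewrite /real_map realize_z0 symbolE. Qed.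

Fact id_equivariant : equivariant (fun a : G => a). Proof. by []. Qed.

(** The twisted group itself, in the frame [x0]. *)
Definition identity_realization : realization CX :=
  realize (tame_prime_to tameG) id_equivariant.

Lemma identity_extends :
  extends_sym (fun g z => g z) (frame_inv : identity_realization -> X).
Proof.
apply: extends_at_z0; first exact: frame_invM.
  move=> g _; have [M pM gM] := cochar_torsion z0P g; exists M; split=> // z _.
  exact: (cochar_val z0P pM gM (zlogE z0P z pM)).
by move=> a _; rewrite realize_map /symbol cochE.
Qed.

(** Frobenius acts on [z0] by the power [q], and on the indices by [tw]. *)
Lemma real_map_frob (r : realization CX) a : a \in S ->
  real_map (rgal Fr r) a = real_map r (tw a) ^+ q.
Proof.
move=> aS; have CF : cs_set CX (gal_cochar aX Fr (symbol a)) by apply/cs_gal/symbol_mem.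
have Ft : topgen (gal_zhat Fr z0) by apply/gal_topgen/z0_topgen.
rewrite -[LHS]/(r_sym r (gal_cochar aX Fr (symbol a)) (gal_zhat Fr z0)).
have [l lE] := topgen_zpow z0P Ft; rewrite lE r_pow //; last exact: z0_topgen.
rewrite real_mapE base_value_frob symbolE; apply: expg_eqmod (torsion_dvd _) _.
have pr := r_prime r.
have := zlog_eq z0P pr (_ : gal_zhat Fr z0 #|r| = (z0 #|r| ^+ l #|r|)%R).
rewrite {1}lE /= => /(_ erefl) <-.
by apply: (zlog_eq z0P).
Qed.

Fact ord_prime N : prime_to p N.+1 -> prime_to p #|'I_N.+1|.
Proof. by rewrite card_ord. Qed.

Definition indicator_realization N (E : {set G}) (pN : prime_to p N.+1) : realization CX :=
  realize (ord_prime pN) (@class_indicator_equivariant _ _ _ _ _ z0P _ _ tameG C N E).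

(** The component of [R] at a class has values in an infinite group of roots of unity;
    at a finite level it factors through a cyclic realization. *)
Lemma indicator_extends N E (Ecl : E \in classesC) (pN : prime_to p N.+1) :
  exists th : indicator_realization E pN -> muinf p K,
    extends_sym (fun g z => if `[< (twist_set (cls E) : set (cochar p K X)) g >]
      then zroot z N.+1 else 1) th /\
    forall k, th ((inZp 1 : 'I_N.+1) ^+ k) = zroot z0 N.+1 ^+ k.
Proof.
pose th (i : 'I_N.+1) : muinf p K := zroot z0 N.+1 ^+ nat_of_ord i; exists th.
have zN : zroot z0 N.+1 ^+ N.+1 = 1.
  by apply: val_inj; rewrite [LHS]muexpE /= (prim_expr_order (z0P pN)).
have thM : {morph th : x y / x * y}.
  by move=> x y; rewrite /th -expgnDr; apply: expg_eqmod zN _; rewrite /= modn_mod.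
have th1 k : th (inZp 1 ^+ k) = zroot z0 N.+1 ^+ k.
  by apply: expg_eqmod zN _; rewrite Zp_expg /= modnMml mul1n modn_mod.
have clsP (g : cochar p K X) : (twist_set (cls E) : set (cochar p K X)) g <-> rho g \in E.
  apply: conj_class_frame => x f; rewrite /cls /= => fE.
  by rewrite (classesC_eq Ecl fE); apply/imsetP; exists x^-1; rewrite ?inE // conjgE invgK mulgA.
split=> //; apply: extends_at_z0 => //.
  move=> g _; exists N.+1; case: asboolP => _; split; rewrite ?expg1n // => z _.
    by apply: val_inj; rewrite [RHS]muexpE; apply: (zlogE z0P).
  by rewrite expg1n.
move=> a _; rewrite realize_map /class_indicator Ecl /= th1.
have -> : (a \in E) = `[< (twist_set (cls E) : set (cochar p K X)) (symbol a) >].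
  by apply/idP/asboolP => [aE|/clsP]; [apply/clsP|]; rewrite symbolE.
by case: asboolP.
Qed.

(** * Words from a rational point *)

Section PointsToWords.
Variables (gamma : cochar p K X) (n : set (cochar p K G) -> nat).

(** The group [H] with the map [mu] and with its Frobenius shift, the twisted group
    and the cyclic groups of the class counts are realizations, so one word in their
    product approximates all the data of a point at once. *)
Theorem points_to_words (u : Uhat CX) : U_point n gamma u ->
  word_condition charF z0P tameG C h (rho gamma) (fun A => n (cls A)).
Proof.
move=> [uF uR ug] H mu [//|N] pH pN muE.
pose T : finGroupType := power_group {set G} 'I_N.+1.
pose indT a : T := [ffun E => indicator N E a].
pose L : finGroupType := (H * H * G * T)%type.
pose nu a : L := (mu a, mu (tw a) ^+ q, a, indT a).
have pG := tame_prime_to tameG.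
have pp := p_prime charF.
have pI : prime_to p #|'I_N.+1| by rewrite card_ord.
have pL : prime_to p #|L|.
  by rewrite !card_prod !prime_toM pH pG power_group_prime.
have nuE : equivariant nu.
  move=> a b aS bS; congr (_, _, _, _); first exact: muE.
  - exact: twisted_shift_equivariant.
  apply: power_groupP => E; rewrite !coordM /coord !ffunE.
  exact: class_indicator_equivariant.
pose r := realize pL nuE; have [w wS uw] := value_word (u z0) r.
have wE (Y : finGroupType) (f : r -> Y) (g : G -> Y) : {morph f : x y / x * y} ->
    (forall a, f (nu a) = g a) -> f (u z0 r) = \prod_(a <- w) g a.
  move=> fM fE; rewrite uw (big_morph f fM (gmorph1 fM)).
  by apply: eq_bigr => a _; rewrite realize_map fE.
exists w; split=> //.
- pose rm := realize pH muE.
  have e1 : u z0 rm = \prod_(a <- w) mu a.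
    rewrite -(@value_transport (u z0) r (rm) (fun x : L => x.1.1.1)) //.
      exact: (wE H (fun x => x.1.1.1)).
    by move=> a aS; rewrite !realize_map.
  have e2 : u z0 (rgal Fr rm) = \prod_(a <- w) mu (tw a) ^+ q.
    rewrite -(@value_transport (u z0) r (rgal Fr rm) (fun x : L => x.1.1.2)) //.
      exact: (wE H (fun x => x.1.1.2)).
    by move=> a aS; rewrite real_map_frob // !realize_map.
  have := congr1 (fun v : Uhat1 CX => v rm) (uF Fr (gal_zhat Fr z0)).
  by rewrite gal_zhatK (gal_zhat_frob iota charF) uhatX e1 -e2.
- pose rg := identity_realization.
  have e1 : u z0 rg = \prod_(a <- w) a.
    rewrite -(@value_transport (u z0) r (rg) (fun x : L => x.1.2)) //.
      exact: (wE G (fun x => x.1.2)).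
    by move=> a aS; rewrite !realize_map.
  have := ug z0; rewrite /U_to_cochar (UevalE _ identity_extends) e1 => e2.
  have := congr1 (fun f : X => f x0) e2; rewrite frame_invE => ->.
  by apply: (@mulgI _ (gamma z0 x0)); rewrite -twistM !mulgV ffunE.
move=> E Ecl; pose rE := indicator_realization E pN.
have e1 : u z0 rE = \prod_(a <- w) indicator N E a.
  rewrite -(@value_transport (u z0) r (rE) (fun x : L => coord E x.2)).
  - by apply: (wE _ (fun x => coord E x.2)) => [x y|a]; rewrite /= ?coordM // /coord ffunE.
  - by move=> x y; rewrite /= coordM.
  by move=> a aS; rewrite !realize_map /coord ffunE.
have [th [ext th1]] := indicator_extends Ecl pN.
have cE : geom_classes C (cls E) by rewrite (geom_classesE z0P tameG); exists E.
have := uR _ cE z0 N.+1 pN; rewrite /Rcomp (UevalE _ ext) e1 class_indicator_prod // th1.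
move/(zroot_eq z0P _ _ pN pN); rewrite -!muln_modl => /eqP.
by rewrite eqn_pmul2r // => /eqP.
Qed.

End PointsToWords.

(** * A rational point from words *)

Section WordsToPoints.
Variables (gamma : cochar p K X) (n : set (cochar p K G) -> nat).
Hypothesis words :
  word_condition charF z0P tameG C h (rho gamma) (fun A => n (cls A)).

Definition approximations (r : realization CX) N : set (seq G) :=
  [set w | [/\ all (mem S) w,
    \prod_(a <- w) real_map r (tw a) ^+ q = (\prod_(a <- w) real_map r a) ^+ q,
    \prod_(a <- w) a = (rho gamma)^-1
    & forall E, E \in classesC -> count (mem E) w = n (cls E) %[mod N]]].

Lemma approximations_sub (r r' : realization CX) N N' (th : r -> r') :
  {morph th : x y / x * y} -> (forall a, th (real_map r a) = real_map r' a) ->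
  (N' %| N)%N -> approximations r N `<=` approximations r' N'.
Proof.
move=> thM thE NN w [wS wF wa wn]; split=> // [|E Ecl].
  have := congr1 th wF; rewrite (gmorphX thM) !(big_morph th thM (gmorph1 thM)).
  have -> : \prod_(a <- w) th (real_map r a) = \prod_(a <- w) real_map r' a.
    by apply: eq_bigr.
  by move=> <-; apply: eq_bigr => a _; rewrite (gmorphX thM) thE.
by rewrite -[LHS](modn_dvdm _ NN) (wn E Ecl) modn_dvdm.
Qed.

(** Products of realizations are realizations, so the sets of approximations
    generate a proper filter. *)
Lemma approximations_ultrafilter : exists2 U : set_system (seq G), UltraFilter U &
  forall r N, prime_to p N -> U (approximations r N).
Proof.
pose W : set_system (seq G) :=
  [set A | exists r N, prime_to p N /\ approximations r N `<=` A].
have pG := tame_prime_to tameG.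
have oneE : equivariant (fun _ : G => (1 : G)) by move=> a b _ _; rewrite !mul1g invg1.
have WF : ProperFilter W.
  apply: Build_ProperFilter_ex.
    move=> A [r [N [pN AW]]].
    by have [w wP] := words (r_prime r) pN (@real_map_equivariant r); exists w; apply: AW.
  split.
  - by exists (realize pG oneE), 1%N; split=> //; apply: prime_to1.
  - move=> A B [r [N [pN AW]]] [r' [N' [pN' BW]]].
    pose L : finGroupType := (r * r')%type.
    pose nu a : L := (real_map r a, real_map r' a).
    have nuE : equivariant nu.
      by move=> a b aS bS; congr (_, _); apply: real_map_equivariant.
    have pL : prime_to p #|L| by rewrite card_prod prime_toM !r_prime.
    have sub := @approximations_sub (realize pL nuE).
    exists (realize pL nuE), (N * N')%N; split; first by rewrite prime_toM pN.
    move=> w wP; split.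
      apply: AW; apply: (sub r _ _ (fun x : L => x.1) _ _ _ w wP) => // [a|].
        by rewrite realize_map.
      exact: dvdn_mulr.
    apply: BW; apply: (sub r' _ _ (fun x : L => x.2) _ _ _ w wP) => // [a|].
      by rewrite realize_map.
    exact: dvdn_mull.
  by move=> A B AB [r [N [pN AW]]]; exists r, N; split=> //; apply: subset_trans AB.
have [U [UU sU]] := ultraFilterLemma WF.
exists U; first exact: UU.
by move=> r N pN; apply: sU; exists r, N; split.
Qed.

Let ultra := cid2 approximations_ultrafilter.
Let U : set_system (seq G) := s2val ultra.
Let UU : UltraFilter U. Proof. exact: s2valP ultra. Qed.
#[local] Existing Instance UU.
Let Uapprox r N : prime_to p N -> U (approximations r N). Proof. exact: (s2valP' ultra r N). Qed.

Let approx (r : realization CX) (w : seq G) : r := \prod_(a <- w) real_map r a.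

Let lim_ex (r : realization CX) : exists x : r, U [set w | approx r w = x].
Proof.
have [|x _ Ux] := @ultra_limit (seq G) U r (approx r) (enum r) UU; last by exists x.
by apply: filterS (Uapprox r (prime_to1 p)) => w _ /=; rewrite mem_enum.
Qed.

(** The component of the profinite point in [r]. *)
Let lim (r : realization CX) : r := sval (cid (lim_ex r)).
Let limP r : U [set w | approx r w = lim r]. Proof. exact: svalP (cid (lim_ex r)). Qed.

Let lim_eq (r : realization CX) (x : r) r0 N : prime_to p N ->
  (forall w, approximations r0 N w -> approx r w = x) -> lim r = x.
Proof.
move=> pN ax; have [w [/= <- /ax]] := filter_ex (filterI (limP r) (Uapprox r0 pN)).
by [].
Qed.

Let real_map_ext (r r' : realization CX) (th : r -> r') :
  extends_sym (r_sym r') th -> forall a, a \in S -> th (real_map r a) = real_map r' a.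
Proof. by case=> _ thE a aS; apply: thE; [apply: symbol_mem|apply: z0_topgen]. Qed.

Lemma lim_nat (r r' : realization CX) (th : r -> r') :
  {morph th : x y / x * y} -> (forall a, a \in S -> th (real_map r a) = real_map r' a) ->
  th (lim r) = lim r'.
Proof.
move=> thM thE.
have [w [[/= ar ar'] [wS _ _ _]]] :=
  filter_ex (filterI (filterI (limP r) (limP r')) (Uapprox r (prime_to1 p))).
rewrite -ar -ar' /approx (big_morph th thM (gmorph1 thM)).
by apply: eq_big_seq => a /(allP wS); apply: thE.
Qed.

Lemma lim_frob r : lim (rgal Fr r) = lim r ^+ q.
Proof.
have [w [[/= aF ar] [wS wF _ _]]] := filter_ex
  (filterI (filterI (limP (rgal Fr r)) (limP r)) (Uapprox r (prime_to1 p))).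
rewrite -aF -ar -wF; apply: eq_big_seq => a /(allP wS).
exact: real_map_frob.
Qed.

(** The value of the point at [z] is the power of its value at [z0] with exponent the
    logarithm of [z]; these are compatible, like the limits themselves. *)
Fact point_nat z (r r' : realization CX) (th : r -> r') : extends_sym (r_sym r') th ->
  th (lim r ^+ zlog z0 z #|r|) = lim r' ^+ zlog z0 z #|r'|.
Proof.
move=> ext; have [thM _] := ext; rewrite (gmorphX thM) (lim_nat thM (real_map_ext ext)).
have pr := r_prime r; have pr' := r_prime r'.
have prr : prime_to p (#|r| * #|r'|) by rewrite prime_toM pr.
have e1 : lim r' ^+ #|r| = 1.
  by rewrite -(lim_nat thM (real_map_ext ext)) -(gmorphX thM) torsion_dvd (gmorph1 thM).
rewrite -(expg_eqmod e1 (zlog_mod z0P z prr (dvdn_mulr _ (dvdnn _)))).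
by rewrite (expg_eqmod (torsion_dvd _) (zlog_mod z0P z prr (dvdn_mull _ (dvdnn _)))).
Qed.

Definition point_comp (z : Z1) : Uhat1 CX := MkUhat1 (point_nat z).

Fact pointM z w r : point_comp (z * w) r = point_comp z r * point_comp w r.
Proof.
rewrite /= -expgnDr; apply: expg_eqmod (torsion_dvd _) _.
exact: (zlogM z0P _ _ (r_prime r)).
Qed.

Fact point_cont r : zcontinuous (fun z => point_comp z r).
Proof.
exists #|r|; first exact: r_prime.
move=> z w zw /=; apply: expg_eqmod (torsion_dvd _) _.
by apply: (zlog_eq z0P (r_prime r)); rewrite zw; apply: (zlogE z0P _ (r_prime r)).
Qed.

Definition point : Uhat CX := MkUhat pointM point_cont.

Lemma Uhat1_eq (u v : Uhat1 CX) : (forall r, u r = v r) -> u = v.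
Proof.
case: u v => [u un] [v vn] /= uv.
have euv : u = v by apply: functional_extensionality_dep.
by case: _ / euv in vn uv *; congr MkUhat1; apply: Prop_irrelevance.
Qed.

Let galexp (s : absGal iota) (r : realization CX) := zlog z0 (gal_zhat s z0) #|r|.

Lemma zlog_gal (s : absGal iota) z m : prime_to p m ->
  zlog z0 (gal_zhat s z) m = zlog z0 (gal_zhat s z0) m * zlog z0 z m %[mod m].
Proof.
move=> pm; apply: (zlog_eq z0P pm) => /=.
by rewrite (zlogE z0P z pm) galX exprM -(zlogE z0P (gal_zhat s z0) pm).
Qed.

(** The equation expressing rationality is multiplicative in the Galois element. *)
Lemma lim_galM s t : (forall r, lim (rgal s r) = lim r ^+ galexp s r) ->
  (forall r, lim (rgal t r) = lim r ^+ galexp t r) ->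
  forall r, lim (rgal (s * t) r) = lim r ^+ galexp (s * t) r.
Proof.
move=> sP tP r; pose idr (x : rgal t (rgal s r)) : rgal (s * t) r := x.
rewrite -(@lim_nat _ _ idr) //; last first.
  move=> a aS; rewrite -[LHS]/(r_sym r (gal_cochar aX s (gal_cochar aX t (symbol a))) (gal_zhat s (gal_zhat t z0))).
  by rewrite -gal_cocharM; congr (r_sym r _ _); apply/val_inj/funext.
rewrite /idr tP sP -expgnA; apply: expg_eqmod (torsion_dvd _) _.
have e : gal_zhat (s * t) z0 = gal_zhat s (gal_zhat t z0) by apply/val_inj/funext.
by rewrite /galexp e [RHS]zlog_gal ?r_prime.
Qed.

Lemma lim_frobX j r : lim (rgal (Fr ^+ j) r) = lim r ^+ galexp (Fr ^+ j) r.
Proof.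
elim: j r => [|j IHj] r; last first.
  rewrite expgS; apply: lim_galM IHj r => r; rewrite lim_frob; apply: expg_eqmod (torsion_dvd _) _.
  by apply/esym/(zlog_eq z0P (r_prime r)).
have z1 : gal_zhat (1 : absGal iota) z0 = z0 by apply/val_inj/funext.
pose idr (x : r) : rgal 1 r := x.
rewrite /galexp z1 (expg_eqmod (torsion_dvd _) (zlog1 z0P (r_prime r))).
rewrite expg1 -[LHS](@lim_nat r (rgal 1 r) idr) // => a aS.
rewrite -[RHS]/(r_sym r (gal_cochar aX 1 (symbol a)) (gal_zhat 1 z0)) z1.
congr (r_sym r _ z0); apply: (cochar_inj z0P).
by rewrite (starE z0P aX twistG_torsion) star1.
Qed.

Lemma real_sym_log (r : realization CX) g z w : cs_set CX g -> topgen z -> topgen w ->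
  z #|r| = w #|r| -> r_sym r g z = r_sym r g w.
Proof.
move=> Cg zt wt zw; have pr := r_prime r.
have [l zE] := topgen_zpow z0P zt; have [l' wE] := topgen_zpow z0P wt.
rewrite zE wE !r_pow //; try exact: z0_topgen.
apply: expg_eqmod (torsion_dvd _) _.
apply/eqP; rewrite -(eq_prim_root_expr (z0P pr)); apply/eqP.
by move: zw; rewrite {1}zE {1}wE.
Qed.

(** Both sides only depend on the action of [s] on finitely many cocharacters and one
    root of unity, where it agrees with a power of the Frobenius. *)
Lemma lim_gal s r : lim (rgal s r) = lim r ^+ galexp s r.
Proof.
have [d d0 dP] := uniform_level algK charF (fun a : G => symbol a z0)
  (star_action z0P aX twistG_torsion).
have [l l0 lP] := finite_level algK charF [:: z0 #|r|].
have dl0 : (0 < d * l)%N by rewrite muln_gt0 d0.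
have [j sj] := frob_dense charF s dl0.
have sjz : (gal_zhat s z0) #|r| = (gal_zhat (Fr ^+ j) z0) #|r|.
  rewrite /=; apply: (agree_dvd (dvdn_mull d (dvdnn l)) sj).
  by apply: lP; rewrite mem_head.
have sjg a : gal_cochar aX s (symbol a) = gal_cochar aX (Fr ^+ j) (symbol a).
  apply: (cochar_inj z0P); rewrite !(starE z0P aX twistG_torsion).
  by apply: dP; apply: agree_dvd (dvdn_mulr _ (dvdnn d)) sj.
have -> : galexp s r = galexp (Fr ^+ j) r by rewrite /galexp /zlog sjz.
rewrite -lim_frobX; pose idr (x : rgal (Fr ^+ j) r) : rgal s r := x.
rewrite -[LHS](@lim_nat _ _ idr) // => a aS.
rewrite -[LHS]/(r_sym r (gal_cochar aX (Fr ^+ j) (symbol a)) (gal_zhat (Fr ^+ j) z0)).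
rewrite -[RHS]/(r_sym r (gal_cochar aX s (symbol a)) (gal_zhat s z0)) sjg.
apply: (@real_sym_log r) => //; try exact/gal_topgen/z0_topgen.
exact/cs_gal/symbol_mem.
Qed.

Lemma point_rational : U_rational point.
Proof.
move=> s z; apply: Uhat1_eq => r.
rewrite -[LHS]/(lim (rgal s r) ^+ zlog z0 (gal_zhat s^-1 z) #|r|) lim_gal -expgnA.
apply: expg_eqmod (torsion_dvd _) _; rewrite -zlog_gal ?r_prime //.
have {1}-> : gal_zhat s (gal_zhat s^-1 z) = z; last by [].
by apply/val_inj/funext => k; apply: galKV.
Qed.

Lemma point_base z : U_to_cochar point z = (gamma z)^-1.
Proof.
pose rg := identity_realization.
rewrite /U_to_cochar (UevalE _ identity_extends) /=.
have -> : lim rg = (rho gamma)^-1.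
  apply: (lim_eq (r0 := rg) (prime_to1 p)) => w [_ _ <- _].
  by apply: eq_bigr => a _; rewrite realize_map.
apply: twistG_ev_inj; rewrite frame_invE.
have -> : (gamma z)^-1 x0 = (gamma z x0)^-1.
  by apply: (@mulgI _ (gamma z x0)); rewrite -twistM !mulgV ffunE.
rewrite expVgn; congr (_^-1); rewrite -[RHS]/(cochar_ev x0 gamma z).
have pG := tame_prime_to tameG.
by rewrite (cochar_val z0P pG (torsion_dvd _) (zlogE z0P z pG)).
Qed.

Lemma point_value E : E \in classesC -> R_value point (twist_set (cls E)) (n (cls E)).
Proof.
move=> Ecl z [//|N] pN.
pose rE := indicator_realization E pN.
have [th [ext th1]] := indicator_extends Ecl pN.
rewrite /Rcomp (UevalE _ ext) /=.
have -> : lim rE = inZp 1 ^+ n (cls E).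
  apply: (lim_eq (r0 := rE) pN) => w [_ _ _ wn].
  transitivity (\prod_(a <- w) indicator N E a).
    by apply: eq_bigr => a _; rewrite realize_map.
  rewrite class_indicator_prod // !Zp_expg; apply: val_inj.
  by rewrite /= -[LHS]modnMmr -[RHS]modnMmr wn.
rewrite -expgnA th1; apply: val_inj; rewrite [LHS]muexpE [RHS]muexpE /=.
by rewrite (zlogE z0P z pN) -exprM card_ord mulnC.
Qed.

Theorem words_to_points : exists u : Uhat CX, U_point n gamma u.
Proof.
exists point; split; [exact: point_rational| |exact: point_base].
move=> cb; rewrite (geom_classesE z0P tameG) => -[E /= Ecl <-].
exact: point_value.
Qed.

End WordsToPoints.

End Realizations.

(** * The criterion for rational points *)

Theorem theorem3p28
  (F : finFieldType) (K : closedFieldType) (iota : {rmorphism F -> K})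
  (algK : forall x : K, algebraicOver iota x)
  (p : nat) (charF : p \in [pchar F])
  (G : finGroupType) (aG : etale_action iota G) (tameG : coprime #|G| p)
  (C : conj_subscheme p aG)
  (C1 : forall g : cochar p K G, cs_set C g -> ~ (forall z, g z = 1%g))
  (genC : generates C)
  (phi : torsor aG)
  (gamma : cochar p K (twistG phi))
  (gammaF : gal_fixed (twistG_action phi) gamma)
  (n : set (cochar p K G) -> nat)
  (nF : forall s cb, geom_classes C cb -> n (gal_class aG s cb) = n cb) :
  (exists u : Uhat (twist_subscheme phi C), U_point n gamma u) <->
  (forall beta : central_ext p aG,
     (forall c, pi0 C c -> algebraic_residue beta c) ->
     residue_at beta gamma +
       \sum_(c \in pi0 C)
         cor (field_degree c) (residue beta c) *+ n (geom_pt c)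
     = 0 :> (absGal iota -> QZ)).
Proof.
have [z0 z0P] := compatible_primitive_roots (fun n pn => prim_root_exists iota charF pn).
pose Fr := frob iota charF; have [x0 _] := t_ne phi.
have [h [hE _]] := t_simply_transitive x0 (t_gal Fr^-1%g x0).
have hP := esym hE; pose a0 : G := base_value z0 x0 gamma.
have a0F : aG Fr (h^-1 * a0 * h)%g = (a0 ^+ #|F|)%g.
  have := base_value_frob z0P tameG hP gamma; rewrite gammaF -/a0 => a0T.
  rewrite [in RHS]a0T /twisted_frob /starG.
  by rewrite (star_frob charF z0P aG (tG tameG)).
split=> [[u uP] beta alg|vanish].
  have wc := points_to_words (z0P := z0P) (tameG := tameG) hP uP; have [m mP] := lift_exists z0P tameG alg.
  have [r [-> rP]] := residue_sum_frob algK charF nF mP x0 gammaF.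
  apply: (word_residue mP _ wc) => e k eE kE.
  by apply: rP; rewrite ?kE.
apply: (words_to_points algK (z0P := z0P) (tameG := tameG) hP); 
apply: (residues_to_words algK genC a0F) => B m r mP rP.
have [r' [r'E r'P]] := residue_sum_frob algK charF nF mP x0 gammaF.
(* Both [r] and [r'] compare the Frobenius of a lift of [a0] with its power. *)
suff <- : r' = r by apply/r'E/vanish => c; apply: (lift_algebraic algK charF mP).
have [e eE] := ce_proj_surj B a0; have [k kE] := ce_proj_surj B h.
have := rP e k eE kE; rewrite (r'P e k eE _) ?kE // => /mulIg/ce_incl_inj rr.
apply: (@mulIg _ r^-1%g); rewrite mulgV; apply: (muinf_expq_inj iota charF).
by rewrite expgMn ?rr -?expgMn ?mulgV ?expg1n //; apply: muC.
Qed.
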